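(* Let $p$ be a prime with $p \equiv 1 \pmod{12}$, let $b,c$ be positive integers with $p=b^{2}+bc+c^{2}$, let $m$ be an odd integer with $3\nmid m$, and let $\mathcal Q$ be a finite self-dual directly regular $4$-polytope of type $\{\{3,6\}_{(m,0)},\{6,3\}_{(m,0)}\}$ such that $p(p^{2}-1)$ does not divide $|\Gamma(\mathcal{Q})|$. Then there exists a properly self-dual chiral $4$-polytope, whose automorphism group is isomorphic to $L_{2}(p)\times \Gamma^{+}(\mathcal{Q})$, of type $\{\{3,6\}_{(m,0)},\{6,3\}_{(m,0)}\}$ if $p\mid m$, and of type $\{\{3,6\}_{(mb,mc)},\{6,3\}_{(mb,mc)}\}$ if $p\nmid m$.
   Context: An abstract $n$-polytope is a ranked poset (ranks $-1,\dots,n$) with a least and a greatest face, all flags of size $n+2$, strongly flag-connected, and satisfying the diamond condition; $\Gamma(\mathcal P)$ is its automorphism group. $\mathcal P$ is regular if $\Gamma(\mathcal P)$ is flag-transitive, and chiral if $\Gamma(\mathcal P)$ has exactly two flag orbits with adjacent flags always in distinct orbits. For regular $\mathcal P$, $\Gamma(\mathcal P)$ is generated by involutions $\rho_0,\dots,\rho_{n-1}$; the rotation subgroup $\Gamma^+(\mathcal P)$ is generated by $\sigma_i=\rho_{i-1}\rho_i$, has index at most $2$, and $\mathcal P$ is directly regular if the index is $2$. A polytope is of type $\{\mathcal P_1,\mathcal P_2\}$ if its facets are isomorphic to $\mathcal P_1$ and its vertex-figures to $\mathcal P_2$. A polytope is self-dual if it admits a duality (incidence-reversing bijection onto itself); a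 chiral polytope is properly self-dual if it admits a duality mapping each of the two flag orbits of $\Gamma(\mathcal P)$ onto itself. $\{6,3\}_{(b,c)}$ and $\{3,6\}_{(b,c)}$ denote the toroidal maps obtained from the hexagonal, respectively triangular, tessellation of the plane by factoring out the translation lattice generated by the vector $(b,c)$ (in the usual hexagonal-lattice coordinates) and its image under rotation by $60^\circ$ (the two maps are dual); they are regular if $bc=0$ or $b=c$ and chiral otherwise. $L_2(p)=PSL_2(p)$. *)

(* Defs.v *)
From HB Require Import structures.
From mathcomp Require Import all_boot all_order all_algebra all_fingroup.
From mathcomp Require Import center.

Set Implicit Arguments.
Unset Strict Implicit.
Unset Printing Implicit Defensive.

Import GRing.Theory.
Local Open Scope ring_scope.

Definition order_iso (S T : Type) (leS : S -> S -> Prop) (leT : T -> T -> Prop) : Prop :=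
  exists2 f : S -> T, bijective f & forall x y, leS x y <-> leT (f x) (f y).

Definition chain (d : Order.disp_t) (P : finPOrderType d) (A : {set P}) : bool :=
  [forall x in A, forall y in A, (x >=< y)%O].

Definition flag (d : Order.disp_t) (P : finPOrderType d) (A : {set P}) : bool :=
  maxset (@chain d P) A.

Definition adjacent (d : Order.disp_t) (P : finPOrderType d) (A B : {set P}) : bool :=
  [&& flag A, flag B, #|A :\: B| == 1%N & #|B :\: A| == 1%N].

Definition strongly_flag_connected (d : Order.disp_t) (P : finPOrderType d) : Prop :=
  forall A B : {set P}, flag A -> flag B ->
    connect [rel C D | [&& adjacent C D, A :&: B \subset C & A :&: B \subset D]] A B.

Record is_polytope (n : nat) (d : Order.disp_t) (P : finPOrderType d)
    (rank : P -> int) : Prop := IsPolytope {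
  polytope_rank_bounds : forall x, - 1 <= rank x <= n%:Z;
  polytope_rank_mono : forall x y, (x < y)%O -> rank x < rank y;
  polytope_least : exists x0 : P, forall x, (x0 <= x)%O;
  polytope_greatest : exists x1 : P, forall x, (x <= x1)%O;
  polytope_flag_size : forall A : {set P}, flag A -> #|A| = n.+2;
  polytope_connected : strongly_flag_connected P;
  polytope_diamond : forall x y : P, (x < y)%O -> rank y = rank x + 2%:Z ->
    #|[set z | (x < z < y)%O]| = 2%N
}.

(** Only finite polytopes are considered: a polytope with finite automorphism
    group and finitely many flag orbits is finite. *)
Record polytope (n : nat) : Type := Polytope {
  polytope_disp : Order.disp_t;
  face :> finPOrderType polytope_disp;
  rank : face -> int;
  polytopeP : is_polytope n rank
}.

Definition flags (n : nat) (P : polytope n) : {set {set P}} := [set A | flag A].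

Definition i_adjacent (n : nat) (P : polytope n) (i : nat) (A B : {set P}) : bool :=
  adjacent A B && [forall x in A :\: B, rank x == i%:Z].

Definition Gamma (n : nat) (P : polytope n) : {set {perm P}} :=
  [set g : {perm P} | [forall x, forall y, (g x <= g y)%O == (x <= y)%O]].

Lemma Gamma_group_set (n : nat) (P : polytope n) : group_set (Gamma P).
Proof.
apply/group_setP; split=> [|g h].
  by rewrite inE; apply/forallP=> x; apply/forallP=> y; rewrite !perm1.
rewrite !inE => /forallP hg /forallP hh.
apply/forallP=> x; apply/forallP=> y; rewrite !permM.
by rewrite (eqP (forallP (hh _) _)) (eqP (forallP (hg _) _)).
Qed.

Canonical Gamma_group (n : nat) (P : polytope n) : {group {perm P}} :=
  Group (Gamma_group_set P).

Definition flag_orbits (n : nat) (P : polytope n) : {set {set {set P}}} :=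
  orbit 'P^*%act (Gamma P) @: flags P.

Definition regular (n : nat) (P : polytope n) : Prop :=
  [transitive Gamma P, on flags P | 'P^*].

Definition chiral (n : nat) (P : polytope n) : Prop :=
  #|flag_orbits P| = 2%N /\
  forall A B : {set P}, adjacent A B -> B \notin orbit 'P^*%act (Gamma P) A.

(** For [P] regular and [A] a (base) flag, [rho A i] with [i < n] is the unique
    automorphism taking [A] to its [i]-adjacent flag. *)
Definition rho (n : nat) (P : polytope n) (A : {set P}) (i : nat) : {perm P} :=
  odflt 1%g [pick g in Gamma P | i_adjacent i A (g @: A)].

Definition Gamma_plus (n : nat) (P : polytope n) (A : {set P}) : {set {perm P}} :=
  <<[set (rho A i * rho A i.+1)%g | i : 'I_n.-1]>>%g.

Canonical Gamma_plus_group (n : nat) (P : polytope n) (A : {set P}) :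
    {group {perm P}} :=
  Eval hnf in [group of Gamma_plus A].

Definition directly_regular (n : nat) (P : polytope n) (A : {set P}) : Prop :=
  regular P /\ #|Gamma P : Gamma_plus A|%g = 2%N.

Definition duality (n : nat) (P : polytope n) (delta : {perm P}) : Prop :=
  forall x y : P, (delta x <= delta y)%O = (y <= x)%O.

Definition self_dual (n : nat) (P : polytope n) : Prop :=
  exists delta : {perm P}, duality delta.

Definition properly_self_dual (n : nat) (P : polytope n) : Prop :=
  exists2 delta : {perm P}, duality delta &
    forall O, O \in flag_orbits P -> [set delta @: A | A : {set P} in O] = O.

Definition has_type (n : nat) (P : polytope n) (S T : Type)
    (leS : S -> S -> Prop) (leT : T -> T -> Prop) : Prop :=
  (forall F : P, rank F = n%:Z - 1 ->
     order_iso (fun x y : {x : P | (x <= F)%O} => (sval x <= sval y)%O) leS) /\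
  (forall v : P, rank v = 0 ->
     order_iso (fun x y : {x : P | (v <= x)%O} => (sval x <= sval y)%O) leT).

(** The pair [(x, y)] is the point [x + y w] of the triangular lattice, where
    [w] is the complex number of modulus 1 and argument 60 degrees; hence
    [w ^ 2 = w - 1]. *)
Definition point : Type := (int * int)%type.

Definition rot60 (v : point) : point := (- v.2, v.1 + v.2).

Definition unit_vec (k : nat) : point := iter k rot60 (1, 0).

(** Every edge and every triangle of the tessellation is listed exactly once:
    those based at the lattice point [v] are the edges from [v] in the
    directions [1, w, w ^ 2], and the two triangles at [v] between consecutive
    such directions. *)
Inductive tess_face : Type :=
  | TEmpty
  | TVertex of point
  | TEdge of point & 'I_3
  | TTriangle of point & 'I_2
  | TPlane.

(** [TPlane] is treated separately in [tri_le]. *)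
Definition corners (f : tess_face) : seq point :=
  match f with
  | TVertex v => [:: v]
  | TEdge v k => [:: v; v + unit_vec k]
  | TTriangle v k => [:: v; v + unit_vec k; v + unit_vec k.+1]
  | TEmpty | TPlane => [::]
  end.

Definition tri_le (f g : tess_face) : Prop :=
  match f, g with
  | _, TPlane => True
  | TPlane, _ => False
  | _, _ => {subset corners f <= corners g}
  end.

(** The hexagonal tessellation is the dual of the triangular one: its tiles are
    centred at the lattice points, so both have the same translations. *)
Definition hex_le (f g : tess_face) : Prop := tri_le g f.

Definition translate (t : point) (f : tess_face) : tess_face :=
  match f with
  | TVertex v => TVertex (v + t)
  | TEdge v k => TEdge (v + t) k
  | TTriangle v k => TTriangle (v + t) k
  | TEmpty => TEmpty
  | TPlane => TPlane
  end.

Definition in_lattice (u : point) (t : point) : Prop :=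
  exists r s : int, t = u *~ r + rot60 u *~ s.

Definition translation_orbit (u : point) (f : tess_face) : tess_face -> Prop :=
  fun g => exists2 t, in_lattice u t & g = translate t f.

Definition torus_face (u : point) : Type :=
  {A : tess_face -> Prop | exists f, A = translation_orbit u f}.

Definition torus_le (le : tess_face -> tess_face -> Prop) (u : point)
    (A B : torus_face u) : Prop :=
  exists f g, [/\ sval A f, sval B g & le f g].

(** [{3,6}_u] and [{6,3}_u]. *)
Definition map36 (u : point) := torus_le tri_le (u := u).
Definition map63 (u : point) := torus_le hex_le (u := u).

Definition SL2 (p : nat) : {set {'GL_2(p)}} :=
  [set g : {'GL_2(p)} | \det (GLval g) == 1].

Lemma SL2_group_set (p : nat) : group_set (SL2 p).
Proof.
apply/group_setP; split=> [|g h]; first by rewrite inE /= det1.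
by rewrite !inE GL_MxE det_mulmx => /eqP-> /eqP->; rewrite mulr1.
Qed.

Canonical SL2_group (p : nat) : {group {'GL_2(p)}} := Group (SL2_group_set p).

Definition PSL2 (p : nat) : {set coset_of 'Z(SL2 p)} := (SL2 p / 'Z(SL2 p))%g.

Canonical PSL2_group (p : nat) : {group coset_of 'Z(SL2 p)} :=
  Eval hnf in [group of PSL2 p].

(* Main.v *)
(** Both [Gamma_plus Phi] and [PSL2 p] are generated by three elements that
    satisfy the relations of the rotations of a self-dual 4-polytope with
    triangulated toroidal facets. In [PSL2 p] the translations of the facet are
    unipotent, and [w = - b / c], a primitive sixth root of unity modulo [p],
    acts on them as the rotation by 60 degrees; so the translation by [(x, y)]
    is trivial exactly when [p] divides [c x - b y]. By Goursat's lemma, since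
    [PSL2 p] is simple and its order does not divide that of [Gamma_plus Phi],
    the pairs of corresponding generators generate the whole direct product.
    The cosets of the face stabilisers form a polytope, whose facets are the
    quotients of the tessellation by the translations trivial in both factors.
    If it were not chiral, the product would have an automorphism taking the
    translation by [(b, c)] to its mirror image, by [(- b - c, c)]. By simplicity
    that automorphism preserves the factor [Gamma_plus Phi], which contains the
    first translation but not the second. *)

Require Import Defs.
From HB Require Import structures.
From mathcomp Require Import all_boot all_order all_algebra all_fingroup.
From mathcomp Require Import center finfield boolp zify ring.

Set Implicit Arguments.
Unset Strict Implicit.
Unset Printing Implicit Defensive.

Import Order.TTheory GRing.Theory Num.Theory.
Local Open Scope ring_scope.

(** * Flags and automorphisms of polytopes *)

(** The obstacle is the intersection property of the face stabilisers, without which their cosets do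
    not form a polytope. For rotations it comes down to [<s1, s2> :&: <s2, s3> = <s2>]. Each element
    of [<s1, s2>] is a power of [s2] times a translation of the facet, so it is enough that a
    translation lying in [<s2, s3>] is trivial. In this form ([rd_vertex]) the condition is checked
    in each factor and passes to the product. In [Gamma_plus Phi] it holds because [<s2, s3>] fixes
    the base vertex; in [PSL2 p] because [<s2, s3>] is lower triangular and the translations are
    upper unipotent.

    The congruence modulo 12 supplies a square root [i] of -1: the diagonal matrix with entries
    [w - 1] and [w] has determinant -1 and enters [SL2 p] only after scaling by [i].

    A self-duality is recorded as conjugation by an element [d] of an ambient group: a duality of
    [Q] in one factor, a matrix whose determinant need not be 1 in the other. It reverses the list
    of stabilisers, and it gives the vertex-figures from the facets. *)

Section Polytope.
Variables (n : nat) (P : polytope n).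
Implicit Types (A B C : {set P}) (x y z : P).

Let PP := polytopeP P.

Lemma chainP A : reflect {in A &, forall x y, (x >=< y)%O} (chain A).
Proof.
apply: (iffP forall_inP) => [cA x y xA yA|cA x xA].
  exact: (forall_inP (cA x xA)).
by apply/forall_inP=> y yA; apply: cA.
Qed.

Lemma flag_chain A : flag A -> chain A.
Proof. exact: maxsetp. Qed.

Lemma chain_lt A x y : chain A -> x \in A -> y \in A ->
  (x < y)%O = (rank x < rank y).
Proof.
move=> /chainP cA xA yA; have /orP := cA x y xA yA.
rewrite !le_eqVlt => -[/orP[/eqP->|xy]|/orP[/eqP->|yx]]; rewrite ?ltxx //.
  by rewrite xy (polytope_rank_mono PP xy).
rewrite lt_gtF //; apply/esym/negbTE; rewrite -leNgt.
exact/ltW/(polytope_rank_mono PP).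
Qed.

Lemma chain_rank_inj A : chain A -> {in A &, injective (@rank n P)}.
Proof.
move=> cA x y xA yA eqr.
have /chainP/(_ x y xA yA) := cA; rewrite /Order.comparable !le_eqVlt.
by rewrite !(chain_lt cA) // eqr ltxx !orbF => /orP[] /eqP.
Qed.

Lemma chain_extends A : chain A -> exists2 B, flag B & A \subset B.
Proof. by case/maxset_exists=> B ? ?; exists B. Qed.

Lemma flag_size A : flag A -> #|A| = n.+2.
Proof. exact: (polytope_flag_size PP). Qed.

Lemma chain_flag A : chain A -> #|A| = n.+2 -> flag A.
Proof.
move=> cA sA; have [B fB sAB] := chain_extends cA.
suff -> : A = B by [].
by apply/eqP; rewrite eqEcard sAB sA flag_size ?leqnn.
Qed.

Lemma face_in_flag x : exists2 A, flag A & x \in A.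
Proof.
have cx : chain [set x].
  by apply/chainP=> y z /set1P-> /set1P->; rewrite comparablexx.
by have [A fA] := chain_extends cx; rewrite sub1set => xA; exists A.
Qed.

Definition rk x : 'I_n.+2 := inord `|rank x + 1|.

Lemma rankE x : rank x = (rk x : nat)%:Z - 1.
Proof.
have /andP[r1 r2] := polytope_rank_bounds PP x.
by rewrite /rk inordK; lia.
Qed.

Lemma rk_inj_flag A : flag A -> {in A &, injective rk}.
Proof.
move=> /flag_chain cA x y xA yA eqr; apply: (chain_rank_inj cA) => //.
by rewrite !rankE eqr.
Qed.

Lemma flag_rk A : flag A -> rk @: A = setT.
Proof.
move=> fA; apply/eqP; rewrite eqEcard subsetT cardsT card_ord.
by rewrite (card_in_imset (rk_inj_flag fA)) flag_size ?leqnn.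
Qed.

Lemma flag_face A (i : 'I_n.+2) : flag A -> exists2 x, x \in A & rk x = i.
Proof.
move=> fA; have := in_setT i; rewrite -(flag_rk fA).
by case/imsetP=> x xA ->; exists x.
Qed.

Lemma flag_face_rank A (i : int) : flag A -> -1 <= i <= n%:Z ->
  exists2 x, x \in A & rank x = i.
Proof.
move=> fA /andP[i1 i2]; have [x xA rx] := flag_face (inord `|i + 1|) fA.
by exists x => //; rewrite rankE rx inordK; lia.
Qed.

Lemma flag_rank_inj A : flag A -> {in A &, injective (@rank n P)}.
Proof. by move/flag_chain; apply: chain_rank_inj. Qed.

Lemma flag_lt A x y : flag A -> x \in A -> y \in A ->
  (x < y)%O = (rank x < rank y).
Proof. by move/flag_chain; apply: chain_lt. Qed.

Lemma flag_sub_eq A B : flag A -> flag B -> A \subset B -> A = B.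
Proof.
move=> fA fB sAB; apply/eqP.
by rewrite eqEcard sAB !flag_size ?leqnn.
Qed.

(** Recovers the rank of a face from the order alone. Automorphisms and dualities are defined by the
    order, and [Gamma_rank] and [duality_rank] find their effect on ranks by this count. *)
Lemma flag_card_lt A x : flag A -> x \in A ->
  #|[set y in A | (y < x)%O]| = rk x.
Proof.
move=> fA xA; rewrite -(card_in_imset (f := rk)); last first.
  by move=> y z /setIdP[yA _] /setIdP[zA _]; apply: (rk_inj_flag fA).
rewrite -[RHS](card_ord (rk x)) -[RHS]cardsT.
pose w := widen_ord (ltnW (ltn_ord (rk x))).
have winj : injective w by move=> i j /(congr1 val) /= /val_inj.
rewrite -(card_imset _ winj); congr #|pred_of_set _|.
apply/setP=> i; apply/imsetP/imsetP=> [[y]|[j _ ->]].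
  case/setIdP=> yA; rewrite (flag_lt fA) // !rankE => lt_yx ->.
  have lt : (rk y < rk x)%N by lia.
  by exists (Ordinal lt) => //; apply: val_inj.
have [y yA ry] := flag_face (w j) fA.
exists y => //; rewrite inE yA (flag_lt fA) // !rankE ry /=.
by have := ltn_ord j; lia.
Qed.

Lemma flag_card_gt A x : flag A -> x \in A ->
  #|[set y in A | (x < y)%O]| = (n.+1 - rk x)%N.
Proof.
move=> fA xA; have := flag_size fA.
rewrite -(cardsID [set y in A | (y < x)%O]).
rewrite (setIidPr _); last by apply/subsetP=> y /setIdP[].
rewrite (flag_card_lt fA xA) (cardsD1 x) !inE xA ltxx /=.
set S1 := (X in (_ + (_ + #|pred_of_set X|) = _)%N).
suff -> : S1 = [set y in A | (x < y)%O].
  by move: #|[set y in A | _]| (rk x : nat) => u v; clear; lia.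
apply/setP=> y; rewrite !inE; case yA: (y \in A); rewrite /= ?andbF // andbT.
rewrite !(flag_lt fA) //; case: eqP => [->|ne]; first by rewrite ltxx.
have : rank y <> rank x by move=> /(flag_rank_inj fA yA xA).
by case: ltgtP.
Qed.

(** Flags have equal size and one face of each rank, so agreement outside rank [i] leaves a single
    exchanged face on either side. *)
Lemma i_adjacentP (i : nat) A B : flag A -> flag B ->
  reflect (A <> B /\ {in A, forall x, rank x <> i%:Z -> x \in B})
          (i_adjacent i A B).
Proof.
move=> fA fB; have eqc : #|A :\: B| = #|B :\: A|.
  apply/eqP; rewrite -(eqn_add2l #|A :&: B|) cardsID setIC cardsID.
  by rewrite !flag_size.
rewrite /i_adjacent /adjacent fA fB -eqc andbb /=.
apply: (iffP andP) => [[/eqP c1 /forall_inP r]|[neq r]].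
  split=> [eqAB|x xA rx]; first by move: c1; rewrite eqAB setDv cards0.
  by apply: contraT=> xB; case: rx; apply/eqP/r; rewrite inE xB.
have ri : {in A :\: B, forall x, rank x = i%:Z}.
  move=> x /setDP[xA xB]; apply/eqP; apply: contraNT xB => /eqP ne.
  exact: r.
split; last by apply/forall_inP=> x /ri ->.
rewrite eqn_leq card_gt0 setD_eq0; apply/andP; split; last first.
  by apply: contra_notN neq => sAB; apply: flag_sub_eq.
apply/card_le1_eqP => x y xD yD; have [xA _] := setDP xD; have [yA _] := setDP yD.
by apply: (flag_rank_inj fA); rewrite ?ri.
Qed.

Lemma i_adjacent_flag i A B : i_adjacent i A B -> flag A /\ flag B.
Proof. by case/andP=> /and4P[]. Qed.

Lemma i_adjacent_sym i A B : i_adjacent i A B -> i_adjacent i B A.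
Proof.
move=> ab; have [fA fB] := i_adjacent_flag ab.
move/(i_adjacentP _ fA fB): ab => [neq r].
apply/i_adjacentP => //; split=> [/esym//|x xB rx].
have [y yA ry] : exists2 y, y \in A & rank y = rank x.
  by apply: flag_face_rank => //; apply: polytope_rank_bounds PP x.
suff -> : x = y by [].
by apply: (flag_rank_inj fB) => //; apply: r => //; rewrite ry.
Qed.

Lemma i_adjacent_face i A B a b : i_adjacent i A B -> a \in A -> b \in B ->
  rank a = i%:Z -> rank b = i%:Z -> a <> b.
Proof.
move=> ab; have [fA fB] := i_adjacent_flag ab.
move/(i_adjacentP _ fA fB): ab => [neq r] aA bB ra rb eqab; case: neq.
apply: flag_sub_eq => //; apply/subsetP=> x xA.
have [rx|/eqP/r->//] := eqVneq (rank x) i%:Z.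
by rewrite (flag_rank_inj fA xA aA) ?ra // eqab.
Qed.

Lemma diamond_unique x y a b c : (x < a < y)%O -> (x < b < y)%O ->
  (x < c < y)%O -> rank y = rank x + 2%:Z -> a <> b -> a <> c -> b = c.
Proof.
move=> xay xby xcy ry /eqP ab /eqP ac.
have /andP[xa ay] := xay; have xy := lt_trans xa ay.
have/eqP := polytope_diamond PP xy ry; set S := [set z | _].
rewrite (cardsD1 a) inE xay add1n eqSS => /cards1P[z Sz].
have bS : b \in S :\ a by rewrite !inE eq_sym ab xby.
have cS : c \in S :\ a by rewrite !inE eq_sym ac xcy.
by move: bS cS; rewrite Sz !inE => /eqP-> /eqP->.
Qed.

(** The faces of rank [i] of [A], [B] and [C] all lie in the diamond between the faces of ranks
    [i - 1] and [i + 1] of [A], which has only two elements. *)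
Lemma i_adjacent_uniq i A B C : (i < n)%N ->
  i_adjacent i A B -> i_adjacent i A C -> B = C.
Proof.
move=> ltin ab ac; have [fA fB] := i_adjacent_flag ab.
have [_ fC] := i_adjacent_flag ac.
have /(i_adjacentP _ fA fB)[_ rB] := ab.
have /(i_adjacentP _ fA fC)[_ rC] := ac.
have /(i_adjacentP _ fB fA)[_ rB'] := i_adjacent_sym ab.
have [x xA rx] : exists2 x, x \in A & rank x = i%:Z - 1.
  by apply: flag_face_rank => //; clear -ltin; lia.
have [y yA ry] : exists2 y, y \in A & rank y = i%:Z + 1.
  by apply: flag_face_rank => //; clear -ltin; lia.
have ex (D : {set P}) : flag D -> exists2 a, a \in D & rank a = i%:Z.
  by move=> fD; apply: flag_face_rank => //; clear -ltin; lia.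
have [[a aA ra] [b bB rb]] := (ex A fA, ex B fB); have [c cC rc] := ex C fC.
have btw (D : {set P}) d : flag D -> x \in D -> y \in D -> d \in D -> rank d = i%:Z ->
    (x < d < y)%O.
  by move=> fD xD yD dD rd; rewrite !(flag_lt fD) // rd rx ry; clear; lia.
have bc : b = c.
  apply: (@diamond_unique x y a); rewrite ?rx ?ry; try by clear; lia.
  - exact: (btw A).
  - by apply: (btw B) => //; apply: rB => //; rewrite ?rx ?ry; clear; lia.
  - by apply: (btw C) => //; apply: rC => //; rewrite ?rx ?ry; clear; lia.
  - exact: (i_adjacent_face ab).
  - exact: (i_adjacent_face ac).
apply: flag_sub_eq => //; apply/subsetP=> z zB.
have [rz|/eqP ne] := eqVneq (rank z) i%:Z.
  by rewrite (flag_rank_inj fB zB bB) ?rz // bc.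
by apply: rC => //; apply: rB'.
Qed.

Lemma i_adjacent_exists i A : (i < n)%N -> flag A -> exists B, i_adjacent i A B.
Proof.
move=> ltin fA.
have [x xA rx] : exists2 x, x \in A & rank x = i%:Z - 1.
  by apply: flag_face_rank => //; clear -ltin; lia.
have [y yA ry] : exists2 y, y \in A & rank y = i%:Z + 1.
  by apply: flag_face_rank => //; clear -ltin; lia.
have [a aA ra] : exists2 a, a \in A & rank a = i%:Z.
  by apply: flag_face_rank => //; clear -ltin; lia.
have xa : (x < a)%O by rewrite (flag_lt fA) // rx ra; lia.
have ay : (a < y)%O by rewrite (flag_lt fA) // ry ra; lia.
have/eqP : #|[set z | (x < z < y)%O]| = 2%N.
  by apply: (polytope_diamond PP); rewrite ?(lt_trans xa ay) // rx ry; clear; lia.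
rewrite (cardsD1 a) inE xa ay add1n eqSS => /cards1P[b Sb].
have : b \in [set b] by apply: set11.
rewrite -Sb !inE => /and3P[ba xb by_].
have rb : rank b = i%:Z.
  have := polytope_rank_mono PP xb; have := polytope_rank_mono PP by_.
  by rewrite rx ry; lia.
have bA : b \notin A.
  by apply: contra ba => bA; apply/eqP/(flag_rank_inj fA) => //; rewrite ra.
have low z : z \in A -> z != a -> (z < b)%O || (b < z)%O.
  move=> zA za; have rz : rank z <> i%:Z.
    by rewrite -ra => /(flag_rank_inj fA zA aA)/eqP; rewrite (negPf za).
  have [zi|iz] := ltP (rank z) i%:Z.
    apply/orP; left; apply: le_lt_trans xb.
    by rewrite -[(z <= x)%O]negbK -(comparable_ltNge (chainP _ (flag_chain fA) _ _ xA zA)) (flag_lt fA) // rx -leNgt; clear -zi; lia.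
  apply/orP; right; apply: lt_le_trans by_ _.
  by rewrite -[(y <= z)%O]negbK -(comparable_ltNge (chainP _ (flag_chain fA) _ _ zA yA)) (flag_lt fA) // ry -leNgt; clear -iz rz; lia.
have fB : flag (b |: (A :\ a)).
  apply: chain_flag.
    have cA := chainP _ (flag_chain fA).
    apply/chainP=> u v; rewrite !inE.
    case/orP=> [/eqP->|/andP[ua uA]]; case/orP=> [/eqP->|/andP[va vA]].
    - exact: comparablexx.
    - by case/orP: (low v vA va) => /lt_comparable //; rewrite comparable_sym.
    - by case/orP: (low u uA ua) => /lt_comparable //; rewrite comparable_sym.
    - exact: cA.
  have := flag_size fA.
  by rewrite (cardsD1 a) aA cardsU1 !inE (negPf bA) andbF.
exists (b |: (A :\ a)); apply/i_adjacentP => //; split=> [eqAB|z zA rz].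
  by move: bA; rewrite eqAB !inE eqxx.
rewrite !inE zA andbT; apply/orP; right; apply/eqP=> eza.
by apply: rz; rewrite eza.
Qed.

(** Exchanging the face of rank [i] leaves those of ranks [j - 1], [j] and [j + 1] in place, so the
    exchange at [j] happens in the same diamond before and after it. *)
Lemma i_adjacent_comm i j A B C D E : (i < n)%N -> (j < n)%N ->
    (i.+1 < j)%N || (j.+1 < i)%N ->
    i_adjacent i A B -> i_adjacent j B C ->
    i_adjacent j A D -> i_adjacent i D E -> C = E.
Proof.
move=> ltin ltjn ij ab bc ad de.
apply: (@i_adjacent_uniq i D) => //.
have [fA fB] := i_adjacent_flag ab; have [_ fC] := i_adjacent_flag bc.
have [_ fD] := i_adjacent_flag ad.
have /(i_adjacentP _ fA fB)[_ rAB] := ab.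
have /(i_adjacentP _ fB fC)[_ rBC] := bc.
have /(i_adjacentP _ fA fD)[_ rAD] := ad.
have /(i_adjacentP _ fD fA)[_ rDA] := i_adjacent_sym ad.
have [x xA rx] : exists2 x, x \in A & rank x = j%:Z - 1.
  by apply: flag_face_rank => //; clear -ltin ltjn; lia.
have [y yA ry] : exists2 y, y \in A & rank y = j%:Z + 1.
  by apply: flag_face_rank => //; clear -ltin ltjn; lia.
have ex (F : {set P}) : flag F -> exists2 a, a \in F & rank a = j%:Z.
  by move=> fF; apply: flag_face_rank => //; clear -ltin ltjn; lia.
have [[a aA ra] [d dD rd]] := (ex A fA, ex D fD); have [c cC rc] := ex C fC.
have btw (F : {set P}) f : flag F -> x \in F -> y \in F -> f \in F -> rank f = j%:Z ->
    (x < f < y)%O.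
  by move=> fF xF yF fF' rf; rewrite !(flag_lt fF) // rf rx ry; clear; lia.
have xB : x \in B by apply: rAB => //; rewrite rx; clear -ij; lia.
have yB : y \in B by apply: rAB => //; rewrite ry; clear -ij; lia.
have aB : a \in B by apply: rAB => //; rewrite ra; clear -ij; lia.
have dc : d = c.
  apply: (@diamond_unique x y a); rewrite ?rx ?ry; try by clear; lia.
  - exact: (btw A).
  - by apply: (btw D) => //; apply: rAD => //; rewrite ?rx ?ry; clear; lia.
  - by apply: (btw C) => //; apply: rBC => //; rewrite ?rx ?ry; clear; lia.
  - exact: (i_adjacent_face ad).
  - exact: (i_adjacent_face bc).
apply/i_adjacentP => //; split=> [eqDC|z zD rz]; last first.
  have [rzj|/eqP rzj] := eqVneq (rank z) j%:Z.
    by rewrite (flag_rank_inj fD zD dD) ?rd // dc.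
  by apply: rBC => //; apply: rAB => //; apply: rDA.
have ri (F : {set P}) : flag F -> exists2 a, a \in F & rank a = i%:Z.
  by move=> fF; apply: flag_face_rank => //; clear -ltin ltjn; lia.
have [[f fA' rf] [g gB rg]] := (ri A fA, ri B fB).
apply: (i_adjacent_face ab fA' gB rf rg).
apply: (flag_rank_inj fD); rewrite ?rf ?rg //.
  by apply: rAD => //; rewrite rf; clear -ij; lia.
by rewrite eqDC; apply: rBC => //; rewrite rg; clear -ij; lia.
Qed.

Lemma GammaP (g : {perm P}) :
  reflect (forall x y, (g x <= g y)%O = (x <= y)%O) (g \in Gamma P).
Proof.
rewrite inE; apply: (iffP forallP) => [h x y|h x].
  exact: (eqP (forallP (h x) y)).
by apply/forallP=> y; apply/eqP.
Qed.

(** Only comparability has to be preserved, so that automorphisms and dualities are covered at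
    once. *)
Lemma order_rel_chain (g : {perm P}) A :
  (forall x y, (g x <= g y)%O || (g y <= g x)%O = (x <= y)%O || (y <= x)%O) ->
  chain (g @: A) = chain A.
Proof.
move=> gE; apply/chainP/chainP=> h.
  move=> x y xA yA; rewrite /Order.comparable -gE.
  by apply: h; apply: imset_f.
by move=> _ _ /imsetP[x xA ->] /imsetP[y yA ->]; rewrite /Order.comparable gE; apply: h.
Qed.

Lemma Gamma_flag g A : g \in Gamma P -> flag A -> flag (g @: A).
Proof.
move=> /GammaP gE fA; apply: chain_flag; last first.
  by rewrite (card_imset _ perm_inj) flag_size.
by rewrite order_rel_chain ?flag_chain // => x y; rewrite !gE.
Qed.

Lemma duality_flag (g : {perm P}) A : duality g -> flag A -> flag (g @: A).
Proof.
move=> gE fA; apply: chain_flag; last first.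
  by rewrite (card_imset _ perm_inj) flag_size.
by rewrite order_rel_chain ?flag_chain // => x y; rewrite !gE orbC.
Qed.

Lemma Gamma_rank g x : g \in Gamma P -> rank (g x) = rank x.
Proof.
move=> gG; have /GammaP gE := gG; have [A fA xA] := face_in_flag x.
rewrite !rankE -(flag_card_lt (Gamma_flag gG fA) (imset_f g xA)).
rewrite -(flag_card_lt fA xA) -[in RHS](card_imset _ (@perm_inj _ g)).
congr (_ - _); congr (Posz #|pred_of_set _|); apply/setP=> y.
apply/setIdP/imsetP=> [[/imsetP[z zA ->] lt]|[z /setIdP[zA lt] ->]].
  exists z => //; rewrite inE zA /=; move: lt.
  by rewrite !lt_neqAle gE (inj_eq perm_inj).
by split; [apply: imset_f|move: lt; rewrite !lt_neqAle gE (inj_eq perm_inj)].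
Qed.

Lemma duality_rank (g : {perm P}) x : duality g -> rank (g x) = n%:Z - 1 - rank x.
Proof.
move=> gE; have [A fA xA] := face_in_flag x.
rewrite !rankE -(flag_card_lt (duality_flag gE fA) (imset_f g xA)).
have := flag_card_gt fA xA; rewrite -(card_imset _ (@perm_inj _ g)).
set S := g @: _; set T := [set y in _ | _]; have -> : S = T.
  apply/setP=> y.
  apply/imsetP/setIdP=> [[z /setIdP[zA lt] ->]|[/imsetP[z zA ->] lt]].
    split; first exact: imset_f.
    by move: lt; rewrite !lt_neqAle gE (inj_eq perm_inj) eq_sym.
  exists z => //; rewrite inE zA /=; move: lt.
  by rewrite !lt_neqAle gE (inj_eq perm_inj) eq_sym.
by have := ltn_ord (rk x); lia.
Qed.

Lemma Gamma_i_adjacent g i A B : g \in Gamma P ->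
  i_adjacent i A B -> i_adjacent i (g @: A) (g @: B).
Proof.
move=> gG ab; have [fA fB] := i_adjacent_flag ab.
have /(i_adjacentP _ fA fB)[neq r] := ab.
apply/i_adjacentP; rewrite ?Gamma_flag //; split=> [/(imset_inj perm_inj)//|].
by move=> _ /imsetP[x xA ->]; rewrite Gamma_rank // => /(r _ xA); apply: imset_f.
Qed.

Lemma duality_i_adjacent (g : {perm P}) i j A B : duality g ->
  (i + j).+1 = n -> i_adjacent i A B -> i_adjacent j (g @: A) (g @: B).
Proof.
move=> gE ij ab; have [fA fB] := i_adjacent_flag ab.
have /(i_adjacentP _ fA fB)[neq r] := ab.
apply/i_adjacentP; rewrite ?duality_flag //; split=> [/(imset_inj perm_inj)//|].
move=> _ /imsetP[x xA ->]; rewrite duality_rank // => rx.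
by apply/imset_f/r => // rx'; apply: rx; rewrite rx'; lia.
Qed.

(** The least and the greatest face are comparable with everything and hence lie in every flag, so
    the exchanged face has a rank strictly between theirs. *)
Lemma adjacent_rankP A B : adjacent A B ->
  exists2 i, i_adjacent i A B & (i < n)%N.
Proof.
move=> ab; have /and4P[fA fB /cards1P[x xE] _] := ab.
have /setDP[xA xB] : x \in A :\: B by rewrite xE set11.
have /andP[r1 r2] := polytope_rank_bounds PP x.
have [b bP] := polytope_least PP; have [t tP] := polytope_greatest PP.
have inF (D : {set P}) y : flag D -> (forall z, y >=< z)%O -> y \in D.
  move=> fD yc; suff <- : y |: D = D by rewrite !inE eqxx.
  have /maxsetP[cD maxD] := fD; apply: maxD; last exact: subsetUr.
  apply/chainP=> u v; rewrite !inE; case/orP=> [/eqP->|uD] //.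
  by case/orP=> [/eqP->|vD]; [rewrite comparable_sym|apply: (chainP _ cD)].
have xb : x <> b by move=> xb; case/negP: xB; rewrite xb; apply: inF => // z; rewrite /Order.comparable bP.
have xt : x <> t by move=> xt; case/negP: xB; rewrite xt; apply: inF => // z; rewrite /Order.comparable tP orbT.
have rb := polytope_rank_mono PP (x := b) (y := x); rewrite lt_neqAle bP andbT in rb.
have rt := polytope_rank_mono PP (x := x) (y := t); rewrite lt_neqAle tP andbT in rt.
have {rb}rb : rank b < rank x by apply: rb; rewrite eq_sym; apply/eqP.
have {rt}rt : rank x < rank t by apply: rt; apply/eqP.
have /andP[b1 _] := polytope_rank_bounds PP b.
have /andP[_ t2] := polytope_rank_bounds PP t.
exists `|rank x|%N; last by lia.
rewrite /i_adjacent ab /=; apply/forall_inP=> y; rewrite xE => /set1P->.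
by apply/eqP; lia.
Qed.

(* Automorphisms act freely on flags: fixing one flag propagates to adjacent
   flags, hence to all flags by connectedness. *)
Lemma Gamma_free g A : g \in Gamma P -> flag A -> g @: A = A -> g = 1%g.
Proof.
move=> gG fA gA.
have step C D : adjacent C D -> g @: C = C -> g @: D = D.
  move=> ac gC; have [i iac ltin] := adjacent_rankP ac.
  apply: (@i_adjacent_uniq i C) => //.
  by rewrite -[X in i_adjacent _ X _]gC; apply: Gamma_i_adjacent.
have fixed B : flag B -> g @: B = B.
  move=> fB; have /connectP[s sP ->] := polytope_connected PP fA fB.
  have {sP} : path (@adjacent _ P) A s by apply: sub_path sP => C D /and3P[].
  by elim: s A gA {fA} => //= C s IH A0 gA0 /andP[/step/(_ gA0)/IH].
apply/permP=> x; rewrite perm1; have [B fB xB] := face_in_flag x.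
apply: (flag_rank_inj fB) => //; last exact: Gamma_rank.
by rewrite -(fixed B fB); apply: imset_f.
Qed.

Lemma Gamma_eq g h A : g \in Gamma P -> h \in Gamma P -> flag A ->
  g @: A = h @: A -> g = h.
Proof.
move=> gG hG fA gh; apply/eqP; rewrite eq_mulgV1; apply/eqP.
apply: (Gamma_free (A := A)) => //; first by rewrite groupM ?groupV.
have imM (u v : {perm P}) : (u * v)%g @: A = v @: (u @: A).
  by rewrite -imset_comp; apply: eq_imset => x; rewrite permM.
rewrite imM gh -imM mulgV; rewrite -[RHS]imset_id.
by apply: eq_imset => x; rewrite perm1.
Qed.

End Polytope.

(** * The triangular tessellation and its toroidal quotients *)

Section Tessellation.
Implicit Types (u v t : point) (k : nat).

Lemma uvE : (unit_vec 0 = (1, 0)) * (unit_vec 1 = (0, 1)) * (unit_vec 2 = (-1, 1))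
  * (unit_vec 3 = (-1, 0)) * (unit_vec 4 = (0, -1)) * (unit_vec 5 = (1, -1)).
Proof. by []. Qed.

Lemma addpE (a b c d : int) : (a, b) + (c, d) = (a + c, b + d) :> point.
Proof. by []. Qed.

Lemma mulpE (a b c : int) : (a, b) *~ c = (a * c, b * c) :> point.
Proof.
have nat_case (n : nat) : (a, b) *+ n = (a * n%:Z, b * n%:Z) :> point.
  elim: n => [|n IH]; first by rewrite !mulr0.
  by rewrite mulrS IH addpE intS !mulrDr !mulr1.
by case: c => n; rewrite ?NegzE ?mulrNz -pmulrn nat_case ?mulrN.
Qed.

Lemma unit_vecD6 k : unit_vec (k + 6) = unit_vec k.
Proof.
rewrite /unit_vec iterD; congr iter.
Qed.

Lemma unit_vecMD6 n k : unit_vec (n * 6 + k) = unit_vec k.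
Proof. by elim: n => // n IH; rewrite mulSn -addnA addnC unit_vecD6. Qed.

Lemma unit_vec_mod6 k : unit_vec (k %% 6) = unit_vec k.
Proof. by rewrite [in RHS](divn_eq k 6) unit_vecMD6. Qed.

(** The edge from [v] in direction [unit_vec k], and the triangle at [v] between
    the directions [unit_vec k] and [unit_vec k.+1]. *)
Definition tedge v k : tess_face :=
  if (k %% 6 < 3)%N then TEdge v (inord (k %% 6))
  else TEdge (v + unit_vec k) (inord (k %% 6 - 3)).

Definition ttri v k : tess_face :=
  match (k %% 6)%N with
  | 0 => TTriangle v (inord 0)
  | 1 => TTriangle v (inord 1)
  | 2 => TTriangle (v + unit_vec 3) (inord 0)
  | 3 => TTriangle (v + unit_vec 4) (inord 1)
  | 4 => TTriangle (v + unit_vec 4) (inord 0)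
  | _ => TTriangle (v + unit_vec 5) (inord 1)
  end.

(** The faces of the flag [(v, k)], indexed by their rank plus one. *)
Definition tface (i : nat) v k : tess_face :=
  match i with
  | 0 => TEmpty
  | 1 => TVertex v
  | 2 => tedge v k
  | 3 => ttri v k
  | _ => TPlane
  end.

Lemma tedge_mod6 v k : tedge v (k %% 6) = tedge v k.
Proof. by rewrite /tedge modn_mod unit_vec_mod6. Qed.

Lemma ttri_mod6 v k : ttri v (k %% 6) = ttri v k.
Proof. by rewrite /ttri modn_mod. Qed.

Lemma tface_mod6 i v k : tface i v (k %% 6) = tface i v k.
Proof. by case: i => [|[|[|[|i]]]] //=; rewrite (tedge_mod6, ttri_mod6). Qed.

Lemma mod6_ind (Pr : nat -> Prop) :
  (forall n k, Pr (n * 6 + k)%N <-> Pr k) ->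
  Pr 0 -> Pr 1 -> Pr 2 -> Pr 3 -> Pr 4 -> Pr 5 -> forall k, Pr k.
Proof.
move=> h p0 p1 p2 p3 p4 p5 k; rewrite (divn_eq k 6); apply/h.
by have := ltn_pmod k (isT : (0 < 6)%N); case: (k %% 6)%N => [|[|[|[|[|[|]]]]]].
Qed.

Lemma tfaceMD6 i v n k l : tface i v (n * 6 + k + l) = tface i v (k + l).
Proof. by rewrite -addnA -tface_mod6 modnMDl tface_mod6. Qed.

(** The same edge named from its other end, with the opposite direction. *)
Lemma tedgeD3 v k : tedge (v + unit_vec k) (k + 3) = tedge v k.
Proof.
elim/mod6_ind: k => [n k||||||].
- have := tfaceMD6 2 (v + unit_vec k) n k 3; have := tfaceMD6 2 v n k 0.
  by rewrite !addn0 unit_vecMD6 /= => -> ->.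
all: rewrite /tedge /= -?addrA //; congr (TEdge _ _).
all: by rewrite -[RHS]addr0; congr (_ + _).
Qed.

(** The same triangle named from its third corner; [ttriD2] names it from the second. The increments
    3 of [tedgeD3] and 4 here reappear in the products [elt_s12] and [elt_rot3]. *)
Lemma ttriD4 v k : ttri (v + unit_vec k.+1) (k + 4) = ttri v k.
Proof.
elim/mod6_ind: k => [n k||||||].
- have := tfaceMD6 3 (v + unit_vec k.+1) n k 4; have := tfaceMD6 3 v n k 0.
  by rewrite !addn0 -addnS unit_vecMD6 /= => -> ->.
all: rewrite /ttri /= -?addrA //; congr (TTriangle _ _).
all: by rewrite -[RHS]addr0; congr (_ + _).
Qed.

Lemma ttriD2 v k : ttri (v + unit_vec k) (k + 2) = ttri v k.
Proof.
elim/mod6_ind: k => [n k||||||].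
- have := tfaceMD6 3 (v + unit_vec k) n k 2; have := tfaceMD6 3 v n k 0.
  by rewrite !addn0 unit_vecMD6 /= => -> ->.
all: rewrite /ttri /= -?addrA //; congr (TTriangle _ _).
all: by rewrite -[RHS]addr0; congr (_ + _).
Qed.

Lemma tface_translate i v k t : tface i (v + t) k = translate t (tface i v k).
Proof.
case: i => [|[|[|[|i]]]] //=.
  by rewrite /tedge; case: ifP => _ //=; rewrite addrAC.
by rewrite /ttri; case: (k %% 6)%N => [|[|[|[|[|j]]]]] //=; rewrite addrAC.
Qed.

Lemma translate0 f : translate 0 f = f.
Proof. by case: f => //= *; rewrite addr0. Qed.

Lemma translateD s t f : translate s (translate t f) = translate (t + s) f.
Proof. by case: f => //= *; rewrite addrA. Qed.

Lemma corners_translate t f : corners (translate t f) = map (+%R^~ t) (corners f).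
Proof. by case: f => //= *; rewrite ![_ + t + _]addrAC. Qed.

Lemma tri_le_translate t f g : tri_le (translate t f) (translate t g) <-> tri_le f g.
Proof.
have key : {subset corners (translate t f) <= corners (translate t g)} <->
           {subset corners f <= corners g}.
  rewrite !corners_translate; split=> sub x.
    move/(map_f (+%R^~ t))/sub/mapP=> [y yg /addIr->]//.
  by case/mapP=> y /sub yg ->; apply: map_f.
by case: f key => [|v|v l|v l|]; case: g => [|v'|v' l'|v' l'|] //=.
Qed.

Lemma corners_tedge v k : corners (tedge v k) =i [:: v; v + unit_vec k].
Proof.
rewrite -tedge_mod6 -unit_vec_mod6.
have := ltn_pmod k (isT : (0 < 6)%N); case: (k %% 6)%N => [|[|[|[|[|[|//]]]]]] _ x;
  rewrite /tedge /= ?inordK // -?addrA !inE 1?orbC //;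
  by congr (_ || _); rewrite -[v in RHS]addr0; do 2!congr (_ == _ + _).
Qed.

Lemma corners_ttri v k :
  corners (ttri v k) =i [:: v; v + unit_vec k; v + unit_vec k.+1].
Proof.
rewrite -ttri_mod6 -[unit_vec k]unit_vec_mod6 -[unit_vec k.+1]unit_vec_mod6.
rewrite -[k.+1]addn1 -[((k + 1) %% 6)%N]modnDml.
have := ltn_pmod k (isT : (0 < 6)%N).
by case: v => a b; case: (k %% 6)%N => [|[|[|[|[|[|//]]]]]] _ [x y];
  rewrite /ttri /= ?inordK // !inE !xpair_eqE /=; lia.
Qed.

Lemma tri_le_proper f g : {subset corners f <= corners g} -> f <> TPlane ->
  tri_le f g.
Proof. by case: f => [|v|v l|v l|] //; case: g. Qed.

Lemma tri_le_refl f : tri_le f f.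
Proof. by case: f => //= [v|v l|v l]. Qed.

Lemma tface_neq_plane i v k : (i < 4)%N -> tface i v k <> TPlane.
Proof.
case: i => [|[|[|[|i]]]] //= _; first by rewrite /tedge; case: ifP.
by rewrite /ttri; case: (k %% 6)%N => [|[|[|[|[|j]]]]].
Qed.

Lemma tface_le i j v k : (i <= j <= 4)%N -> tri_le (tface i v k) (tface j v k).
Proof.
case/andP; rewrite leq_eqVlt => /orP[/eqP<- _|]; first exact: tri_le_refl.
rewrite [(j <= 4)%N]leq_eqVlt => ij /orP[/eqP jE|j4].
  by rewrite jE /=; case: (tface i v k).
apply: tri_le_proper; last by apply: tface_neq_plane; apply: ltn_trans ij j4.
case: i j ij j4 => [|[|[|i]]] [|[|[|[|j]]]] // _ _ x /=.
- by rewrite corners_tedge !inE => ->.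
- by rewrite corners_ttri !inE => ->.
- by rewrite corners_ttri corners_tedge !inE => /orP[]->; rewrite ?orbT.
Qed.

Lemma tedge_ord v (l : 'I_3) : TEdge v l = tedge v l.
Proof. by case: l => -[|[|[|//]]] lt; rewrite /tedge /=; congr TEdge; apply: val_inj; rewrite /= inordK. Qed.

Lemma ttri_ord v (l : 'I_2) : TTriangle v l = ttri v l.
Proof. by case: l => -[|[|//]] lt; rewrite /ttri /=; congr TTriangle; apply: val_inj; rewrite /= inordK. Qed.

Lemma tfaceP f : exists i v k, (i <= 4)%N /\ f = tface i v k.
Proof.
case: f => [|v|v l|v l|].
- by exists 0, 0, 0.
- by exists 1, v, 0.
- by exists 2, v, l; rewrite /= -tedge_ord.
- by exists 3, v, l; rewrite /= -ttri_ord.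
- by exists 4, 0, 0.
Qed.

(** Together with [tface_le] this turns incidence into membership in a common flag [(v, k)], the
    form in which it is carried over to the facets and to cosets. *)
Lemma tri_leP f g : tri_le f g ->
  exists i j v k, [/\ (i <= j <= 4)%N, f = tface i v k & g = tface j v k].
Proof.
have same h : exists i j v k, [/\ (i <= j <= 4)%N, h = tface i v k & h = tface j v k].
  by have [i [v [k [i4 ->]]]] := tfaceP h; exists i, i, v, k; rewrite leqnn.
have [->|] := pselect (g = TPlane).
  by move=> _; have [i [v [k [i4 ->]]]] := tfaceP f; exists i, 4, v, k; rewrite i4.
have [->|] := pselect (f = TEmpty).
  by move=> _ _; have [i [v [k [i4 ->]]]] := tfaceP g; exists 0, i, v, k; rewrite i4.
have [->|ne] := pselect (f = g); first by move=> _ _ _; apply: same.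
case: f ne => [|v|v l|v l|] // ne _; case: g ne => [|v'|v' l'|v' l'|] //= ne _ sub.
- by have := sub v (mem_head _ _).
- by have := sub v (mem_head _ _); rewrite inE => /eqP E; rewrite E in ne.
- have := sub v (mem_head _ _); rewrite !inE => /orP[] /eqP->.
    by exists 1, 2, v', l'; rewrite /= -tedge_ord.
  by exists 1, 2, (v' + unit_vec l'), (l' + 3)%N; rewrite /= tedgeD3 -tedge_ord.
- have := sub v (mem_head _ _); rewrite !inE => /or3P[] /eqP->.
  + by exists 1, 3, v', l'; rewrite /= -ttri_ord.
  + by exists 1, 3, (v' + unit_vec l'), (l' + 2)%N; rewrite /= ttriD2 -ttri_ord.
  + by exists 1, 3, (v' + unit_vec l'.+1), (l' + 4)%N; rewrite /= ttriD4 -ttri_ord.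
- by have := sub v (mem_head _ _).
- exfalso; have := sub v (mem_head _ _); have := sub _ (mem_last v [:: v + unit_vec l]).
  rewrite /= !inE; case: v v' {ne sub} => a b [a' b'].
  by case: l => -[|[|[|//]]] lt; rewrite ?uvE ?addpE !xpair_eqE; clear; lia.
- exfalso; apply: ne.
  have := sub v (mem_head _ _); have := sub _ (mem_last v [:: v + unit_vec l]).
  rewrite /= !inE; case: v v' {sub} => a b [a' b'].
  case: l => -[|[|[|//]]] lt; case: l' => -[|[|[|//]]] lt';
  rewrite ?uvE ?addpE !xpair_eqE /= => h1 h2; try (exfalso; move: h1 h2; clear; lia);
  (congr TEdge; [congr pair; move: h1 h2; clear; lia|exact: val_inj]).
(* An edge in a triangle. The witness is the corner from which the edge has some direction [k] and
   the triangle lies between the directions [k] and [k + 1]. *)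
- have := sub v (mem_head _ _); have := sub _ (mem_last v [:: v + unit_vec l]).
  rewrite /= !inE tedge_ord ttri_ord; case: v v' {sub ne} => a b [a' b'].
  case: l => -[|[|[|//]]] lt; case: l' => -[|[|//]] lt';
    rewrite [nat_of_ord _]/= [nat_of_ord (Ordinal lt')]/= ?uvE ?addpE !xpair_eqE /= => h1 h2.
  + exists 2, 3, (a', b'), 0; split=> //=; congr tedge; congr pair; move: h1 h2; clear; lia.
  + exists 2, 3, ((a', b') + unit_vec 1), (1 + 2)%N; split=> //=; last exact: esym (ttriD2 _ 1).
    rewrite /tedge /=; congr TEdge; congr pair; move: h1 h2; rewrite /=; clear; lia.
  + exists 2, 3, ((a', b') + unit_vec 1), (0 + 4)%N; split=> //=; last exact: esym (ttriD4 _ 0).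
    rewrite /tedge /=; congr TEdge; congr pair; move: h1 h2; rewrite /=; clear; lia.
  + exists 2, 3, (a', b'), 1; split=> //=; congr tedge; congr pair; move: h1 h2; clear; lia.
  + exists 2, 3, ((a', b') + unit_vec 0), (0 + 2)%N; split=> //=; last exact: esym (ttriD2 _ 0).
    rewrite /tedge /=; congr TEdge; congr pair; move: h1 h2; rewrite /=; clear; lia.
  + exists 2, 3, ((a', b') + unit_vec 2), (1 + 4)%N; split=> //=; last exact: esym (ttriD4 _ 1).
    rewrite /tedge /=; congr TEdge; congr pair; move: h1 h2; rewrite /=; clear; lia.
- by have := sub v (mem_head _ _).
- exfalso; have := sub v (mem_head _ _).
  have := sub _ (mem_last v [:: v + unit_vec l; v + unit_vec l.+1]).
  rewrite /= !inE; case: v v' {ne sub} => a b [a' b'].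
  by case: l => -[|[|//]] lt; rewrite /unit_vec /rot60 /= ?addpE !xpair_eqE /=; clear; lia.
- exfalso; have := sub v (mem_head _ _).
  have := sub (v + unit_vec l); rewrite !inE eqxx orbT => /(_ isT).
  have := sub _ (mem_last v [:: v + unit_vec l; v + unit_vec l.+1]).
  rewrite /= !inE; case: v v' {ne sub} => a b [a' b'].
  by case: l => -[|[|//]] lt; case: l' => -[|[|[|//]]] lt';
    rewrite /unit_vec /rot60 /= ?addpE !xpair_eqE /=; clear; lia.
- exfalso; apply: ne; have := sub v (mem_head _ _).
  have := sub (v + unit_vec l); rewrite !inE eqxx orbT => /(_ isT).
  have := sub _ (mem_last v [:: v + unit_vec l; v + unit_vec l.+1]).
  rewrite /= !inE; case: v v' {sub} => a b [a' b'].
  case: l => -[|[|//]] lt; case: l' => -[|[|//]] lt';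
  rewrite /unit_vec /rot60 /= ?addpE !xpair_eqE /= => h1 h2 h3; try (exfalso; move: h1 h2 h3; clear; lia);
  (congr TTriangle; [congr pair; move: h1 h2 h3; clear; lia|exact: val_inj]).
Qed.

(** * Toroidal quotients and their covers by the tessellation *)

Lemma in_lattice0 u : in_lattice u 0.
Proof. by exists 0, 0; rewrite !mulr0z addr0. Qed.

Lemma in_latticeB u s t : in_lattice u s -> in_lattice u t -> in_lattice u (s - t).
Proof.
case=> a [b ->] [c [d ->]]; exists (a - c), (b - d).
by rewrite !mulrzBr opprD addrACA.
Qed.

Lemma in_latticeN u t : in_lattice u t -> in_lattice u (- t).
Proof. by move=> ut; rewrite -sub0r; apply: in_latticeB => //; apply: in_lattice0. Qed.

Lemma in_latticeD u s t : in_lattice u s -> in_lattice u t -> in_lattice u (s + t).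
Proof. by move=> us ut; rewrite -[t]opprK; apply/in_latticeB/in_latticeN. Qed.

Lemma torbit_refl u f : translation_orbit u f f.
Proof. by exists 0; [apply: in_lattice0|rewrite translate0]. Qed.

Lemma torbit_sym u f g : translation_orbit u f g -> translation_orbit u g f.
Proof.
case=> t ut ->; exists (- t); first exact: in_latticeN.
by rewrite translateD subrr translate0.
Qed.

Lemma torbit_trans u f g h : translation_orbit u f g -> translation_orbit u g h ->
  translation_orbit u f h.
Proof.
case=> t ut -> [s us ->]; exists (t + s); first exact: in_latticeD.
by rewrite translateD.
Qed.

Lemma torbit_eq u f g : translation_orbit u f g ->
  translation_orbit u f = translation_orbit u g.
Proof.
move=> fg; apply/funext=> h; apply/propext; split; apply: torbit_trans => //.
exact: torbit_sym.
Qed.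

(** [h] identifies the quotient of the triangular tessellation by the lattice
    of [u] with the ordered set [S]. *)
Record torus_cover u (S : Type) (leS : S -> S -> Prop) (h : tess_face -> S) : Prop :=
  TorusCover {
    cover_surj : forall x, exists f, h f = x;
    cover_fiber : forall f g, h f = h g <-> translation_orbit u f g;
    cover_le : forall f g, leS (h f) (h g) <->
      exists2 g', translation_orbit u g g' & tri_le f g'
  }.

Lemma cover_of_iso u (S : Type) (leS : S -> S -> Prop) :
  order_iso leS (@map36 u) -> exists h, torus_cover u leS h.
Proof.
case=> phi [psi phiK psiK] phi_le.
pose cls f : torus_face u := exist _ (translation_orbit u f) (ex_intro _ f erefl).
exists (psi \o cls); split=> [x|f g|f g] /=.
- have [f fE] := svalP (phi x); exists f.
  by rewrite -[RHS]phiK; congr psi; case: (phi x) fE => A AP /= fE; apply: eq_exist.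
- split=> [/(can_inj psiK)/(congr1 sval) /= E|fg]; first by rewrite E; apply: torbit_refl.
  by congr psi; apply/eq_exist/torbit_eq.
- rewrite phi_le !psiK; split=> [[f1 [g1 [/= [t ut ->] gg1 le]]]|[g' gg' le]].
    exists (translate (- t) g1).
      by apply: torbit_trans gg1 _; exists (- t) => //; apply: in_latticeN.
    apply/(tri_le_translate t); rewrite [translate t (translate _ _)]translateD.
    by rewrite addNr translate0.
  by exists f, g'; split=> //=; apply: torbit_refl.
Qed.

(** A face of the torus is a predicate, so the isomorphism sends [x] to its whole fibre, and the
    inverse picks a member of the class by choice. *)
Lemma iso_of_cover u (S : Type) (leS : S -> S -> Prop) h :
  torus_cover u leS h -> order_iso leS (@map36 u).
Proof.
case=> surj fib le.
have fiberE f : (fun g => h g = h f) = translation_orbit u f.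
  by apply/funext=> g; apply/propext; split=> [/esym/fib|/fib].
have clsP x : exists f, (fun g => h g = x) = translation_orbit u f.
  by have [f <-] := surj x; exists f.
exists (fun x => exist _ (fun g => h g = x) (clsP x)).
  exists (fun A : torus_face u => h (sval (cid (svalP A)))) => [x|[A AP]].
    case: cid => f /= E; have : translation_orbit u f f by apply: torbit_refl.
    by rewrite -E.
  apply: eq_exist; rewrite fiberE; case: cid => f /= E.
  by rewrite E.
move=> x y; split=> [xy|[f [g [/= <- <- fg]]]].
  have [f fx] := surj x; have [g gy] := surj y.
  have /le[g' gg' fg'] : leS (h f) (h g) by rewrite fx gy.
  by exists f, g'; split=> //=; rewrite -gy; apply/esym/fib.
by apply/le; exists g => //; apply: torbit_refl.
Qed.

(** The duality carries the vertex-figure at [v], upside down, onto the facet [d v], and [map63] is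
    [map36] upside down by definition. *)
Lemma dual_has_type n (P : polytope n) (d : {perm P}) u : duality d ->
  (forall F : P, rank F = n%:Z - 1 ->
    order_iso (fun x y : {x : P | (x <= F)%O} => (sval x <= sval y)%O) (@map36 u)) ->
  has_type P (@map36 u) (@map63 u).
Proof.
move=> dd fac; split=> // v rv.
have rF : rank (d v) = n%:Z - 1 by rewrite (duality_rank _ dd) rv subr0.
have [phi phib phi_le] := fac _ rF.
have to_le (x : {x : P | (v <= x)%O}) : (d (sval x) <= d v)%O.
  by rewrite dd; apply: (svalP x).
have of_le (y : {y : P | (y <= d v)%O}) : (v <= (d^-1)%g (sval y))%O.
  by rewrite -dd permKV; apply: (svalP y).
exists (fun x => phi (exist _ (d (sval x)) (to_le x))).
  apply: (bij_comp phib); exists (fun y => exist _ ((d^-1)%g (sval y)) (of_le y)).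
    by case=> x vx; apply: eq_exist; rewrite /= permK.
  by case=> y yv; apply: eq_exist; rewrite /= permKV.
move=> x y; rewrite -dd.
have := phi_le (exist _ (d (sval y)) (to_le y)) (exist _ (d (sval x)) (to_le x)).
by move=> /= ->; split=> -[f [g [ff gg fg]]]; exists g, f.
Qed.

(** * Normal form in groups that act like the rotations of the triangular lattice *)

Section Translations.
Variable gT : finGroupType.
Local Open Scope group_scope.
Implicit Types x y q : gT.

Definition zpow x (z : int) : gT :=
  match z with Posz n => x ^+ n | Negz n => x ^- n.+1 end.

Lemma zpowB x (n m : nat) : zpow x (n%:Z - m%:Z)%R = x ^+ n * x ^- m.
Proof.
have [mn|/ltnW nm] := leqP m n.
  by rewrite subzn //= -{2}(subnK mn) expgD mulgK.
have -> : (n%:Z - m%:Z)%R = (- (m - n)%N%:Z)%R by rewrite -subzn // opprB.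
rewrite -{2}(subnK nm) expgD invMg mulKVg.
by case: (m - n)%N => //=; rewrite !expg0 invg1.
Qed.

Lemma int_diff (z : int) : exists n m : nat, z = (n%:Z - m%:Z)%R.
Proof.
case: z => n; first by exists n, 0; rewrite subr0.
by exists 0, n.+1; rewrite sub0r NegzE.
Qed.

Lemma zpow_mem (H : {group gT}) x a : x \in H -> zpow x a \in H.
Proof. by move=> xH; case: a => n /=; rewrite ?groupV groupX. Qed.

Lemma zpow_commute x y a b : commute x y -> commute (zpow x a) (zpow y b).
Proof.
move=> /cent1P xy; apply/commute_sym/cent1P/zpow_mem/cent1P/commute_sym/cent1P.
exact: zpow_mem.
Qed.

Lemma zpowD x a b : zpow x (a + b)%R = zpow x a * zpow x b.
Proof.
have [n1 [m1 ->]] := int_diff a; have [n2 [m2 ->]] := int_diff b.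
rewrite addrACA -opprD -!PoszD !zpowB !expgD invMg -!mulgA; congr (_ * _).
rewrite mulgA -(zpowB x n2 m2).
have -> : x ^- m1 = zpow x (0%:Z - m1%:Z)%R by rewrite zpowB expg0 mul1g.
exact: zpow_commute.
Qed.

Lemma zpowN x a : zpow x (- a)%R = (zpow x a)^-1.
Proof.
have [n [m ->]] := int_diff a; rewrite opprB !zpowB invMg invgK.
by [].
Qed.

Lemma zpowJ x q a : (zpow x a) ^ q = zpow (x ^ q) a.
Proof. by case: a => n /=; rewrite ?conjVg conjXg. Qed.

Lemma zpowV x a : zpow x^-1 a = zpow x (- a)%R.
Proof. by rewrite zpowN; case: a => n /=; rewrite expVgn ?invgK. Qed.

Lemma zpowMg x y a : commute x y -> zpow (x * y) a = zpow x a * zpow y a.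
Proof.
move=> cxy; case: a => n /=; rewrite expgMn // invMg.
by apply: commuteV; apply/commute_sym/commuteV/commute_sym/commuteX2.
Qed.

(** [x] acts as the unit translation, and [q] as the rotation by 60 degrees, of
    a quotient of the triangular lattice. *)
Definition hex_action (q x : gT) : Prop :=
  [/\ commute x (x ^ q), x ^ (q ^+ 2) = x^-1 * x ^ q & q ^+ 6 = 1].

Definition tr (q x : gT) v : gT := zpow x v.1 * zpow (x ^ q) v.2.

(** The rotation by [k] times 60 degrees about the origin, followed by the translation by [v];
    products act from left to right. It takes the flag [(0, 0)] of the tessellation to [(v, k)]. *)
Definition elt (q x : gT) v k : gT := q ^+ k * tr q x v.

Section HexAction.
Variables q x : gT.
Hypothesis qx : hex_action q x.
Local Notation tr := (tr q x).
Local Notation elt := (elt q x).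

Lemma tr0 : tr 0%R = 1. Proof. by rewrite /tr /= !expg0 mulg1. Qed.

Lemma tr1 : tr (1, 0)%R = x. Proof. by rewrite /tr /= expg0 mulg1. Qed.

Lemma trD u v : tr (u + v)%R = tr u * tr v.
Proof.
have [cxy _ _] := qx; rewrite /tr /= !zpowD -!mulgA; congr (_ * _).
by rewrite !mulgA; congr (_ * _); apply: zpow_commute.
Qed.

Lemma trN v : tr (- v)%R = (tr v)^-1.
Proof. by apply: (mulgI (tr v)); rewrite -trD subrr tr0 mulgV. Qed.

Lemma trJ v : (tr v) ^ q = tr (rot60 v).
Proof.
have [cxy xqq _] := qx; rewrite /tr conjMg !zpowJ -conjgM -expg2 xqq /=.
rewrite (@zpowMg x^-1 (x ^ q)); last exact: commute_sym (commuteV (commute_sym cxy)).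
rewrite zpowV zpowD !mulgA; congr (_ * _).
exact/commute_sym/zpow_commute.
Qed.

Lemma trqX v k : tr v * q ^+ k = q ^+ k * tr (iter k rot60 v).
Proof.
elim: k v => [|k IH] v; first by rewrite expg0 mulg1 mul1g.
by rewrite expgS mulgA [tr v * q]conjgC trJ -mulgA IH -iterSr mulgA.
Qed.

Lemma eltM v k w l : elt v k * elt w l = elt (iter l rot60 v + w)%R (k + l).
Proof. by rewrite /elt mulgA -(mulgA (q ^+ k)) trqX expgD trD !mulgA. Qed.

Lemma q_order k : q ^+ (k %% 6) = q ^+ k.
Proof. by have [_ _ q6] := qx; rewrite expg_mod. Qed.

Lemma elt_mod6 v k : elt v (k %% 6) = elt v k.
Proof. by rewrite /elt q_order. Qed.

Lemma elt_qV v k : q^-1 * elt v k = elt v (k + 5).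
Proof.
have [_ _ q6] := qx; rewrite -elt_mod6 /elt mulgA q_order.
rewrite addnC expgD; congr (_ * _ * _).
by apply: (mulgI q); rewrite mulgV -expgS.
Qed.

(** The rotation by 240 degrees about the centre of the triangle with corners 0, 1 and [w]. For
    [q = s2^-1] and [x = s2 ^+ 3 * s1 * s2] it is [s1]. *)
Definition rot3 := q ^+ 3 * x * q.

Lemma rot3E : rot3 = elt (unit_vec 1) 4.
Proof. by rewrite /rot3 /elt -mulgA [x * q]conjgC -{1}tr1 trJ mulgA -expgSr. Qed.

(** Multiplication on the left exchanges the flag [(v, k)] for another flag of the same triangle, as
    in [ttriD4], whereas multiplication on the right moves the whole tessellation. *)
Lemma elt_rot3 v k : rot3 * elt v k = elt (v + unit_vec k.+1)%R (k + 4).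
Proof. by rewrite rot3E eltM addrC addnC /unit_vec -iterD addn1. Qed.

Lemma elt_mem v k : elt v k \in <<[set q^-1; rot3]>>.
Proof.
have [K KE] : exists K : {group gT}, K = <<[set q^-1; rot3]>> :> {set gT}.
  by exists <<[set q^-1; rot3]>>%G.
have qK : q \in K by rewrite -groupV KE mem_gen // !inE eqxx.
have rK : rot3 \in K by rewrite KE mem_gen // !inE eqxx orbT.
have xK : x \in K.
  have -> : x = q ^- 3 * rot3 * q^-1 by rewrite /rot3 -(mulgA (q ^+ 3)) mulKg mulgK.
  exact: groupM (groupM (groupVr (groupX 3 qK)) rK) (groupVr qK).
by rewrite -KE groupM ?groupX // groupM ?zpow_mem // groupJ.
Qed.

(** In a finite group the generated subgroup consists of products of generators without inverses,
    and left multiplication by either generator keeps the normal form. *)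
Lemma eltP g : g \in <<[set q^-1; rot3]>> -> exists v k, g = elt v k.
Proof.
case/gen_prodgP=> n [c cP ->]; elim: n c cP => [|n IH] c cP.
  by exists 0%R, 0; rewrite big_ord0 /elt tr0 expg0 mulg1.
rewrite big_ord_recl.
have [v [k ->]] := IH (fun i => c (lift ord0 i)) (fun i => cP _).
have := cP ord0; rewrite !inE => /orP[] /eqP->.
  by exists v, (k + 5)%N; rewrite elt_qV.
by exists (v + unit_vec k.+1)%R, (k + 4)%N; rewrite elt_rot3.
Qed.

End HexAction.
End Translations.

End Tessellation.

(** * Rotations of a regular polytope with toroidal facets *)

Section Regular.
Variables (n : nat) (Q : polytope n) (Phi : {set Q}).
Hypothesis Phi_flag : flag Phi.
Hypothesis Q_regular : regular Q.

Lemma imset_permM (g h : {perm Q}) (A : {set Q}) :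
  (g * h)%g @: A = h @: (g @: A).
Proof. by rewrite -imset_comp; apply: eq_imset => x; rewrite permM. Qed.

Lemma imset_perm1 (A : {set Q}) : (1%g : {perm Q}) @: A = A.
Proof. by rewrite -[RHS]imset_id; apply: eq_imset => x; rewrite perm1. Qed.

Lemma regular_trans (A B : {set Q}) : flag A -> flag B ->
  exists2 g, g \in Gamma Q & g @: A = B.
Proof.
move=> fA fB; have tr : [transitive Gamma Q, on flags Q | 'P^*] := Q_regular.
have [||g gG ->] := atransP2 tr (x := A) (y := B); rewrite ?inE //; exists g => //.
Qed.

Lemma rhoP i : (i < n)%N ->
  rho Phi i \in Gamma Q /\ i_adjacent i Phi (rho Phi i @: Phi).
Proof.
move=> lti; rewrite /rho; case: pickP => [g /andP[gG ag]|none] //=.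
have [B adj] := i_adjacent_exists lti Phi_flag.
have [_ fB] := i_adjacent_flag adj.
have [g gG gB] := regular_trans Phi_flag fB.
by have := none g; rewrite gG gB adj.
Qed.

Lemma rho_Gamma i : (i < n)%N -> rho Phi i \in Gamma Q.
Proof. by case/rhoP. Qed.

Lemma rho_adj i g : (i < n)%N -> g \in Gamma Q ->
  i_adjacent i (g @: Phi) ((rho Phi i * g)%g @: Phi).
Proof.
move=> lti gG; rewrite imset_permM; apply: Gamma_i_adjacent => //.
by have [] := rhoP lti.
Qed.

Lemma rho_flag i g A : (i < n)%N -> g \in Gamma Q -> i_adjacent i (g @: Phi) A ->
  (rho Phi i * g)%g @: Phi = A.
Proof. by move=> lti gG; apply: i_adjacent_uniq (rho_adj lti gG). Qed.

Lemma rho_sqr i : (i < n)%N -> (rho Phi i * rho Phi i)%g = 1%g.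
Proof.
move=> lti; have rG := rho_Gamma lti.
apply: (Gamma_eq (A := Phi)); rewrite ?groupM ?group1 // imset_perm1.
apply: rho_flag => //; apply: i_adjacent_sym; by have [] := rhoP lti.
Qed.

Lemma rho_comm i j : (i < n)%N -> (j < n)%N -> (i.+1 < j)%N || (j.+1 < i)%N ->
  (rho Phi i * rho Phi j = rho Phi j * rho Phi i)%g.
Proof.
move=> lti ltj ij; have [riG adi] := rhoP lti; have [rjG adj] := rhoP ltj.
apply: (Gamma_eq (A := Phi)); rewrite ?groupM //.
have ji : (j.+1 < i)%N || (i.+1 < j)%N by rewrite orbC.
exact: (i_adjacent_comm ltj lti ji adj (rho_adj lti rjG) adi (rho_adj ltj riG)).
Qed.

Lemma rho_fix i j x : (i < n)%N -> x \in Phi -> rank x = j -> i%:Z <> j ->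
  rho Phi i x = x.
Proof.
move=> lti xP rx ij; have [rG ad] := rhoP lti; have [_ fR] := i_adjacent_flag ad.
apply: (flag_rank_inj fR); first exact: imset_f.
  by move/(i_adjacentP _ Phi_flag fR): ad => [_]; apply=> //; rewrite rx => /esym.
exact: Gamma_rank.
Qed.

(** Dualities map flags to flags, so flag-transitivity corrects a given duality to one that fixes
    the base flag. *)
Lemma dual_fixing_flag : self_dual Q ->
  exists2 d : {perm Q}, duality d & d @: Phi = Phi.
Proof.
case=> d0 dd; have [g gG E] := regular_trans (duality_flag dd Phi_flag) Phi_flag.
exists (d0 * g)%g; last by rewrite imset_permM.
by move=> x y; rewrite !permM (GammaP _ gG) dd.
Qed.

Lemma rho_dual (d : {perm Q}) i j : duality d -> d @: Phi = Phi -> (i + j).+1 = n ->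
  (rho Phi i ^ d)%g = rho Phi j.
Proof.
move=> dd dPhi ij.
have lti : (i < n)%N by rewrite -ij ltnS leq_addr.
have ltj : (j < n)%N by rewrite -ij ltnS leq_addl.
have [riG adi] := rhoP lti; have [rjG adj] := rhoP ltj.
have dV : d^-1%g @: Phi = Phi by rewrite -{1}dPhi -imset_permM mulgV imset_perm1.
apply: (Gamma_eq (A := Phi)) => //.
  apply/GammaP=> x y; rewrite conjgE !permM dd (GammaP _ riG).
  by rewrite -dd !permKV.
apply: i_adjacent_uniq ltj _ adj.
rewrite conjgE !imset_permM dV -{1}dPhi.
exact: duality_i_adjacent dd ij adi.
Qed.

End Regular.

(** * The rotations that act on a toroidal facet of a regular polytope *)

Section Facet.
Variables (Q : polytope 4) (Phi : {set Q}) (u : point).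
Hypothesis Phi_flag : flag Phi.
Hypothesis Q_regular : regular Q.
Hypothesis Q_facets : forall F : Q, rank F = 4%:Z - 1 ->
  order_iso (fun x y : {x : Q | (x <= F)%O} => (sval x <= sval y)%O) (@map36 u).

(** A [torus_cover] of the facet [F] with values in [Q] itself, so that automorphisms of [Q] can be
    composed with it. *)
Record facet_param (h : tess_face -> Q) (F : Q) : Prop := FacetParam {
  fp_rank : rank F = 3%:Z;
  fp_surj : forall x, (x <= F)%O <-> exists f, h f = x;
  fp_fiber : forall f g, h f = h g <-> translation_orbit u f g;
  fp_le : forall f g, (h f <= h g)%O <->
    exists2 g', translation_orbit u g g' & tri_le f g'
}.

Lemma facet_param_ex : exists h F, facet_param h F.
Proof.
have [F FPhi rF] := flag_face_rank (i := 3%:Z) Phi_flag isT.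
have [h [hs hf hl]] := cover_of_iso (Q_facets rF).
exists (fun f => sval (h f)), F; split=> //.
- move=> x; split=> [xF|[f <-]]; last exact: (svalP (h f)).
  by have [f fx] := hs (exist _ x xF); exists f; rewrite fx.
- move=> f g; rewrite -hf; split=> [E|->] //.
  by case: (h f) (h g) E => a aP [b bP] /= E; apply: eq_exist.
Qed.

Lemma facet_param_Gamma h F g : g \in Gamma Q -> facet_param h F ->
  facet_param (fun f => g (h f)) (g F).
Proof.
move=> gG [rF hs hf hl]; split.
- by rewrite Gamma_rank.
- move=> x; rewrite -{1}[x](permKV g) (GammaP _ gG) hs.
  split=> -[f fx]; exists f; first by rewrite fx permKV.
  by rewrite -fx permK.
- by move=> f f'; rewrite -hf; split=> [/perm_inj|->].
- by move=> f f'; rewrite (GammaP _ gG).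
Qed.

Section Param.
Variables (h : tess_face -> Q) (F : Q).
Hypothesis hF : facet_param h F.

Lemma fp_plane : h TPlane = F.
Proof.
have [f fF] := (fp_surj hF F).1 (lexx F).
apply/le_anti/andP; split; first by apply/(fp_surj hF); exists TPlane.
rewrite -fF; apply/(fp_le hF); exists TPlane; first exact: torbit_refl.
by case: f {fF}.
Qed.

Lemma fp_mono f g : tri_le f g -> (h f <= h g)%O.
Proof. by move=> fg; apply/(fp_le hF); exists g => //; apply: torbit_refl. Qed.

(** The faces of the two flags of the facet at the vertex [v] and the edge
    [tedge v k] are [pface v k k] and [pface v k (k + 5)]. *)
Definition pface v (k l i : nat) : tess_face :=
  if i == 3 then ttri v l else tface i v k.

(** The triangle of the flag lies to the left of the edge if [l = k], and to the right if
    [l = k + 5], which is [k - 1] modulo 6. *)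
Definition side (k l : nat) := (l = k) \/ (l = k + 5)%N.

Lemma pface_le v k l i j : side k l -> (i <= j <= 4)%N ->
  tri_le (pface v k l i) (pface v k l j).
Proof.
move=> kl ij; rewrite /pface; have [->|kE] : l = k \/ l = (k + 5)%N by [].
  have E i' : (if i' == 3 then ttri v k else tface i' v k) = tface i' v k.
    by case: eqP => // ->.
  by rewrite !E; apply: tface_le.
case: eqP ij => [->|i3]; case: eqP => [->|j3] ij.
- exact: tri_le_refl.
- have -> : j = 4%N by move: ij j3; clear; lia.
  by apply: (@tface_le 3 4).
- have [->|i2] := eqVneq i 2%N; last first.
    have -> : tface i v k = tface i v l by case: i i3 i2 {ij} => [|[|[|[|]]]].
    exact: (@tface_le _ 3).
  apply: tri_le_proper; last exact: (@tface_neq_plane 2).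
  move=> x; rewrite /= corners_tedge corners_ttri kE -addnS unit_vecD6 !inE.
  by case/orP=> ->; rewrite ?orbT.
- exact: tface_le.
Qed.

Definition ctor (f : tess_face) : nat :=
  match f with TEmpty => 0 | TVertex _ => 1 | TEdge _ _ => 2 | TTriangle _ _ => 3
             | TPlane => 4 end.

Lemma ctor_pface v k l i : (i <= 4)%N -> ctor (pface v k l i) = i.
Proof.
case: i => [|[|[|[|[|//]]]]] //= _; first by rewrite /pface /tface /= /tedge; case: ifP.
by rewrite /pface /= /ttri; case: (l %% 6)%N => [|[|[|[|[|]]]]].
Qed.

Lemma ctor_eq f g : h f = h g -> ctor f = ctor g.
Proof. by move/(fp_fiber hF) => [t _ ->]; case: f. Qed.

Lemma pface_lt v k l i j : side k l -> (i < j <= 4)%N ->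
  (h (pface v k l i) < h (pface v k l j))%O.
Proof.
move=> kl /andP[ij j4]; rewrite lt_neqAle fp_mono ?andbT; last first.
  by apply: pface_le; rewrite // ltnW.
apply/eqP=> /ctor_eq; rewrite !ctor_pface //; last exact: leq_trans (ltnW ij) j4.
by move=> E; rewrite E ltnn in ij.
Qed.

(** Five faces ascend strictly from a rank of at least -1 to the rank 3 of [F], which leaves no
    choice. *)
Lemma pface_rank v k l i : side k l -> (i <= 4)%N ->
  rank (h (pface v k l i)) = i%:Z - 1.
Proof.
move=> kl i4; have lt := polytope_rank_mono (polytopeP Q) (pface_lt v kl _).
have r01 := lt 0%N 1%N isT; have r12 := lt 1%N 2%N isT; have r23 := lt 2%N 3%N isT.
have r34 := lt 3%N 4%N isT; have := fp_rank hF; rewrite -fp_plane -[TPlane]/(pface v k l 4%N).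
have /andP[r0 _] := polytope_rank_bounds (polytopeP Q) (h (pface v k l 0)).
by case: i i4 => [|[|[|[|[|//]]]]] _; move: r01 r12 r23 r34 r0; clear; lia.
Qed.

Definition top_face : Q := odflt F [pick t | rank t == 4%:Z].

Lemma topP : rank top_face = 4%:Z /\ forall x, (x <= top_face)%O.
Proof.
have [t tPhi rt] := flag_face_rank (i := 4%:Z) Phi_flag isT.
have [t1 t1P] := polytope_greatest (polytopeP Q).
have uniq y : rank y = 4%:Z -> y = t1.
  move=> ry; apply/eqP; apply: contraT => ne.
  have : (y < t1)%O by rewrite lt_neqAle ne t1P.
  move/(polytope_rank_mono (polytopeP Q)); have := polytope_rank_bounds (polytopeP Q) t1.
  by rewrite ry; clear; lia.
rewrite /top_face; case: pickP => [y /eqP ry|/(_ t)] /=; last by rewrite rt eqxx.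
by split=> // x; rewrite (uniq y ry).
Qed.

Definition mflag v k l : {set Q} := top_face |: [set h (pface v k l i) | i : 'I_5].

Lemma mem_mflag v k l i : (i <= 4)%N -> h (pface v k l i) \in mflag v k l.
Proof.
by rewrite -ltnS => i5; rewrite !inE; apply/orP; right; apply/imsetP; exists (Ordinal i5).
Qed.

Lemma mflag_flag v k l : side k l -> flag (mflag v k l).
Proof.
move=> kl; have [rt tP] := topP; apply: chain_flag.
  apply/chainP=> x y; rewrite !inE.
  case/orP=> [/eqP->|/imsetP[i _ ->]]; last case/orP=> [/eqP->|/imsetP[j _ ->]].
  - by rewrite /Order.comparable tP orbT.
  - by rewrite /Order.comparable tP.
  - case/orP: (leq_total i j) => ij; apply/orP; [left|right]; apply/fp_mono/pface_le => //.
      by rewrite ij -ltnS ltn_ord.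
    by rewrite ij -ltnS ltn_ord.
rewrite cardsU1 card_imset ?card_ord.
  case: imsetP => // -[i _ E]; have i5 := ltn_ord i; rewrite ltnS in i5.
  by have := congr1 (@rank 4 Q) E; rewrite rt (pface_rank v kl i5); move: i5; clear; lia.
have i4 (i : 'I_5) : (i <= 4)%N by rewrite -ltnS ltn_ord.
by move=> i j /ctor_eq; rewrite !ctor_pface ?i4 //; apply: val_inj.
Qed.

Lemma mflag_adj v k l v' k' l' i : (i < 3)%N -> side k l -> side k' l' ->
  h (pface v k l i.+1) <> h (pface v' k' l' i.+1) ->
  (forall j, (j <= 3)%N -> j != i.+1 -> pface v k l j = pface v' k' l' j) ->
  i_adjacent i (mflag v k l) (mflag v' k' l').
Proof.
move=> i3 kl kl' ne ag; have fM := mflag_flag v kl; have fM' := mflag_flag v' kl'.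
apply/i_adjacentP => //; split=> [E|x].
  apply: ne; apply: (flag_rank_inj fM); rewrite ?mem_mflag ?pface_rank //; try exact: ltnW.
  by rewrite E mem_mflag // ltnW.
rewrite !inE => /orP[/eqP->|/imsetP[j _ ->] rx]; first by rewrite eqxx.
have j4 : (j <= 4)%N by rewrite -ltnS ltn_ord.
rewrite pface_rank // in rx; apply/orP; right; apply/imsetP; exists j => //.
have [->|j4'] := eqVneq (j : nat) 4; first by [].
by rewrite ag //; move: rx j4 j4'; clear; lia.
Qed.

(** [rflag v k] has its triangle to the left of its edge, [Mm v k] to the right. Exchanging one face
    of the facet always passes from one kind to the other. *)
Definition rflag v k := mflag v k k.
Definition Mm v k := mflag v k (k + 5).

Lemma sideP k : side k k. Proof. by left. Qed.
Lemma sideM k : side k (k + 5). Proof. by right. Qed.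

Lemma ttriD6 v k : ttri v (k + 6) = ttri v k.
Proof. by rewrite -ttri_mod6 modnDr ttri_mod6. Qed.

(** Translations preserve the direction of an edge modulo 3, and likewise the parity of a triangle
    in [ttri_parity]; so the faces exchanged in [adj1] and [adj2] stay different on the torus. *)
Lemma tedge_succ v v' k t : tedge v k.+1 <> translate t (tedge v' k).
Proof.
have dir v1 k1 : exists v2, tedge v1 k1 = TEdge v2 (inord (k1 %% 3)).
  rewrite /tedge; case: ifP => k3; [exists v1|exists (v1 + unit_vec k1)].
    by congr (TEdge _ (inord _)); move: k3; clear; lia.
  by congr (TEdge _ (inord _)); move: k3; clear; lia.
have [v1 ->] := dir v k.+1; have [v2 ->] := dir v' k.
move=> [_ /(congr1 val)]; rewrite /= !inordK ?ltn_mod //.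
by clear; lia.
Qed.

Lemma ttri_parity v v' k l t : odd k != odd l -> ttri v k <> translate t (ttri v' l).
Proof.
have dir v1 k1 : exists v2, ttri v1 k1 = TTriangle v2 (inord (odd k1)).
  have -> : odd k1 = odd (k1 %% 6).
    by rewrite {1}(divn_eq k1 6) oddD oddM andbF.
  rewrite /ttri; have := ltn_pmod k1 (isT : (0 < 6)%N).
  by case: (k1 %% 6)%N => [|[|[|[|[|[|]]]]]] //= _; eexists.
have [v1 ->] := dir v k; have [v2 ->] := dir v' l.
move=> ne [_ /(congr1 val)]; rewrite /= !inordK ?ltnS ?leq_b1 //.
by case: (odd k) (odd l) ne => -[].
Qed.

Lemma adj2 v k : i_adjacent 2 (rflag v k) (Mm v k).
Proof.
apply: mflag_adj; rewrite //; [exact: sideP|exact: sideM| |].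
  move/(fp_fiber hF) => [t _]; apply: ttri_parity.
  by rewrite oddD; case: (odd k).
by move=> j j3 ne; rewrite /pface (negPf ne).
Qed.

Lemma adj1 v k : i_adjacent 1 (rflag v k) (Mm v k.+1).
Proof.
apply: mflag_adj; rewrite //; [exact: sideP|exact: sideM| |].
  by move/(fp_fiber hF) => [t _]; apply: tedge_succ.
case=> [|[|[|[|]]]] //= _ _; rewrite /pface /=.
by rewrite addSnnS ttriD6.
Qed.

Lemma adj1m v k : i_adjacent 1 (Mm v k) (rflag v (k + 5)).
Proof.
have E : Mm v (k + 5).+1 = Mm v k.
  rewrite /Mm /mflag; congr (_ |: _); apply: eq_imset => i; congr h.
  rewrite /pface -addnS; case: eqP => _; first by rewrite addnAC ttriD6.
  by rewrite -tface_mod6 modnDr tface_mod6.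
by rewrite -E; apply/i_adjacent_sym/adj1.
Qed.

(** This does not come from the lattice but from the diamond condition in [Q], which gives the edge
    a second vertex [b]. As [b] lies in the facet, it is the image of a corner of a translate of the
    edge, hence of one of its two ends; it would equal [h (TVertex v)] if these had the same
    image. *)
Lemma fp_vertices_neq v k : h (TVertex v) <> h (TVertex (v + unit_vec k)).
Proof.
have [B ad] := i_adjacent_exists (isT : (0 < 4)%N) (mflag_flag v (sideP k)).
have [fM fB] := i_adjacent_flag ad.
have /(i_adjacentP _ fM fB)[_ sub] := ad.
have [b bB rb] := flag_face_rank (i := 0) fB isT.
have eB : h (pface v k k 2) \in B by apply: sub; rewrite ?mem_mflag // pface_rank //; left.
have FB : F \in B.
  rewrite -fp_plane -[TPlane]/(pface v k k 4); apply: sub; rewrite ?mem_mflag //.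
  by rewrite pface_rank //; left.
have be : (b <= h (tedge v k))%O.
  by rewrite ltW // (flag_lt fB) // rb (@pface_rank v k k 2) //; left.
have /(fp_surj hF)[f fb] : (b <= F)%O.
  by rewrite ltW // (flag_lt fB) // rb (fp_rank hF).
move: be; rewrite -fb => /(fp_le hF)[g' [t ut ->]] fg.
have [i [j [w [l [/andP[ij j4] fE gE]]]]] := tri_leP fg.
have i1 : i = 1%N.
  have : rank b = i%:Z - 1.
    rewrite -fb fE -[i in RHS](@ctor_pface w l l) ?(leq_trans ij) //.
    have -> : tface i w l = pface w l l i by rewrite /pface; case: eqP => // ->.
    by rewrite pface_rank ?ctor_pface ?(leq_trans ij) //; left.
  by rewrite rb; clear; lia.
rewrite i1 /= in fE; rewrite {}fE in fb fg.
have : w \in corners (translate t (tedge v k)).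
  by move: fg; rewrite /tedge; case: ifP => _ /= fg; apply: fg; rewrite inE eqxx.
rewrite corners_translate => /mapP[z]; rewrite corners_tedge !inE.
have hz : h (TVertex w) = h (TVertex (w - t)).
  apply/(fp_fiber hF); exists (- t) => //; exact: in_latticeN.
move=> zE wE; have {wE} zw : z = w - t by rewrite wE addrK.
have ne : h (TVertex v) <> b.
  apply: (i_adjacent_face ad) => //; last by rewrite (@pface_rank v k k 1) //; left.
  exact: (@mem_mflag v k k 1).
case/orP: zE => /eqP z_; rewrite -fb hz -zw z_ in ne => //.
Qed.

Lemma adj0 v k : i_adjacent 0 (Mm v k) (rflag (v + unit_vec k) (k + 3)).
Proof.
apply: mflag_adj; rewrite //; [exact: sideM|exact: sideP| |].
  exact: fp_vertices_neq.
case=> [|[|[|[|]]]] //= _ _; rewrite /pface /=; first by rewrite tedgeD3.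
rewrite -(ttriD4 v (k + 5)) -addnS unit_vecD6 -addnA -[(5 + 4)%N]/(3 + 6)%N addnA.
by rewrite ttriD6.
Qed.

Lemma M_mod6 v k : rflag v (k %% 6) = rflag v k.
Proof.
rewrite /rflag /mflag; congr (_ |: _); apply: eq_imset => i; congr h.
by rewrite /pface ttri_mod6 tface_mod6.
Qed.

Lemma M_lattice v t k : in_lattice u t -> rflag (v + t) k = rflag v k.
Proof.
move=> ut; rewrite /rflag /mflag; congr (_ |: _); apply: eq_imset => i.
have E w : pface w k k i = tface i w k by rewrite /pface; case: eqP => // ->.
by apply/esym/(fp_fiber hF); exists t => //; rewrite !E tface_translate.
Qed.

Lemma M_inj v k v' k' : rflag v k = rflag v' k' -> in_lattice u (v - v').
Proof.
move=> E; have fM := mflag_flag v (sideP k).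
have : h (pface v k k 1) = h (pface v' k' k' 1).
  apply: (flag_rank_inj fM); rewrite ?mem_mflag ?pface_rank //; try by left.
  by rewrite -/(rflag v k) E mem_mflag.
move=> /esym/(fp_fiber hF)[t ut] /= []; rewrite /pface /= => -[->].
by rewrite addrC addKr.
Qed.

Lemma top_uniq t : rank t = 4%:Z -> t = top_face.
Proof.
move=> rt; have [rT tP] := topP; apply/eqP; apply: contraT => ne.
have : (t < top_face)%O by rewrite lt_neqAle ne tP.
by move/(polytope_rank_mono (polytopeP Q)); rewrite rt rT ltxx.
Qed.

End Param.

Lemma facet_base : exists h F, facet_param h F /\ rflag h F 0 0 = Phi.
Proof.
have [h [F hF]] := facet_param_ex.
have fM := mflag_flag hF 0 (sideP 0).
have [g gG gM] := regular_trans Q_regular fM Phi_flag.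
exists (fun f => g (h f)), (g F); split; first exact: facet_param_Gamma.
rewrite -gM /rflag /mflag imsetU1 -imset_comp; congr (_ |: _).
by apply/esym/top_uniq; rewrite Gamma_rank //; have [] := topP F.
Qed.

Section Action.
Variables (h : tess_face -> Q) (F : Q).
Hypothesis hF : facet_param h F.
Local Notation rflag := (rflag h F).
Hypothesis Phi0 : rflag 0 0 = Phi.
Local Notation r := (rho Phi).
Local Open Scope group_scope.
Implicit Types g : {perm Q}.

(** [g] acts on the flags of the facet like the rotation taking the flag
    [(0, 0)] of the tessellation to [(v, k)]. *)
Definition acts g v k : Prop := g \in Gamma Q /\
  forall g0 v0 k0, g0 \in Gamma Q -> g0 @: Phi = rflag v0 k0 ->
    (g * g0) @: Phi = rflag (v0 + iter k0 rot60 v)%R (k0 + k)%N.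

Lemma iter_rot60D k (v w : point) :
  iter k rot60 (v + w)%R = (iter k rot60 v + iter k rot60 w)%R.
Proof.
elim: k => //= k ->; case: (iter k _ v) (iter k _ w) => a b [c d].
by rewrite /rot60 /= !addpE /= opprD addrACA.
Qed.

Lemma iter_rot600 k : iter k rot60 0%R = 0%R.
Proof. by elim: k => //= k ->. Qed.

Lemma iter_rot60N k (v : point) : iter k rot60 (- v)%R = (- iter k rot60 v)%R.
Proof. by apply: (addrI (iter k rot60 v)); rewrite -iter_rot60D !subrr iter_rot600. Qed.

Lemma acts1 : acts 1 0%R 0.
Proof. by split=> // g0 v0 k0 _ E; rewrite mul1g E iter_rot600 addr0 addn0. Qed.

Lemma actsM g v k g' v' k' : acts g v k -> acts g' v' k' ->
  acts (g * g') (v' + iter k' rot60 v)%R (k + k')%N.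
Proof.
move=> [gG gP] [gG' gP']; split=> [|g0 v0 k0 g0G E]; first exact: groupM.
rewrite -mulgA (gP _ _ _ _ (gP' _ _ _ g0G E)) ?groupM //.
by rewrite iter_rot60D addrA -iterD addnA addnAC.
Qed.

Lemma acts_mod6 g v k k' : (k %% 6 = k' %% 6)%N -> acts g v k -> acts g v k'.
Proof.
move=> kk [gG gP]; split=> // g0 v0 k0 g0G E; rewrite (gP _ _ _ g0G E).
by rewrite -M_mod6 -modnDmr kk modnDmr M_mod6.
Qed.

Lemma acts_Phi g v k : acts g v k -> g @: Phi = rflag v k.
Proof.
move=> [gG gP]; have := gP 1 0%R 0 (group1 _).
by rewrite mulg1 imset_perm1 Phi0 add0r; apply.
Qed.

(** Automorphisms act freely on flags, so a relation between rotations of the facet holds as soon as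
    both sides have the same parameters modulo the lattice and modulo 6. *)
Lemma acts_eq g v k g' v' k' : acts g v k -> acts g' v' k' ->
  in_lattice u (v - v')%R -> (k %% 6 = k' %% 6)%N -> g = g'.
Proof.
move=> gP gP' L km; apply: (Gamma_eq (A := Phi)) => //; try by [case: gP|case: gP'].
rewrite (acts_Phi gP) (acts_Phi gP') -M_mod6 km M_mod6.
by rewrite -[v](subrK v') addrC M_lattice.
Qed.

Lemma acts_eq0 g v k g' k' : acts g v k -> acts g' v k' -> (k %% 6 = k' %% 6)%N -> g = g'.
Proof. by move=> gP gP'; apply: acts_eq gP gP' _; rewrite subrr; apply: in_lattice0. Qed.

Lemma actsV g v : acts g v 0 -> acts g^-1 (- v)%R 0.
Proof.
move=> [gG gP]; split=> [|g0 v0 k0 g0G E]; first by rewrite groupV.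
have fM := mflag_flag hF (v0 - iter k0 rot60 v)%R (sideP k0).
have [g1 g1G E1] := regular_trans Q_regular Phi_flag fM.
have := gP _ _ _ g1G E1; rewrite addn0 subrK -E => E2.
have <- : g * g1 = g0 by apply: Gamma_eq Phi_flag E2; rewrite ?groupM.
by rewrite mulKg E1 iter_rot60N ?addn0.
Qed.

Lemma acts_zpow g v (a : int) : acts g v 0 -> acts (zpow g a) (v *~ a)%R 0.
Proof.
have nat_case (w : point) g1 n : acts g1 w 0 -> acts (g1 ^+ n) (w *+ n)%R 0.
  move=> wP; elim: n => [|n IH]; first by rewrite expg0 mulr0n; apply: acts1.
  by rewrite expgSr mulrS; apply: (actsM IH wP).
move=> vP; case: a => n /=; first by rewrite -pmulrn; apply: nat_case.
by rewrite -expVgn NegzE mulrNz -mulNrz -pmulrn; apply/nat_case/actsV.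
Qed.

Definition sg1 := r 0 * r 1.
Definition sg2 := r 1 * r 2.
Definition sg3 := r 2 * r 3.

(** The flag of [r i * g] is the one adjacent at [i] to the flag of [g]. So [r 0 * r 1] performs
    first the exchange at 1, which leads to [Mm h F v0 k0.+1], and then that at 0. *)
Lemma acts_sg1 : acts sg1 (unit_vec 1) 4.
Proof.
have G0 : r 0 \in Gamma Q by apply: rho_Gamma.
have G1 : r 1 \in Gamma Q by apply: rho_Gamma.
split=> [|g0 v0 k0 g0G E]; first by rewrite groupM.
rewrite -mulgA; apply: rho_flag => //; first by rewrite groupM.
have -> : (r 1 * g0) @: Phi = Mm h F v0 k0.+1.
  by apply: rho_flag => //; rewrite E; apply: adj1.
have -> : (v0 + iter k0 rot60 (unit_vec 1) = v0 + unit_vec k0.+1)%R.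
  by rewrite /unit_vec -iterD addn1.
have -> : (k0 + 4 = k0.+1 + 3)%N by rewrite addSnnS.
exact: adj0.
Qed.

Lemma acts_sg2 : acts sg2 0%R 5.
Proof.
have G1 : r 1 \in Gamma Q by apply: rho_Gamma.
have G2 : r 2 \in Gamma Q by apply: rho_Gamma.
split=> [|g0 v0 k0 g0G E]; first by rewrite groupM.
rewrite -mulgA; apply: rho_flag => //; first by rewrite groupM.
have -> : (r 2 * g0) @: Phi = Mm h F v0 k0.
  by apply: rho_flag => //; rewrite E; apply: adj2.
by rewrite iter_rot600 addr0; apply: adj1m.
Qed.

Lemma acts_sg2X n : acts (sg2 ^+ n) 0%R (n * 5).
Proof.
elim: n => [|n IH]; first by rewrite expg0; apply: acts1.
by rewrite expgSr mulSnr -[0%R](addr0 0%R) -{2}(iter_rot600 5); apply: actsM acts_sg2.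
Qed.

Lemma sg2_order : sg2 ^+ 6 = 1.
Proof. exact: acts_eq0 (acts_sg2X 6) acts1 _. Qed.

Lemma acts_q : acts sg2^-1 0%R 1.
Proof.
have -> : sg2^-1 = sg2 ^+ 5 by apply: (mulgI sg2); rewrite mulgV -expgS sg2_order.
by apply: acts_mod6 (acts_sg2X 5).
Qed.

Definition tx := sg2 ^+ 3 * sg1 * sg2.

Lemma acts_sg12 : acts (sg1 * sg2) (1, 0)%R 9.
Proof. exact: actsM acts_sg1 acts_sg2. Qed.

Lemma acts_tx : acts tx (1, 0)%R 0.
Proof.
rewrite /tx -mulgA; have := actsM (acts_sg2X 3) acts_sg12.
by rewrite iter_rot600 addr0; apply: acts_mod6.
Qed.

Lemma acts_conj g v : acts g v 0 -> acts (g ^ sg2^-1) (rot60 v) 0.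
Proof.
move=> gP; rewrite conjgE invgK; have := actsM acts_sg2 (actsM gP acts_q).
by rewrite iter_rot600 addr0 /= add0r; apply: acts_mod6.
Qed.

Lemma sg_hex_action : hex_action sg2^-1 tx.
Proof.
split.
- have A2 := actsM (acts_conj acts_tx) acts_tx; rewrite /= addrC in A2.
  exact: acts_eq0 (actsM acts_tx (acts_conj acts_tx)) A2 _.
- have -> : sg2^-1 ^+ 2 = sg2^-1 * sg2^-1 by [].
  rewrite conjgM; have A2 := actsM (actsV acts_tx) (acts_conj acts_tx).
  exact: acts_eq0 (acts_conj (acts_conj acts_tx)) A2 _.
- by rewrite expVgn sg2_order invg1.
Qed.

Lemma acts_tr v : acts (tr sg2^-1 tx v) v 0.
Proof.
have := actsM (acts_zpow v.1 acts_tx) (acts_zpow v.2 (acts_conj acts_tx)).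
suff -> : (rot60 (1, 0) *~ v.2 + iter 0 rot60 ((1, 0) *~ v.1) = v)%R by [].
by case: v => a b; rewrite /= /rot60 /= !mulpE addpE !mul1r !mul0r addr0 add0r.
Qed.

Lemma sg_tr_lattice v : tr sg2^-1 tx v = 1 <-> in_lattice u v.
Proof.
split=> [E|L]; last first.
  by apply: acts_eq (acts_tr v) acts1 _ _; rewrite ?subr0.
have := acts_Phi (acts_tr v); rewrite E imset_perm1 -Phi0 => /esym/(M_inj hF).
by rewrite subr0.
Qed.

(** [sg2] and [sg3] fix the base vertex, which the translation by [v] takes to the vertex [v] of the
    torus. *)
Lemma sg_vertex_stab v : tr sg2^-1 tx v \in <<[set sg2; sg3]>> -> in_lattice u v.
Proof.
move=> trK; pose x0 := h (pface 0%R 0 0 1).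
have x0Phi : x0 \in Phi by rewrite -Phi0 mem_mflag.
have rx0 : rank x0 = 0%R by rewrite /x0 (pface_rank hF) //; left.
have fixr i : (0 < i < 4)%N -> r i x0 = x0.
  case/andP=> i0 i4; apply: (rho_fix Phi_flag Q_regular i4 x0Phi rx0).
  by case: i i0 {i4}.
have /astab1P fix0 : tr sg2^-1 tx v \in 'C[x0 | 'P].
  move: trK; apply/subsetP; rewrite gen_subG; apply/subsetP=> g.
  by case/set2P=> ->; apply/astab1P; rewrite /= /aperm permM !fixr.
have : h (pface v 0 0 1) = x0.
  have fM := mflag_flag hF v (sideP 0).
  apply: (flag_rank_inj fM); rewrite ?mem_mflag ?(pface_rank hF) ?rx0 //; try by left.
  by rewrite -/(rflag v 0) -(acts_Phi (acts_tr v)) -{1}fix0; apply: imset_f.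
by move=> /esym/(fp_fiber hF)[t ut] [->]; rewrite add0r.
Qed.

Lemma sg_rels : [/\ sg1 ^+ 3 = 1, (sg1 * sg2) ^+ 2 = 1 & (sg1 * sg2 * sg3) ^+ 2 = 1].
Proof.
split.
- by apply: acts_eq0 (actsM acts_sg1 (actsM acts_sg1 acts_sg1)) acts1 _.
- by apply: acts_eq0 (actsM acts_sg12 acts_sg12) acts1 _.
have r12 i : (i < 4)%N -> r i * r i = 1 by apply: rho_sqr.
have -> : sg1 * sg2 * sg3 = r 0 * r 3.
  by rewrite /sg1 /sg2 /sg3 -!mulgA (mulgA (r 1)) r12 // mul1g (mulgA (r 2)) r12 // mul1g.
rewrite expg2 {1}(rho_comm Phi_flag Q_regular (i := 0) (j := 3)) //.
by rewrite -mulgA (mulgA (r 0)) r12 // mul1g r12.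
Qed.

End Action.
End Facet.

Lemma Gamma_plusE (Q : polytope 4) (Phi : {set Q}) :
  Gamma_plus Phi = <<[set sg1 Phi; sg2 Phi; sg3 Phi]>>%g.
Proof.
congr <<_>>%g; apply/setP=> g; rewrite !inE; apply/imsetP/idP.
  by case=> -[[|[|[|//]]] lt] _ -> /=; rewrite eqxx ?orbT.
case/orP=> [/orP[]|] /eqP->.
- by exists (@Ordinal 3 0 isT).
- by exists (@Ordinal 3 1 isT).
- by exists (@Ordinal 3 2 isT).
Qed.

(** [L] is the lattice of the translations that act trivially on the facet, and
    [d] is a duality fixing the base flag. *)
Record rotation_data (gT : finGroupType) (s1 s2 s3 d : gT) (L : point -> Prop) : Prop :=
  RotationData {
    rd_s1 : (s1 ^+ 3 = 1)%g;
    rd_s12 : ((s1 * s2) ^+ 2 = 1)%g;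
    rd_s123 : ((s1 * s2 * s3) ^+ 2 = 1)%g;
    rd_hex : hex_action s2^-1%g (s2 ^+ 3 * s1 * s2)%g;
    rd_tr : forall v, tr s2^-1%g (s2 ^+ 3 * s1 * s2)%g v = 1%g <-> L v;
    rd_vertex : forall v, tr s2^-1%g (s2 ^+ 3 * s1 * s2)%g v \in <<[set s2; s3]>>%g -> L v;
    rd_d1 : (s1 ^ d = s3^-1)%g;
    rd_d2 : (s2 ^ d = s2^-1)%g;
    rd_d3 : (s3 ^ d = s1^-1)%g
  }.

Lemma regular_rotation_data (Q : polytope 4) (Phi : {set Q}) (u : point) :
  flag Phi -> regular Q -> self_dual Q ->
  (forall F : Q, rank F = 4%:Z - 1 ->
    order_iso (fun x y : {x : Q | (x <= F)%O} => (sval x <= sval y)%O) (@map36 u)) ->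
  exists d, rotation_data (sg1 Phi) (sg2 Phi) (sg3 Phi) d (in_lattice u).
Proof.
move=> fP regQ sdQ facQ; have [d dd dPhi] := dual_fixing_flag fP regQ sdQ.
have [h [F [hF Phi0]]] := facet_base fP regQ facQ.
have [R1 R2 R3] := sg_rels fP regQ hF Phi0.
have r2 i : (i < 4)%N -> ((rho Phi i)^-1 = rho Phi i)%g.
  by move=> i4; apply: (mulgI (rho Phi i)); rewrite mulgV rho_sqr.
have rd := rho_dual fP regQ dd dPhi.
exists d; split=> //.
- exact: (sg_hex_action fP regQ hF Phi0).
- exact: (sg_tr_lattice fP regQ hF Phi0).
- exact: (sg_vertex_stab fP regQ hF Phi0).
- by rewrite /sg1 /sg3 conjMg (rd 0 3) // (rd 1 2) // invMg !r2.
- by rewrite /sg2 conjMg (rd 1 2) // (rd 2 1) // invMg !r2.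
- by rewrite /sg1 /sg3 conjMg (rd 2 1) // (rd 3 0) // invMg !r2.
Qed.

(** * Projective special linear groups *)

Section PSL2.
Variable F : finFieldType.
Implicit Types (a b c d x y : F) (g : {'GL_2[F]}).

Definition mx2 a b c d : 'M[F]_2 :=
  \matrix_(i < 2, j < 2) if i == 0 then (if j == 0 then a else b)
                         else (if j == 0 then c else d).

Lemma mx2M a b c d a' b' c' d' : mx2 a b c d *m mx2 a' b' c' d' =
  mx2 (a * a' + b * c') (a * b' + b * d') (c * a' + d * c') (c * b' + d * d').
Proof.
apply/matrixP=> i j; rewrite !mxE big_ord_recl big_ord1 !mxE /=.
by case: (i == 0); case: (j == 0).
Qed.

Lemma det_mx2 a b c d : \det (mx2 a b c d) = a * d - b * c.
Proof.
rewrite (expand_det_row _ 0) big_ord_recl big_ord1 /cofactor !det_mx11 !mxE /=.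
by ring.
Qed.

Lemma mx2_surj (A : 'M[F]_2) : A = mx2 (A 0 0) (A 0 1) (A 1 0) (A 1 1).
Proof.
apply/matrixP=> i j; rewrite !mxE.
by case: i => -[|[|//]] ii; case: j => -[|[|//]] jj; congr (A _ _); apply: val_inj.
Qed.

Lemma mx2_inj a b c d a' b' c' d' : mx2 a b c d = mx2 a' b' c' d' ->
  [/\ a = a', b = b', c = c' & d = d'].
Proof.
move/matrixP=> E; split.
- by have := E 0 0; rewrite !mxE.
- by have := E 0 1; rewrite !mxE.
- by have := E 1 0; rewrite !mxE.
- by have := E 1 1; rewrite !mxE.
Qed.

Definition SL2F : {set {'GL_2[F]}} := [set g : {'GL_2[F]} | \det (GLval g) == 1].

Lemma SL2F_group_set : group_set SL2F.
Proof.
apply/group_setP; split=> [|g h]; first by rewrite inE /= det1.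
by rewrite !inE GL_MxE det_mulmx => /eqP-> /eqP->; rewrite mulr1.
Qed.

Canonical SL2F_group := Group SL2F_group_set.

Definition g2 a b c d : {'GL_2[F]} := insubd (1%g : {'GL_2[F]}) (mx2 a b c d).

Lemma g2E a b c d : a * d - b * c != 0 -> GLval (g2 a b c d) = mx2 a b c d.
Proof. by move=> nz; apply: insubdK; rewrite -topredE /= unitmxE det_mx2 unitfE. Qed.

Lemma g2_surj g : exists a b c d, a * d - b * c != 0 /\ g = g2 a b c d.
Proof.
exists (GLval g 0 0), (GLval g 0 1), (GLval g 1 0), (GLval g 1 1).
have nz : \det (GLval g) != 0 by apply: GL_det.
rewrite [GLval g]mx2_surj det_mx2 in nz; split=> //.
by apply: val_inj; rewrite -[RHS]/(GLval _) g2E // -mx2_surj.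
Qed.

Lemma g2M a b c d a' b' c' d' : a * d - b * c != 0 -> a' * d' - b' * c' != 0 ->
  (g2 a b c d * g2 a' b' c' d')%g =
  g2 (a * a' + b * c') (a * b' + b * d') (c * a' + d * c') (c * b' + d * d').
Proof.
move=> nz nz'; apply: val_inj; rewrite -[LHS]/(GLval _) -[RHS]/(GLval _) GL_MxE !g2E //.
  exact: mx2M.
by rewrite -det_mx2 -mx2M det_mulmx !det_mx2 mulf_neq0.
Qed.

Lemma g2_1 : g2 1 0 0 1 = 1%g.
Proof.
apply: val_inj; rewrite -[LHS]/(GLval _) -[RHS]/(GLval _) g2E.
  rewrite -[RHS]/(1 : 'M_2) [RHS]mx2_surj !mxE /=; congr mx2.
by rewrite mulr1 mulr0 subr0 oner_eq0.
Qed.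

Lemma g2_inj a b c d a' b' c' d' : a * d - b * c != 0 -> a' * d' - b' * c' != 0 ->
  g2 a b c d = g2 a' b' c' d' -> [/\ a = a', b = b', c = c' & d = d'].
Proof. by move=> nz nz' /(congr1 (@GLval _ _)); rewrite !g2E //; apply: mx2_inj. Qed.

Lemma det_neq0 a b c d : a * d = 1 + b * c -> a * d - b * c != 0.
Proof. by move->; rewrite addrK oner_eq0. Qed.

Lemma det_mul a b c d a' b' c' d' : a * d = 1 + b * c -> a' * d' = 1 + b' * c' ->
  (a * a' + b * c') * (c * b' + d * d') = 1 + (a * b' + b * d') * (c * a' + d * c').
Proof. by move=> D D'; ring: D D'. Qed.

Lemma g2_SL a b c d : a * d = 1 + b * c -> g2 a b c d \in SL2F.
Proof. by move=> D; rewrite inE g2E ?det_neq0 // det_mx2 D addrK. Qed.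

Lemma SL2P g : g \in SL2F -> exists a b c d, a * d = 1 + b * c /\ g = g2 a b c d.
Proof.
have [a [b [c [d [nz ->]]]]] := g2_surj g.
rewrite inE g2E // det_mx2 subr_eq => /eqP D; by exists a, b, c, d.
Qed.

Lemma det11 x : 1 * 1 = 1 + x * 0 :> F. Proof. by rewrite mulr0 addr0 mulr1. Qed.
Lemma det11' x : 1 * 1 = 1 + 0 * x :> F. Proof. by rewrite mul0r addr0 mulr1. Qed.
Lemma detN1 : -1 * -1 = 1 + 0 * 0 :> F. Proof. by ring. Qed.

Local Notation Z := 'Z(SL2F)%g.

Lemma g2_scalar a b c d : b = 0 -> c = 0 -> a = d -> a * d = 1 + b * c ->
  g2 a b c d = 1%g \/ g2 a b c d = g2 (-1) 0 0 (-1).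
Proof.
move=> -> -> <- D; have : (a - 1) * (a + 1) == 0 by apply/eqP; ring: D.
rewrite mulf_eq0 subr_eq0 addr_eq0 => /orP[] /eqP->; last by right.
by left; rewrite g2_1.
Qed.

(** Commuting with the two elementary unipotents forces a matrix to be scalar. *)
Lemma center_SL2 g : g \in Z -> g = 1%g \/ g = g2 (-1) 0 0 (-1).
Proof.
case/centerP=> /SL2P[a [b [c [d [D ->]]]]] cent.
have nz := det_neq0 D.
have := cent _ (g2_SL (det11 1)); have := cent _ (g2_SL (det11' 1)).
have nU := det_neq0 (det11 1); have nL := det_neq0 (det11' 1).
rewrite /commute !(g2M nz) // !(g2M _ nz) // => EL EU.
have {EL}[] := g2_inj (det_neq0 (det_mul D (det11' 1))) (det_neq0 (det_mul (det11' 1) D)) EL.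
have {EU}[] := g2_inj (det_neq0 (det_mul D (det11 1))) (det_neq0 (det_mul (det11 1) D)) EU.
move=> E1 E2 _ _ E3 _ _ _.
have c0 : c = 0 by apply: (addrI a); move: E1; rewrite !mulr1 !mulr0 !mul1r !addr0.
have b0 : b = 0 by apply: (addrI a); move: E3; rewrite !mulr1 !mul0r !mul1r !addr0.
have ad : a = d by move: E2; rewrite b0 !mulr1 !mul1r addr0 add0r.
exact: g2_scalar.
Qed.

Lemma minus1_cent g : commute g (g2 (-1) 0 0 (-1)).
Proof.
have [a [b [c [d [nz ->]]]]] := g2_surj g.
rewrite /commute (g2M nz (det_neq0 detN1)) (g2M (det_neq0 detN1) nz).
by congr g2; ring.
Qed.

Lemma minus1_center : g2 (-1) 0 0 (-1) \in Z.
Proof.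
apply/centerP; split=> [|g _]; first exact/g2_SL/detN1.
exact/commute_sym/minus1_cent.
Qed.

(** All of the general linear group normalises the centre, so [coset Z] is multiplicative on
    matrices of any non-zero determinant; [ld] needs this. *)
Lemma norm_center g : g \in 'N(Z)%g.
Proof.
apply: (subsetP (cent_sub Z)); apply/centP=> z /center_SL2[->|->].
  exact: commute1.
exact: minus1_cent.
Qed.

Definition PSL2F : {set coset_of Z} := (SL2F / Z)%g.

Canonical PSL2F_group := Eval hnf in [group of PSL2F].

Definition pmx a b c d : coset_of Z := coset Z (g2 a b c d).
Arguments pmx (a b c d)%_ring_scope.

Lemma S_mem a b c d : a * d = 1 + b * c -> pmx a b c d \in PSL2F.
Proof. by move=> D; apply: mem_quotient; apply: g2_SL. Qed.

Lemma PSL2P (t : coset_of Z) : t \in PSL2F ->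
  exists a b c d, a * d = 1 + b * c /\ t = pmx a b c d.
Proof.
case/morphimP=> g _ /SL2P[a [b [c [d [D ->]]]]] ->.
by exists a, b, c, d.
Qed.

Lemma cosetM g g' : coset Z (g * g')%g = (coset Z g * coset Z g')%g.
Proof. by rewrite morphM ?norm_center. Qed.

(** The entries of the product are asked for up to equations, so that [ring] and [field] can prove
    them modulo the relations satisfied by [w] and [i]. *)
Lemma pmxM a b c d a' b' c' d' a2 b2 c2 d2 :
  a * d = 1 + b * c -> a' * d' = 1 + b' * c' ->
  a * a' + b * c' = a2 -> a * b' + b * d' = b2 ->
  c * a' + d * c' = c2 -> c * b' + d * d' = d2 ->
  (pmx a b c d * pmx a' b' c' d')%g = pmx a2 b2 c2 d2.
Proof.
by move=> /det_neq0 D /det_neq0 D' <- <- <- <-; rewrite /pmx -cosetM (g2M D D').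
Qed.

Lemma S1 : pmx 1 0 0 1 = 1%g.
Proof. by rewrite /pmx g2_1 morph1. Qed.

Lemma S_m1 : pmx (-1) 0 0 (-1) = 1%g.
Proof. exact: coset_id minus1_center. Qed.

Lemma S_eq a b c d a' b' c' d' : a * d = 1 + b * c -> a' * d' = 1 + b' * c' ->
  pmx a b c d = pmx a' b' c' d' ->
  [/\ a = a', b = b', c = c' & d = d'] \/
  [/\ a = - a', b = - b', c = - c' & d = - d'].
Proof.
move=> D D' E.
have : g2 a b c d \in (coset Z (g2 a' b' c' d') : {set _}).
  by rewrite -[coset _ _]E /pmx val_coset ?norm_center // rcoset_refl.
rewrite val_coset ?norm_center // => /rcosetP[z /center_SL2[]->].
  by rewrite mul1g => E2; left; apply: g2_inj E2; apply: det_neq0.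
rewrite (g2M (det_neq0 detN1) (det_neq0 D')) => E2; right.
have [-> -> -> ->] := g2_inj (det_neq0 D) (det_neq0 (det_mul detN1 D')) E2.
by split; ring.
Qed.

Local Opaque pmx.

Lemma SV a b c d : a * d = 1 + b * c -> (pmx a b c d)^-1%g = pmx d (- b) (- c) a.
Proof.
move=> D; apply: (mulgI (pmx a b c d)); rewrite mulgV -S1; apply/esym/pmxM; try by ring: D.
Qed.

Definition U x := pmx 1 x 0 1.
Definition Lo x := pmx 1 0 x 1.
Arguments U x%_ring_scope.
Arguments Lo x%_ring_scope.

Lemma UD x y : (U x * U y)%g = U (x + y).
Proof. by apply: pmxM; ring. Qed.

Lemma LoD x y : (Lo x * Lo y)%g = Lo (x + y).
Proof. by apply: pmxM; ring. Qed.

Lemma U0 : U 0 = 1%g. Proof. exact: S1. Qed.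
Lemma Lo0 : Lo 0 = 1%g. Proof. exact: S1. Qed.

Lemma UX x (n : nat) : (U x ^+ n)%g = U (x *+ n).
Proof. by elim: n => [|n IH]; rewrite ?expg0 ?U0 // expgS IH UD mulrS. Qed.

Lemma UN x : (U x)^-1%g = U (- x).
Proof. by apply: (mulgI (U x)); rewrite mulgV UD subrr U0. Qed.

Lemma zpowU x (a : int) : zpow (U x) a = U (x *~ a).
Proof.
case: a => n /=; first by rewrite UX pmulrn.
by rewrite UX UN NegzE mulrNz -pmulrn.
Qed.

Lemma LoX x (n : nat) : (Lo x ^+ n)%g = Lo (x *+ n).
Proof. by elim: n => [|n IH]; rewrite ?expg0 ?Lo0 // expgS IH LoD mulrS. Qed.

Hypothesis Fp_nat : forall x, exists n : nat, x = n%:R.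

Lemma U_gen (N : {group coset_of Z}) x y : x != 0 -> U x \in N -> U y \in N.
Proof.
move=> nz xN; have [n E] := Fp_nat (y / x).
have -> : y = x *+ n by rewrite -mulr_natr -E mulrC divfK.
by rewrite -UX groupX.
Qed.

Lemma Lo_gen (N : {group coset_of Z}) x y : x != 0 -> Lo x \in N -> Lo y \in N.
Proof.
move=> nz xN; have [n E] := Fp_nat (y / x).
have -> : y = x *+ n by rewrite -mulr_natr -E mulrC divfK.
by rewrite -LoX groupX.
Qed.

(** A matrix with [c] non-zero is a product of an upper, a lower and an upper unipotent. If [c = 0],
    multiplication by [Lo 1] first makes the lower left entry equal to [a]. *)
Lemma gen_unipotent (N : {group coset_of Z}) :
  (forall x, U x \in N) -> (forall x, Lo x \in N) -> PSL2F \subset N.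
Proof.
move=> UN_ LN; apply/subsetP=> t /PSL2P[a [b [c [d [D ->]]]]].
have main a' b' c' d' : a' * d' = 1 + b' * c' -> c' != 0 -> pmx a' b' c' d' \in N.
  move=> D' nz.
  have E1 : (U ((a' - 1) / c')%R * Lo c')%g = pmx a' ((a' - 1) / c')%R c' 1.
    by apply: pmxM; field.
  have E2 : (pmx a' ((a' - 1) / c')%R c' 1 * U ((d' - 1) / c')%R)%g = pmx a' b' c' d'.
    have bE : b' = (a' * d' - 1) / c' by rewrite D' addrC addKr mulfK.
    by apply: pmxM; rewrite ?bE; field.
  by rewrite -E2 -E1 !groupM.
have [c0|] := eqVneq c 0; last exact: main.
have a0 : a != 0.
  by apply: contraTneq (oner_neq0 F) => a0; move: D; rewrite c0 a0 mul0r mulr0 addr0 => <-; rewrite eqxx.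
have <- : (Lo (-1) * (Lo 1 * pmx a b c d))%g = pmx a b c d.
  by rewrite mulgA LoD addNr Lo0 mul1g.
rewrite groupM // (_ : (_ * _)%g = pmx a b (a + c) (b + d)); last by apply: pmxM; ring: D.
by apply: main; [ring: D|rewrite c0 addr0].
Qed.

Lemma conj_weyl a b c d : a * d = 1 + b * c ->
  (pmx a b c d ^ pmx 0 1 (-1) 0)%g = pmx d (- c) (- b) a.
Proof.
move=> D; have W : 0 * 0 = 1 + 1 * -1 :> F by ring.
rewrite conjgE SV //.
have -> : (pmx a b c d * pmx 0 1 (-1) 0)%g = pmx (- b) a (- d) c by apply: pmxM; ring: D.
by apply: pmxM; ring: D.
Qed.

(* Given an element of [N] with non-zero lower left entry, a commutator with a
   diagonal matrix is lower triangular, and a commutator of the latter with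
   [Lo 1] is [Lo 15]. *)
Lemma PSL2_simple (N : {group coset_of Z}) : 2%:R != 0 :> F -> 15%:R != 0 :> F ->
  N \subset PSL2F -> PSL2F \subset 'N(N)%g -> (N :!=: 1)%g -> PSL2F \subset N.
Proof.
move=> nz2 nz15 sN nN ntN.
have W : 0 * 0 = 1 + 1 * -1 :> F by ring.
have conjN t s : t \in N -> s \in PSL2F -> (t ^ s)%g \in N.
  by move=> tN sP; rewrite memJ_norm // (subsetP nN).
have cN h t : t \in N -> h \in PSL2F -> (h * t^-1 * h^-1)%g \in N.
  by move=> tN hP; rewrite -mulgA -{1}[h]invgK -conjgE conjN ?groupV.
(* A non-trivial element is brought to [c != 0]: by exchanging [b] and [c] if [b] is non-zero, and
   by conjugation with [Lo 1] if it is diagonal, in which case [a != d]. *)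
have [t tN [a [b [c [d [D [c0 tE]]]]]]] : exists2 t, t \in N & exists a b c d,
    a * d = 1 + b * c /\ c != 0 /\ t = pmx a b c d.
  have [t tN t1] := trivgPn _ ntN.
  have [a [b [c [d [D tE]]]]] := PSL2P (subsetP sN t tN).
  have [c0|c0] := eqVneq c 0; last by exists t => //; exists a, b, c, d.
  have [b0|b0] := eqVneq b 0; last first.
    exists (t ^ pmx 0 1 (-1) 0)%g; first by apply: conjN => //; apply: S_mem.
    exists d, (- c), (- b), a; rewrite tE conj_weyl // oppr_eq0 b0; split=> //.
    by ring: D.
  have ad : a != d.
    apply: contra t1 => /eqP ad; rewrite tE b0 c0 -ad; rewrite b0 c0 -ad in D.
    have : (a - 1) * (a + 1) == 0 by apply/eqP; ring: D.
    by rewrite mulf_eq0 subr_eq0 addr_eq0 => /orP[] /eqP->; rewrite (S1, S_m1).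
  exists (t ^ Lo 1)%g; first by apply: conjN => //; apply/S_mem/det11'.
  exists a, 0, (d - a), d; split; first by rewrite D b0; ring.
  rewrite subr_eq0 eq_sym ad; split=> //.
  rewrite tE conjgE (SV (det11' 1)) b0 c0; rewrite b0 c0 in D.
  have -> : (pmx a 0 0 d * Lo 1)%g = pmx a 0 d d by apply: pmxM; ring: D.
  by apply: pmxM; ring: D.
(* Conjugation by [U (a / c)] makes the upper left entry vanish. *)
have {t tN tE a b D} [e mN] : exists e, pmx 0 (- c^-1) c e \in N.
  exists (a + d); have := conjN t (U (a / c)) tN (S_mem (det11 _)).
  rewrite conjgE tE UN.
  have -> : (pmx a b c d * U (a / c))%g = pmx a (a / c * a + b) c (a + d).
    by apply: pmxM; [exact: D|ring|ring|ring|ring|field].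
  rewrite (_ : (_ * _)%g = pmx 0 (- c^-1) c (a + d)) //.
  have bE : b = (a * d - 1) / c by rewrite D addrC addKr mulfK.
  by apply: pmxM; rewrite ?bE; field.
set v := 2%:R^-1 : F.
have hP : pmx 2%:R 0 0 v \in PSL2F by apply: S_mem; rewrite /v; field.
have [f yN] : exists f, pmx (v * v) 0 f (2%:R * 2%:R) \in N.
  exists (c * e * (1 - v * v)).
  have Dm : 0 * e = 1 + - c^-1 * c by field.
  have E1 : (pmx 2%:R 0 0 v * pmx e c^-1 (- c) 0 = pmx (2%:R * e) (2%:R * c^-1) (- c * v) 0)%g.
    by apply: pmxM; rewrite /v; field; rewrite ?nz2 ?c0.
  have E2 : (pmx (2%:R * e) (2%:R * c^-1) (- c * v) 0 * pmx v 0 0 2%:R =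
      pmx e (4%:R * c^-1) (- c * (v * v)) 0)%g.
    by apply: pmxM; rewrite /v; field; rewrite ?nz2 ?c0.
  have E3 : (pmx 0 (- c^-1) c e * pmx e (4%:R * c^-1) (- c * (v * v)) 0 =
     pmx (v * v) 0 (c * e * (1 - v * v)) (2%:R * 2%:R))%g.
    by apply: pmxM; rewrite /v; field; rewrite ?nz2 ?c0.
  rewrite -E3 groupM // -E2 -E1.
  have -> : pmx e c^-1 (- c) 0 = (pmx 0 (- c^-1) c e)^-1%g by rewrite SV // opprK.
  have -> : pmx v 0 0 2%:R = (pmx 2%:R 0 0 v)^-1%g.
    by rewrite SV ?oppr0 // /v; field; rewrite ?nz2.
  exact: cN.
have vv4 : v * v * (2%:R * 2%:R) = 1 + 0 * f by rewrite /v; field.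
(* The diagonal entries 1/4 and 4 have ratio 16, so conjugation turns [Lo 1] into [Lo 16], and the
   commutator has parameter 16 - 1. *)
have LoN : Lo 15%:R \in N.
  have E1 : (Lo 1 * pmx (2%:R * 2%:R) 0 (- f) (v * v) =
     pmx (2%:R * 2%:R) 0 (2%:R * 2%:R - f) (v * v))%g.
    by apply: pmxM; rewrite /v; field; rewrite ?nz2.
  have E2 : (pmx (2%:R * 2%:R) 0 (2%:R * 2%:R - f) (v * v) * Lo (-1) =
     pmx (2%:R * 2%:R) 0 (2%:R * 2%:R - f - v * v) (v * v))%g.
    by apply: pmxM; rewrite /v; field; rewrite ?nz2.
  have E3 : (pmx (v * v) 0 f (2%:R * 2%:R) * pmx (2%:R * 2%:R) 0 (2%:R * 2%:R - f - v * v) (v * v) =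
     Lo 15%:R)%g.
    by apply: pmxM; rewrite /v; field; rewrite ?nz2.
  rewrite -E3 groupM // -E2 -E1.
  have -> : pmx (2%:R * 2%:R) 0 (- f) (v * v) = (pmx (v * v) 0 f (2%:R * 2%:R))^-1%g.
    by rewrite SV // oppr0.
  have -> : Lo (-1) = (Lo 1)^-1%g by apply: (mulgI (Lo 1)); rewrite mulgV LoD subrr Lo0.
  by apply: cN => //; apply/S_mem/det11'.
have LN x : Lo x \in N by apply: Lo_gen LoN.
apply: gen_unipotent => // x; have := conjN _ _ (LN (- x)) (S_mem W).
by rewrite /Lo (conj_weyl (det11' (- x))) oppr0 opprK.
Qed.

(** The special linear group is the kernel of the determinant, whose image has order dividing
    [#|F| - 1], and its centre has order 1 or 2. *)
Lemma card_PSL2F : (#|F| * (#|F| ^ 2 - 1) %| 2 * #|PSL2F|)%N.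
Proof.
pose f (g : {'GL_2[F]}) : {unit F} := insubd (1%g : {unit F}) (\det (GLval g)).
have fE g : val (f g) = \det (GLval g).
  have nz : \det (GLval g) != 0 by apply: GL_det.
  by apply: insubdK; rewrite -topredE /= unitfE.
have fM : {in [set: {'GL_2[F]}] &, {morph f : g h / (g * h)%g}}.
  by move=> g h _ _; apply: val_inj; rewrite /= !fE GL_MxE det_mulmx.
pose fm := Morphism fM.
have kerE : ('ker fm = SL2F)%g.
  apply/setP=> g; rewrite !inE /=; apply/eqP/eqP => [/(congr1 val)|E].
    by rewrite /= fE.
  by apply: val_inj; rewrite /= fE.
set im := #|(fm @* setT)%g|; set sl := #|SL2F|.
have E : (sl * im = #|F| * #|F|.-1 ^ 2 * #|F|.+1)%N.
  rewrite -card_GL_2 /im card_morphim setIT /sl -kerE.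
  exact: (Lagrange (subsetT ('ker fm)%G)).
have imd : (im %| #|F|.-1)%N.
  by rewrite -card_finField_unit; apply: cardSg (subsetT _).
have q1 : (0 < #|F|.-1)%N by rewrite -ltnS prednK ?finNzRing_gt1 // ltnW // finNzRing_gt1.
have sld : (#|F| * (#|F| ^ 2 - 1) %| sl)%N.
  have -> : (#|F| * (#|F| ^ 2 - 1) = #|F| * #|F|.-1 * #|F|.+1)%N.
    by have := finNzRing_gt1 F; case: #|F| => // n _ /=; rewrite -mulnA; congr (_ * _)%N; lia.
  have [k kE] := dvdnP imd.
  rewrite -(dvdn_pmul2r q1) mulnAC.
  have -> : (#|F| * #|F|.-1 * #|F|.-1 * #|F|.+1 = sl * im)%N.
    by rewrite E -mulnA -mulnn !mulnA.
  by rewrite dvdn_mul.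
apply: dvdn_trans sld _.
have -> : sl = (#|Z| * #|PSL2F|)%N.
  have nZ : SL2F \subset 'N(Z)%g by apply/subsetP=> g _; apply: norm_center.
  by rewrite /PSL2F (card_quotient nZ) (Lagrange (center_sub SL2F_group)).
apply: dvdn_mul => //.
have : (#|Z| <= 2)%N.
  apply: (@leq_trans #|[set (1%g : {'GL_2[F]}); g2 (-1) 0 0 (-1)]|); last by rewrite cards2 ltnS leq_b1.
  by apply/subset_leq_card/subsetP=> z /center_SL2[]->; rewrite !inE eqxx ?orbT.
by have := cardG_gt0 Z; case: #|Z| => [|[|[|]]].
Qed.

(** * Generators of the projective special linear group that behave like rotations *)

Section Generators.
Variables w i : F.
Hypothesis w2 : w * w = w - 1.
Hypothesis i2 : i * i = -1.
Hypothesis nz2 : 2%:R != 0 :> F.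
Hypothesis nz3 : 3%:R != 0 :> F.

(* The diagonal entries of [l2] have ratio [w], so that conjugation by [l2]
   multiplies the parameter of the unipotent [U x] by a primitive sixth root of
   unity. *)
Definition l1 := pmx (- w) (1 - w) 0 (w - 1).
Definition l2 := pmx (i * (w - 1)) 0 0 (i * w).
Definition l3 := pmx (- w) 0 (2%:R * w - 1) (w - 1).
(** Antidiagonal, so that conjugation exchanges upper and lower triangular matrices; the entry
    [2 - w] is the one that takes [l1] to the inverse of [l3]. The determinant [w - 2] need not be
    1. *)
Definition ld := coset Z (g2 0 1 (2%:R - w) 0).

Lemma det_l1 : - w * (w - 1) = 1 + (1 - w) * 0. Proof. by ring: w2. Qed.
Lemma det_l2 : i * (w - 1) * (i * w) = 1 + 0 * 0. Proof. by ring: w2 i2. Qed.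
Lemma det_l3 : - w * (w - 1) = 1 + 0 * (2%:R * w - 1). Proof. by ring: w2. Qed.

Lemma y_neq0 : 2%:R - w != 0.
Proof.
apply: contra nz3 => /eqP y0; apply/eqP.
have -> : 3%:R = (2%:R - w) * (1 + w) by ring: w2.
by rewrite y0 mul0r.
Qed.

Lemma ld_conj a b c d : a * d = 1 + b * c ->
  (pmx a b c d ^ ld)%g = pmx d (c / (2%:R - w)) (b * (2%:R - w)) a.
Proof.
move=> D; have nz := y_neq0; apply: (mulgI ld); rewrite -conjgC.
have D0 : 0 * 0 - 1 * (2%:R - w) != 0 by rewrite mul0r add0r mul1r oppr_eq0.
have D1 : d * a = 1 + c / (2%:R - w) * (b * (2%:R - w)) by rewrite mulrC D; field.
(* As the determinant of [ld] need not be 1, [pmxM] does not apply; the products are taken by [g2M],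
   which asks only for non-zero determinants. *)
Local Transparent pmx.
rewrite /pmx -!cosetM (g2M (det_neq0 D) D0) (g2M D0 (det_neq0 D1)).
Local Opaque pmx.
by congr (coset _ (g2 _ _ _ _)); field.
Qed.

Lemma l12 : (l1 * l2)%g = pmx i i 0 (- i).
Proof. by apply: pmxM; ring: w2 i2. Qed.

Lemma l2_sqr : (l2 * l2)%g = pmx w 0 0 (1 - w).
Proof. by apply: pmxM; ring: w2 i2. Qed.

Lemma l2_cube : (l2 ^+ 3)%g = pmx (- i) 0 0 i.
Proof. by rewrite expgSr expg2 l2_sqr; apply: pmxM; ring: w2 i2. Qed.

Lemma lx : (l2 ^+ 3 * l1 * l2)%g = U 1.
Proof. by rewrite l2_cube -mulgA l12; apply: pmxM; ring: w2 i2. Qed.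

Lemma lq : l2^-1%g = pmx (i * w) 0 0 (i * (w - 1)).
Proof. by rewrite SV ?det_l2 // oppr0. Qed.

Lemma U_conj_q x : (U x ^ l2^-1)%g = U (w * x).
Proof.
rewrite conjgE invgK lq.
have -> : (U x * pmx (i * w) 0 0 (i * (w - 1)))%g = pmx (i * w) (i * (w - 1) * x) 0 (i * (w - 1)).
  by apply: pmxM; ring: w2 i2.
by apply: pmxM; ring: w2 i2.
Qed.

Lemma l2_order : (l2 ^+ 6 = 1)%g.
Proof.
rewrite -[6%N]/(3 * 2)%N expgM l2_cube expg2 -S_m1.
by apply: pmxM; ring: w2 i2.
Qed.

Lemma l_hex : hex_action l2^-1%g (U 1).
Proof.
split.
- by rewrite U_conj_q /commute !UD addrC.
- have -> : (l2^-1 ^+ 2 = l2^-1 * l2^-1)%g by [].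
  rewrite conjgM !U_conj_q UN UD; congr U; by ring: w2.
- by rewrite expVgn l2_order invg1.
Qed.

Lemma l_tr v : tr l2^-1%g (U 1) v = U (v.1%:~R + w * v.2%:~R).
Proof. by rewrite /tr U_conj_q !zpowU UD mulr1 mulrzr. Qed.

Lemma U_eq0 x : U x = 1%g -> x = 0.
Proof.
rewrite -S1 => /(S_eq (det11 x) (det11 0)) [[]|[_ + _ _]] //.
by rewrite oppr0.
Qed.

(** The translations are upper unipotent, so a translation in the group of [l2] and [l3] is trivial;
    this is [rd_vertex]. *)
Lemma lower_closed (t : coset_of Z) : t \in <<[set l2; l3]>>%g ->
  exists a c d, a * d = 1 + 0 * c /\ t = pmx a 0 c d.
Proof.
case/gen_prodgP=> n [f fP ->]; elim: n f fP => [|n IH] f fP.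
  by exists 1, 0, 1; rewrite big_ord0 S1; split=> //; ring.
rewrite big_ord_recl.
have [a [c [d [D ->]]]] := IH (fun j => f (lift ord0 j)) (fun j => fP _).
have /set2P[] := fP ord0 => ->.
  exists (i * (w - 1) * a), (i * w * c), (i * w * d); split.
    by ring: w2 i2 D.
  by apply: pmxM => //; [exact: det_l2|..]; ring.
exists (- w * a), ((2%:R * w - 1) * a + (w - 1) * c), ((w - 1) * d); split.
  by ring: w2 D.
by apply: pmxM => //; [exact: det_l3|..]; ring.
Qed.

(** The relations are visible in the traces: trace -1 gives [l1] order 3, and trace 0 makes
    [l1 * l2] and [l1 * l2 * l3] square to -1. The entry [2 * w - 1] of [l3] is the one for which
    the last trace vanishes. *)
Lemma l_rotation_data :
  rotation_data l1 l2 l3 ld (fun v => v.1%:~R + w * v.2%:~R = 0).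
Proof.
split; rewrite ?lx.
- rewrite expgSr expg2.
  have -> : (l1 * l1)%g = pmx (w - 1) (w - 1) 0 (- w) by apply: pmxM; ring: w2.
  by rewrite -S1; apply: pmxM; ring: w2.
- by rewrite l12 expg2 -S_m1; apply: pmxM; ring: w2 i2.
- rewrite l12 expg2.
  have -> : (pmx i i 0 (- i) * l3)%g =
      pmx (i * (w - 1)) (i * (w - 1)) (i * (1 - 2%:R * w)) (i * (1 - w)).
    by apply: pmxM; ring: w2 i2.
  by rewrite -S_m1; apply: pmxM; ring: w2 i2.
- exact: l_hex.
- by move=> v; rewrite l_tr; split=> [/U_eq0|->] //; apply: U0.
- move=> v; rewrite l_tr => /lower_closed[a [c [d [D E]]]].
  have [[_ -> _ _]|[_ -> _ _]] := S_eq (det11 _) D E => //.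
  by rewrite oppr0.
- have nz := y_neq0; rewrite (ld_conj det_l1) (SV det_l3) oppr0 mul0r.
  by congr pmx; ring: w2.
- by rewrite (ld_conj det_l2) (SV det_l2) !mul0r oppr0.
- have nz := y_neq0; rewrite (ld_conj det_l3) (SV det_l1) oppr0 mul0r.
  congr pmx; apply: (mulIf nz); rewrite divfK //; by ring: w2.
Qed.

(** The conjugate of [U 1] by [ld] is a word in [l2] and [l3] on the one hand, a non-trivial lower
    unipotent on the other; so both kinds of unipotents are generated. *)
Lemma l_gen : PSL2F \subset <<[set l1; l2; l3]>>%g.
Proof.
set N := <<_>>%g.
have [N' NE] : exists N' : {group coset_of Z}, N' = N :> {set _} by exists <<[set l1; l2; l3]>>%G.
have s1N : l1 \in N' by rewrite NE mem_gen // !inE eqxx.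
have s2N : l2 \in N' by rewrite NE mem_gen // !inE eqxx orbT.
have s3N : l3 \in N' by rewrite NE mem_gen // !inE eqxx orbT.
have UN1 : U 1 \in N' by rewrite -lx !groupM ?groupX.
have [_ _ _ _ _ _ d1 d2 d3] := l_rotation_data.
have LN1 : Lo (2%:R - w) \in N'.
  have -> : Lo (2%:R - w) = (U 1 ^ ld)%g.
    by rewrite (ld_conj (det11 1)) mul0r mul1r.
  rewrite -lx 2!conjMg conjXg d1 d2.
  by rewrite !groupM ?groupV // groupX // groupV.
rewrite -NE; apply: gen_unipotent => x; first by apply: U_gen UN1; apply: oner_neq0.
by apply: Lo_gen LN1; apply: y_neq0.
Qed.

Lemma l_gen_mem : [/\ l1 \in PSL2F, l2 \in PSL2F & l3 \in PSL2F].
Proof. by split; apply: S_mem; [apply: det_l1|apply: det_l2|apply: det_l3]. Qed.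

(** The upper left entry of the product is [(i * w) ^+ k], which must be 1 or -1. Its square is
    [(1 - w) ^+ k], and [1 - w], the inverse of [w], is a primitive sixth root of unity as 2 and 3
    are non-zero. *)
Lemma l_elt v k : elt l2^-1%g (U 1) v k = 1%g -> (6 %| k)%N.
Proof.
rewrite -(elt_mod6 l_hex) /elt l_tr /dvdn.
set y := _ + _; have := ltn_pmod k (isT : (0 < 6)%N).
have qX n : (l2^-1 ^+ n)%g = pmx ((i * w) ^+ n) 0 0 ((i * (w - 1)) ^+ n).
  elim: n => [|n IH]; first by rewrite expg0 !expr0 S1.
  rewrite expgS IH lq !exprS; apply: pmxM; try ring.
    by ring: w2 i2.
  rewrite -exprMn (_ : i * w * (i * (w - 1)) = 1) ?expr1n; first by ring.
  by ring: w2 i2.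
have D n : (i * w) ^+ n * (i * (w - 1)) ^+ n = 1 + 0 * 0.
  rewrite -exprMn (_ : i * w * (i * (w - 1)) = 1) ?expr1n; first by ring.
  by ring: w2 i2.
have key n : (l2^-1 ^+ n * U y = 1)%g -> (1 - w) ^+ n = 1.
  rewrite qX (_ : (_ * _)%g = pmx ((i * w) ^+ n) ((i * w) ^+ n * y) 0 ((i * (w - 1)) ^+ n)); last first.
    by apply: pmxM; rewrite ?D //; ring.
  rewrite -S1 => E.
  have D1 : (i * w) ^+ n * (i * (w - 1)) ^+ n = 1 + (i * w) ^+ n * y * 0.
    by rewrite D; ring.
  have -> : 1 - w = (i * w) * (i * w) by ring: w2 i2.
  rewrite exprMn; have [[-> _ _ _]|[-> _ _ _]] := S_eq D1 (det11 0) E; by ring.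
have w1 : w != 0 by apply: contraTneq (oner_neq0 F) => w0; have := w2; rewrite w0 mul0r sub0r => /eqP; rewrite eq_sym oppr_eq0 => ->.
case: (k %% 6)%N => [|[|[|[|[|[|//]]]]]] // _ /key E; exfalso.
- have w0 : w = 0 by move: E; rewrite expr1 => /eqP; rewrite subr_eq addrC -subr_eq subrr eq_sym => /eqP.
  by rewrite w0 eqxx in w1.
- have wm : w = -1.
    have : (1 - w) ^+ 2 = - w by rewrite expr2; ring: w2.
    by rewrite E => ->; rewrite opprK.
  case/negP: nz3; have w2' := w2; rewrite wm in w2'.
  have -> : 3%:R = -1 * -1 - (-1 - 1) :> F by ring.
  by rewrite w2' subrr.
- case/negP: nz2; have : (1 - w) ^+ 3 = -1 by rewrite !exprS expr0; ring: w2.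
  by rewrite E => E'; rewrite -subr_eq0 subr0 -[2%:R]/(1 + 1) {2}E' subrr.
- have w_2 : w = 2%:R by have : (1 - w) ^+ 4 = w - 1 by [rewrite !exprS expr0; ring: w2]; rewrite E => /eqP; rewrite eq_sym subr_eq => /eqP->; ring.
  case/negP: nz3; have w2' := w2; rewrite w_2 in w2'.
  have -> : 3%:R = 2%:R * 2%:R - (2%:R - 1) :> F by ring.
  by rewrite w2' subrr.
- have w_1 : w = 1 by rewrite -E !exprS expr0; ring: w2.
  by have := w2; rewrite w_1 mulr1 subrr => /eqP; rewrite oner_eq0.
Qed.

End Generators.
End PSL2.

(** With [4 k] non-zero elements, some non-zero [x] is not among the at most [2 k] roots of
    ['X^(k * 2) - 1]. Then [x ^+ (k * 2)] squares to 1 without being 1, so it is -1. *)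
Lemma finField_sqrtN1 (F : finFieldType) : 2%:R != 0 :> F -> (4 %| #|F|.-1)%N ->
  exists i : F, i * i = -1.
Proof.
move=> nz2 /dvdnP[k kE].
have q1 : (0 < #|F|.-1)%N by rewrite -ltnS prednK ?finNzRing_gt1 // ltnW // finNzRing_gt1.
have k0 : (0 < k)%N by move: q1; rewrite kE; case: k {kE}.
pose P : {poly F} := 'X^(k * 2) - 1.
have sP : size P = (k * 2).+1 by rewrite size_XnsubC // muln_gt0 k0.
have [x x0 xP] : exists2 x : F, x != 0 & x ^+ (k * 2) != 1.
  apply/exists_inP; apply: contraT; rewrite negb_exists_in => /forall_inP all.
  have allr : seq.all (root P) (enum (predC1 (0 : F))).
    apply/allP=> x; rewrite mem_enum => x0; have := all x x0; rewrite negbK => /eqP xE.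
    by rewrite /root !hornerE xE subrr.
  have Pn0 : P != 0 by rewrite -size_poly_gt0 sP.
  have := max_poly_roots Pn0 allr (enum_uniq _).
  by rewrite sP -cardE cardC1 kE; move: k0; clear; lia.
exists (x ^+ k).
have x4 : x ^+ (k * 4) = 1.
  apply: (mulfI x0); rewrite -exprS mulr1 -kE prednK; last exact: ltnW (finNzRing_gt1 F).
  exact: expf_card.
have : (x ^+ (k * 2) - 1) * (x ^+ (k * 2) + 1) == 0.
  by rewrite -subr_sqr expr1n -exprM -mulnA x4 subrr.
rewrite mulf_eq0 subr_eq0 (negPf xP) /= addr_eq0 => /eqP <-.
by rewrite -exprD addnn -muln2.
Qed.

Lemma rotation_data_iff (gT : finGroupType) (s1 s2 s3 d : gT) (L L' : point -> Prop) :
  (forall v, L v <-> L' v) -> rotation_data s1 s2 s3 d L -> rotation_data s1 s2 s3 d L'.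
Proof.
move=> LL' [r1 r2 r3 r4 r5 r6 r7 r8 r9]; split=> // v; first by rewrite -LL'.
by move/r6/LL'.
Qed.

Lemma PSL2F_data (F : finFieldType) (w i : F) :
    (forall x : F, exists n : nat, x = n%:R) -> w * w = w - 1 -> i * i = -1 ->
    2%:R != 0 :> F -> 3%:R != 0 :> F -> 15%:R != 0 :> F ->
  exists s1 s2 s3 d : coset_of 'Z(SL2F F)%g,
  [/\ rotation_data s1 s2 s3 d (fun v => v.1%:~R + w * v.2%:~R = 0),
      <<[set s1; s2; s3]>>%g = PSL2F F,
      (forall v k, elt s2^-1%g (s2 ^+ 3 * s1 * s2)%g v k = 1%g -> (6 %| k)%N),
      (forall N : {group coset_of 'Z(SL2F F)%g}, N \subset PSL2F F ->
         PSL2F F \subset 'N(N)%g -> (N :!=: 1)%g -> PSL2F F \subset N)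
    & (#|F| * (#|F| ^ 2 - 1) %| 2 * #|PSL2F F|)%N].
Proof.
move=> Fn w2 i2 nz2 nz3 nz15; exists (l1 w), (l2 w i), (l3 w), (ld w); split.
- exact: l_rotation_data.
- apply/eqP; rewrite eqEsubset l_gen // andbT gen_subG.
  have [m1 m2 m3] := l_gen_mem w2 i2.
  by apply/subsetP=> t /setUP[/set2P[]->|/set1P->].
- by move=> v k; rewrite lx //; apply: l_elt.
- by move=> N; apply: PSL2_simple.
- exact: card_PSL2F.
Qed.

Lemma PSL2_data (p b c : nat) : prime p -> p = 1 %[mod 12] -> (0 < b)%N -> (0 < c)%N ->
  p = (b ^ 2 + b * c + c ^ 2)%N ->
  exists s1 s2 s3 d : coset_of 'Z(SL2 p)%g,
  [/\ rotation_data s1 s2 s3 d (fun v => (p%:Z %| c%:Z * v.1 - b%:Z * v.2)%Z),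
      <<[set s1; s2; s3]>>%g = PSL2 p,
      (forall v k, elt s2^-1%g (s2 ^+ 3 * s1 * s2)%g v k = 1%g -> (6 %| k)%N),
      (forall N : {group coset_of 'Z(SL2 p)%g}, N \subset PSL2 p ->
         PSL2 p \subset 'N(N)%g -> (N :!=: 1)%g -> PSL2 p \subset N)
    & (p * (p ^ 2 - 1) %| 2 * #|PSL2 p|)%N].
Proof.
move=> p_pr p12 b0 c0 pE.
have p1 : (1 < p)%N := prime_gt1 p_pr.
have nz n : ~~ (p %| n)%N -> n%:R != 0 :> 'F_p by rewrite (dvdn_pcharf (pchar_Fp p_pr)).
have p13 : (13 <= p)%N by move: p12 p1; clear; lia.
have small n : (0 < n < 13)%N -> n%:R != 0 :> 'F_p.
  case/andP=> n0 n13; apply: nz; apply: contraL n13 => /dvdn_leq-/(_ n0).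
  by move: p13; clear; lia.
have nz15 : 15%:R != 0 :> 'F_p.
  rewrite (_ : 15%:R = 3%:R * 5%:R); last by ring.
  by rewrite mulf_neq0 ?small.
have nzc : c%:R != 0 :> 'F_p.
  apply: nz; apply/negP=> /dvdn_leq-/(_ c0); rewrite pE.
  by move: b0 c0; clear; nia.
have sum0 : b%:R * b%:R + b%:R * c%:R + c%:R * c%:R = 0 :> 'F_p.
  by rewrite -!natrM -!natrD !mulnn -pE pchar_Fp_0.
pose w : 'F_p := - (b%:R / c%:R).
have w2 : w * w = w - 1.
  apply/eqP; rewrite -subr_eq0; apply/eqP.
  apply: (mulIf (mulf_neq0 nzc nzc)); rewrite mul0r -sum0 /w; by field.
have [i i2] : exists i : 'F_p, i * i = -1.
  apply: finField_sqrtN1; first exact: small.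
  by rewrite card_Fp //; move: p12 p1; clear; lia.
have Fn (x : 'F_p) : exists n : nat, x = n%:R by exists (x : nat); rewrite natr_Zp.
(* [SL2 p] unfolds to [SL2F] over ['F_p], so the data apply as they stand. *)
have [s1 [s2 [s3 [d [R G6 E pmx C]]]]] :=
  PSL2F_data Fn w2 i2 (small 2%N isT) (small 3%N isT) nz15.
exists s1, s2, s3, d; split=> //; last first.
  by have := C; rewrite card_Fp.
apply: rotation_data_iff R => v.
have E0 : (c%:Z * v.1 - b%:Z * v.2)%:~R = c%:R * (v.1%:~R + w * v.2%:~R) :> 'F_p.
  by rewrite rmorphB !rmorphM /= -!pmulrn /w; field.
rewrite (dvdz_pcharf (pchar_Fp p_pr)) E0 mulf_eq0 (negPf nzc) /=.
by split=> [->|/eqP].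
Qed.

(** * Coset geometries *)

Local Close Scope ring_scope.
Local Open Scope group_scope.

Definition proper_rank (i : nat) : bool := (0 < i < 5)%N.

(** The groups [cg_K 1, ..., cg_K 4] are the stabilisers in [cg_G] of the faces
    of ranks 0, ..., 3 of a base flag, so that ranks are shifted by one; the two
    improper faces have index 0 and 5. The flag adjacent to the base flag at
    index [i] is the image under [cg_a i] of the one adjacent at index 1. *)
Record coset_geometry := CosetGeometry {
  cg_type : finGroupType;
  cg_G : {group cg_type};
  cg_K : nat -> {group cg_type};
  cg_a : nat -> cg_type;
  cg_sub : forall i, cg_K i \subset cg_G;
  cg_bot : cg_K 0 = cg_G :> {set cg_type};
  cg_top : cg_K 5 = cg_G :> {set cg_type};
  cg_factor : forall i j k, (i < j < k)%N -> (k <= 5)%N ->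
    cg_K j \subset (cg_K j :&: cg_K i) * (cg_K j :&: cg_K k);
  cg_diamond : forall i, (i < 4)%N -> exists x,
    [/\ x \in cg_K i :&: cg_K i.+2, x \notin cg_K i.+1 &
        cg_K i :&: cg_K i.+2 \subset cg_K i.+1 :|: cg_K i.+1 :* x];
  cg_a1 : cg_a 1 = 1;
  cg_aG : forall i, cg_a i \in cg_G;
  cg_aK : forall i j l, proper_rank i -> proper_rank j -> proper_rank l ->
    l != i -> l != j -> (cg_a i)^-1 * cg_a j \in cg_K l;
  cg_a2 : cg_a 2 \in cg_K 2 * cg_K 1;
  cg_a2n : cg_a 2 \notin cg_K 1;
  cg_gen : forall (J : pred nat) g, g \in cg_G ->
    (forall j, proper_rank j -> J j -> g \in cg_K j) ->
    g \in <<[set x | [exists i : 'I_6, exists j : 'I_6,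
      [&& proper_rank i, proper_rank j, ~~ J i, ~~ J j &
          x == (cg_a i)^-1 * cg_a j]]]>>
}.

Section Faces.
Variable X : coset_geometry.
Local Notation gT := (cg_type X).
Local Notation G := (cg_G X).
Local Notation K := (@cg_K X).
Local Notation a := (@cg_a X).

Definition cface_pred : pred ('I_6 * {set gT}) := fun x => x.2 \in rcosets (K x.1) G.
Definition cface : Type := {x | cface_pred x}.
HB.instance Definition _ := Finite.copy cface {x | cface_pred x}.

Implicit Types (x y z : cface) (g h : gT).
Definition tp x : 'I_6 := (val x).1.
Definition cs x : {set gT} := (val x).2.

Lemma cs_coset x g : g \in cs x -> cs x = K (tp x) :* g.
Proof.
have /rcosetsP[h hG] := valP x; rewrite -/(tp x) -/(cs x) => -> gx.
exact/esym/rcoset_eqP.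
Qed.

Lemma cs_sub x : cs x \subset G.
Proof.
have /rcosetsP[h hG] := valP x; rewrite -/(tp x) -/(cs x) => ->.
by apply/subsetP=> _ /rcosetP[k kK ->]; rewrite groupM // (subsetP (cg_sub _ _) _ kK).
Qed.

Lemma cs_ex x : exists g, g \in cs x.
Proof.
have /rcosetsP[h hG] := valP x; rewrite -/(tp x) -/(cs x) => ->.
by exists h; apply: rcoset_refl.
Qed.

Lemma cs_mulP x g h : g \in cs x -> (h \in cs x) = (h * g^-1 \in K (tp x)).
Proof. by move=> gx; rewrite (cs_coset gx) mem_rcoset. Qed.

Lemma cface_eq x y g : tp x = tp y -> g \in cs x -> g \in cs y -> x = y.
Proof.
move=> t gx gy; apply: val_inj; rewrite [val x]surjective_pairing.
rewrite [val y]surjective_pairing -/(tp x) -/(tp y) -/(cs x) -/(cs y).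
by rewrite (cs_coset gx) (cs_coset gy) t.
Qed.

Lemma cs_improper x : ~~ proper_rank (tp x) -> cs x = G.
Proof.
have [g gx] := cs_ex x; rewrite (cs_coset gx) => px.
have gG := subsetP (cs_sub x) g gx.
suff -> : K (tp x) = G by rewrite rcoset_id.
apply: val_inj; rewrite /=; case: (tp x) px => -[|[|[|[|[|[|//]]]]]] //= _ _.
  exact: cg_bot.
exact: cg_top.
Qed.

Definition cle x y : bool := (tp x <= tp y)%N && (cs x :&: cs y != set0).

Lemma cleP x y :
  reflect ((tp x <= tp y)%N /\ exists2 g, g \in cs x & g \in cs y) (cle x y).
Proof.
apply: (iffP andP) => [[t /set0Pn[g /setIP[gx gy]]]|[t [g gx gy]]].
  by split=> //; exists g.
by split=> //; apply/set0Pn; exists g; rewrite inE gx.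
Qed.

Lemma cle_eq x y : cle x y -> tp x = tp y -> x = y.
Proof. by case/cleP=> _ [g gx gy] t; apply: (cface_eq t gx). Qed.

(* This uses the factorisation [cg_factor] of the middle group. *)
Lemma cle_common x y z : cle x y -> cle y z ->
  exists g, [/\ g \in cs x, g \in cs y & g \in cs z].
Proof.
move=> xy yz; have /cleP[txy [g gx gy]] := xy; have /cleP[tyz [h hy hz]] := yz.
case: (eqVneq (tp x) (tp y)) => [t|txy'].
  by exists h; rewrite (cle_eq xy t).
case: (eqVneq (tp y) (tp z)) => [t|tyz'].
  by exists g; rewrite -(cle_eq yz t).
have lt : (tp x < tp y < tp z)%N.
  by rewrite !ltn_neqAle txy tyz txy' tyz'.
have hg : h * g^-1 \in K (tp y) by rewrite -(cs_mulP _ gy).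
have /subsetP/(_ (g * h^-1)) := cg_factor X lt (ltn_ord (tp z)).
rewrite -groupV invMg invgK => /(_ hg).
case/mulsgP=> u v /setIP[uy ux] /setIP[vy vz] E.
have E2 : u^-1 * g = v * h by rewrite -[g](mulgKV h) E !mulgA mulVg mul1g.
exists (u^-1 * g); rewrite (cs_mulP _ gx) (cs_mulP _ gy) mulgK !groupV uy ux.
by split=> //; rewrite E2 (cs_mulP _ hz) mulgK.
Qed.

Lemma cle_refl : reflexive cle.
Proof. by move=> x; apply/cleP; split=> //; have [g gx] := cs_ex x; exists g. Qed.

Lemma cle_anti : antisymmetric cle.
Proof.
move=> x y /andP[xy yx]; apply: (cle_eq xy); apply/val_inj/anti_leq.
by case/andP: xy yx => -> _ /andP[].
Qed.

Lemma cle_trans : transitive cle.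
Proof.
move=> y x z xy yz; have [g [gx _ gz]] := cle_common xy yz.
apply/cleP; split; last by exists g.
by case/andP: xy yz => xy _ /andP[/(leq_trans xy)].
Qed.

HB.instance Definition _ :=
  Order.Le_isPOrder.Build (Order.Disp tt tt) cface cle_refl cle_anti cle_trans.

Lemma leE x y : (x <= y)%O = cle x y. Proof. by []. Qed.

Lemma tp_le x y : (x <= y)%O -> (tp x <= tp y)%N. Proof. by case/andP. Qed.

Lemma tp_lt x y : (x < y)%O -> (tp x < tp y)%N.
Proof.
rewrite lt_neqAle => /andP[ne xy]; rewrite ltn_neqAle tp_le // andbT.
by apply: contra ne => /eqP/val_inj/(cle_eq xy)->.
Qed.

Lemma comparable_le x y : (x >=< y)%O -> (tp x <= tp y)%N -> (x <= y)%O.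
Proof.
case/orP=> // yx t; have := tp_le yx => t'.
by rewrite (cle_eq yx) //; apply/val_inj/anti_leq; rewrite t t'.
Qed.

(** The default value 1 makes [fc] total, so that a face can be formed without a proof that [g] lies
    in [G]. *)
Definition coset_rep g := if g \in G then g else 1.

Lemma coset_repG g : coset_rep g \in G.
Proof. by rewrite /coset_rep; case: ifP. Qed.

Lemma fc_subproof (i : 'I_6) g : cface_pred (i, K i :* coset_rep g).
Proof. by apply/rcosetsP; exists (coset_rep g); rewrite ?coset_repG. Qed.

Definition fc (i : 'I_6) g : cface := exist (fun w : 'I_6 * {set gT} => is_true (cface_pred w)) _ (fc_subproof i g).

Lemma cs_fc i g : g \in G -> cs (fc i g) = K i :* g.
Proof. by move=> gG; rewrite /cs /= /coset_rep gG. Qed.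

Lemma mem_fc i g : g \in G -> g \in cs (fc i g).
Proof. by move=> gG; rewrite cs_fc // rcoset_refl. Qed.

Lemma fcE x g : g \in cs x -> x = fc (tp x) g.
Proof.
move=> gx; apply: (cface_eq _ gx) => //.
by apply: mem_fc; apply: (subsetP (cs_sub x)).
Qed.

Lemma fc_eqP i g h : g \in G -> h \in G ->
  reflect (fc i g = fc i h) (g * h^-1 \in K i).
Proof.
move=> gG hG; apply: (iffP idP) => [gh|E].
  by apply: (@cface_eq _ _ g); rewrite ?mem_fc // cs_fc // mem_rcoset.
by rewrite -mem_rcoset -cs_fc // -E mem_fc.
Qed.

Lemma fc_mulK (i : 'I_6) g k : g \in G -> k \in K i -> fc i (k * g) = fc i g.
Proof.
move=> gG kK; apply/fc_eqP; rewrite ?mulgK // groupM //.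
exact: subsetP (cg_sub _ _) _ kK.
Qed.

Lemma fc_le (i j : 'I_6) g : g \in G -> (i <= j)%N -> (fc i g <= fc j g)%O.
Proof. by move=> gG ij; apply/cleP; split=> //; exists g; rewrite mem_fc. Qed.

Lemma le_improper x y : ~~ proper_rank (tp x) || ~~ proper_rank (tp y) ->
  (tp x <= tp y)%N -> (x <= y)%O.
Proof.
move=> pr t; apply/cleP; split=> //.
case/orP: pr => /cs_improper ->.
  by have [g gy] := cs_ex y; exists g => //; apply: (subsetP (cs_sub y)).
by have [g gx] := cs_ex x; exists g => //; apply: (subsetP (cs_sub x)).
Qed.

Lemma cchainP (A : {set cface}) :
  reflect {in A &, forall x y, (x >=< y)%O} (chain A).
Proof.
apply: (iffP forall_inP) => [cA x y xA yA|cA x xA].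
  exact: (forall_inP (cA x xA)).
by apply/forall_inP=> y yA; apply: cA.
Qed.

Lemma chain_tp_inj (A : {set cface}) : chain A -> {in A &, injective tp}.
Proof.
move=> /cchainP cA x y xA yA t.
by apply: cle_eq (t); apply: comparable_le; [apply: cA|rewrite t].
Qed.

Lemma flag_cchain (A : {set cface}) : flag A -> chain A.
Proof. exact: maxsetp. Qed.

Lemma flag_absorb (A : {set cface}) z : flag A ->
  {in A, forall x, (z >=< x)%O} -> z \in A.
Proof.
move=> fA zc; suff <- : z |: A = A by rewrite !inE eqxx.
have /maxsetP[/cchainP cA maxA] := fA; apply: maxA; last exact: subsetUr.
apply/cchainP=> u v; rewrite !inE; case/orP=> [/eqP->|uA].
  by case/orP=> [/eqP->|/zc //]; rewrite comparablexx.
by case/orP=> [/eqP->|vA]; [rewrite comparable_sym zc|apply: cA].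
Qed.

Lemma flag_improper (A : {set cface}) z : flag A -> ~~ proper_rank (tp z) -> z \in A.
Proof.
move=> fA pz; apply: flag_absorb => // x _.
by case/orP: (leq_total (tp z) (tp x)) => t; apply/orP; [left|right];
  apply: le_improper => //; rewrite pz ?orbT.
Qed.

(* Between two incident faces there is a face of any intermediate rank: take
   the coset of a common element. *)
Lemma flag_tp (A : {set cface}) i : flag A -> exists2 x, x \in A & tp x = i.
Proof.
move=> fA; have /cchainP cA := flag_cchain fA.
have [pi|npi] := boolP (proper_rank i); last first.
  by exists (fc i 1) => //; apply: flag_improper.
have [/existsP[x /andP[xA /eqP]]|] := boolP [exists x in A, tp x == i].
  by exists x.
rewrite negb_exists_in => /forall_inP nA.
have botA : fc ord0 1 \in A by apply: flag_improper.
have topA : fc ord_max 1 \in A by apply: flag_improper.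
have [/= i0 i5] := andP pi.
case: (@arg_maxnP _ (fc ord0 1) (fun x => (x \in A) && (tp x < i)%N) (fun x => tp x : nat)).
  by rewrite botA.
move=> x /andP[xA xi] xmax.
case: (@arg_minnP _ (fc ord_max 1) (fun x => (x \in A) && (i < tp x)%N) (fun x => tp x : nat)).
  by rewrite topA.
move=> y /andP[yA yi] ymin.
have /cleP[_ [g gx gy]] : (x <= y)%O.
  by apply: comparable_le; rewrite ?cA // ltnW // (ltn_trans xi).
have gG := subsetP (cs_sub x) g gx.
have xz : (x <= fc i g)%O by rewrite (fcE gx) fc_le // ltnW.
have zy : (fc i g <= y)%O by rewrite (fcE gy) fc_le // ltnW.
exists (fc i g) => //; apply: flag_absorb => // w wA.
have := nA w wA; rewrite -val_eqE /= neq_ltn => /orP[wi|iw].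
  apply/orP; right; apply: le_trans xz.
  by apply: comparable_le; rewrite ?cA //; apply: xmax; rewrite wA.
apply/orP; left; apply: le_trans zy _.
by apply: comparable_le; rewrite ?cA //; apply: ymin; rewrite wA.
Qed.

Lemma cflag_size (A : {set cface}) : flag A -> #|A| = 6%N.
Proof.
move=> fA; rewrite -(card_in_imset (chain_tp_inj (flag_cchain fA))).
rewrite -[RHS](card_ord 6) -cardsT; congr #|pred_of_set _|.
by apply/setP=> i; rewrite !inE; have [x xA <-] := flag_tp i fA; rewrite imset_f.
Qed.

Lemma cchain_flag (A : {set cface}) : chain A ->
  (forall i, exists2 x, x \in A & tp x = i) -> flag A.
Proof.
move=> cA allA; apply/maxsetP; split=> // B cB sAB.
apply/eqP; rewrite eqEsubset sAB andbT; apply/subsetP=> y yB.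
have [x xA t] := allA (tp y).
by rewrite -(chain_tp_inj cB (subsetP sAB x xA) yB t).
Qed.

Lemma flag_of_fun (f : 'I_6 -> cface) : (forall i, tp (f i) = i) ->
  (forall i j : 'I_6, (i < j)%N -> (f i <= f j)%O) -> flag [set f i | i : 'I_6].
Proof.
move=> tf fle; apply: cchain_flag => [|i]; last by exists (f i); rewrite ?imset_f.
apply/cchainP=> _ _ /imsetP[i _ ->] /imsetP[j _ ->].
case: (ltngtP i j) => [ij|ji|/val_inj->]; last exact: comparablexx.
  by apply/orP; left; apply: fle.
by apply/orP; right; apply: fle.
Qed.

Definition fl g : {set cface} := [set fc i g | i : 'I_6].
(** [fl' g] is to be the flag adjacent to [fl g] at index 1. The flag adjacent to [fl 1] at index 2
    keeps the base vertex and is the image of [fl' 1] under [a 2]; hence the vertex of [fl' 1] is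
    the coset of [(a 2)^-1]. *)
Definition fc' (i : 'I_6) g : cface :=
  if i == 1%N :> nat then fc i ((a 2)^-1 * g) else fc i g.
Definition fl' g : {set cface} := [set fc' i g | i : 'I_6].

Lemma flag_fl g : g \in G -> flag (fl g).
Proof. by move=> gG; apply: flag_of_fun => // i j /ltnW/fc_le->. Qed.

Lemma tp_fc' i g : tp (fc' i g) = i.
Proof. by rewrite /fc'; case: ifP. Qed.

Lemma fc'_le (i j : 'I_6) g : g \in G -> (i < j)%N -> (fc' i g <= fc' j g)%O.
Proof.
move=> gG; rewrite /fc'; case: eqP => [i1|_]; case: eqP => [j1|_] ij.
- by rewrite i1 j1 in ij.
- have hG : (a 2)^-1 * g \in G by rewrite groupM // groupV cg_aG.
  have [pj|npj] := boolP (proper_rank j); last first.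
    by apply: le_improper; rewrite ?npj ?orbT // ltnW.
  have [j2|j2] := eqVneq (j : nat) 2%N.
    (* With [a 2 = u * v], the element [v * (a 2)^-1] is [u^-1]; it lies in the coset of the new
       vertex and in the stabiliser of the base edge. *)
    have /mulsgP[u v u2 v1 E] := cg_a2 X.
    apply/cleP; split; first by rewrite /= ltnW.
    exists (v * (a 2)^-1 * g).
      by rewrite cs_fc // -mulgA mem_rcoset mulgK i1.
    rewrite cs_fc // mem_rcoset mulgK E invMg mulgA mulgV mul1g groupV.
    by rewrite j2.
  have -> : fc j g = fc j ((a 2)^-1 * g).
    rewrite fc_mulK // groupV.
    have := @cg_aK X 1 2 j isT isT pj; rewrite cg_a1 invg1 mul1g; apply=> //.
    by apply: contraTneq ij => ->; rewrite i1.
  exact/fc_le/ltnW.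
- apply: le_improper; last exact: ltnW.
  by case: (i : nat) j1 ij => //= i' ->.
- exact/fc_le/ltnW.
Qed.

Lemma flag_fl' g : g \in G -> flag (fl' g).
Proof.
by move=> gG; apply: flag_of_fun => [i|i j]; [apply: tp_fc'|apply: fc'_le].
Qed.

Lemma fc_fl i g : fc i g \in fl g. Proof. exact: imset_f. Qed.

Lemma fc'_fl' i g : fc' i g \in fl' g. Proof. exact: imset_f. Qed.

Lemma mem_fl g x : g \in G -> (x \in fl g) = (g \in cs x).
Proof.
move=> gG; apply/imsetP/idP=> [[i _ ->]|gx]; first exact: mem_fc.
by exists (tp x) => //; apply: fcE.
Qed.

(* The adjacency of the flags [fl g] and [fl' (a i * g)] at index [i]. *)
Lemma fl_adj (i l : 'I_6) g : g \in G -> proper_rank i -> l != i ->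
  fc' l (a i * g) = fc l g.
Proof.
move=> gG pi li; have aG := cg_aG X.
have [pl|npl] := boolP (proper_rank l); last first.
  apply: (@cface_eq _ _ g); rewrite ?tp_fc' // ?mem_fc //.
  by rewrite cs_improper ?tp_fc'.
rewrite /fc'; case: eqP => [l1|l1].
  rewrite mulgA fc_mulK //.
  have [i2|i2] := eqVneq (i : nat) 2%N; first by rewrite i2 mulVg group1.
  by apply: cg_aK => //; rewrite l1.
rewrite fc_mulK // -[a i]mul1g -invg1 -(cg_a1 X).
by apply: cg_aK => //; apply/eqP.
Qed.

(** When [J] consists of all indices but [i], the only generator left in [cg_gen] is the trivial
    [(a i)^-1 * a i]. The consequence is that [G] acts freely on the flags [fl g]. *)
Lemma all_K_trivial g i : g \in G -> proper_rank i ->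
  (forall j, proper_rank j -> j != i -> g \in K j) -> g = 1.
Proof.
move=> gG pi gK; have := @cg_gen X [pred j | j != i] g gG gK.
set S := [set x | _]; have -> : << S >> = 1.
  apply/trivgP; rewrite gen_subG; apply/subsetP=> x.
  rewrite inE => /existsP[k /existsP[l /and5P[_ _]]].
  rewrite /= !negbK => /eqP-> /eqP-> /eqP->.
  by rewrite mulVg inE.
by move/set1gP.
Qed.

(** Agreement away from index 1 forces [g = h], and agreement at index 1 then puts [a 2] into
    [K 1]. *)
Lemma fl_neq g h : g \in G -> h \in G -> fl g <> fl' h.
Proof.
move=> gG hG E.
have fE (l : 'I_6) : fc l g = fc' l h.
  apply: (chain_tp_inj (flag_cchain (flag_fl gG))); rewrite ?tp_fc' //.
    exact: imset_f.
  by rewrite E; apply: imset_f.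
have gh : g = h.
  apply/eqP; rewrite eq_mulgV1; apply/eqP.
  apply: (@all_K_trivial _ 1); rewrite ?groupM ?groupV // => j pj j1.
  have j6 : (j < 6)%N by case/andP: pj => _; apply: ltnW.
  have := fE (Ordinal j6); rewrite /fc' /= (negPf j1).
  by move/(fc_eqP (Ordinal j6) gG hG).
have := fE (inord 1); rewrite /fc' inordK //= -gh => E1.
have := cg_a2n X; rewrite -groupV.
have aG : (a 2)^-1 * g \in G by rewrite groupM // groupV cg_aG.
have /esym/fc_eqP := E1; rewrite inordK // mulgK => ->//.
Qed.

(** Without index [i] only three proper faces remain, and [cle_common] gives them a common element.
    All four need not have one: the flags [fl' g] do not. *)
Lemma flag_point (A : {set cface}) (i : 'I_6) : flag A -> proper_rank i ->
  exists2 g, g \in G & {in A, forall x, tp x != i -> g \in cs x}.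
Proof.
move=> fA pi; have /cchainP cA := flag_cchain fA.
have key (j k l : 'I_6) : (j < k < l)%N ->
    (forall m : 'I_6, proper_rank m -> m != i -> [|| m == j, m == k | m == l]) ->
    exists2 g, g \in G & {in A, forall x, tp x != i -> g \in cs x}.
  move=> /andP[jk kl] all.
  have [x xA tx] := flag_tp j fA; have [y yA ty] := flag_tp k fA.
  have [z zA tz] := flag_tp l fA.
  have xy : cle x y by apply: comparable_le; rewrite ?cA // tx ty ltnW.
  have yz : cle y z by apply: comparable_le; rewrite ?cA // tz ty ltnW.
  have [g [gx gy gz]] := cle_common xy yz.
  have gG := subsetP (cs_sub x) g gx; exists g => // w wA wi.
  have [pw|npw] := boolP (proper_rank (tp w)); last by rewrite cs_improper.
  have inj := chain_tp_inj (flag_cchain fA).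
  have /or3P[] := all _ pw wi; rewrite -?tx -?ty -?tz => /eqP t.
  - by rewrite (inj w x).
  - by rewrite (inj w y).
  - by rewrite (inj w z).
move: i pi key => [[|[|[|[|[|[|//]]]]]] // lti] _ key.
- apply: (key (inord 2) (inord 3) (inord 4)); rewrite ?inordK //.
  by move=> [[|[|[|[|[|[|//]]]]]] ?] // _; rewrite -!val_eqE /= !inordK.
- apply: (key (inord 1) (inord 3) (inord 4)); rewrite ?inordK //.
  by move=> [[|[|[|[|[|[|//]]]]]] ?] // _; rewrite -!val_eqE /= !inordK.
- apply: (key (inord 1) (inord 2) (inord 4)); rewrite ?inordK //.
  by move=> [[|[|[|[|[|[|//]]]]]] ?] // _; rewrite -!val_eqE /= !inordK.
- apply: (key (inord 1) (inord 2) (inord 3)); rewrite ?inordK //.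
  by move=> [[|[|[|[|[|[|//]]]]]] ?] // _; rewrite -!val_eqE /= !inordK.
Qed.

Lemma agree_adjacent (A B : {set cface}) (i : 'I_6) : flag A -> flag B -> A <> B ->
  {in A, forall x, tp x != i -> x \in B} -> adjacent A B.
Proof.
move=> fA fB neq AB.
have eqc : #|A :\: B| = #|B :\: A|.
  apply/eqP; rewrite -(eqn_add2l #|A :&: B|) cardsID setIC cardsID.
  by rewrite !cflag_size.
rewrite /adjacent fA fB -eqc andbb /= eqn_leq card_gt0 setD_eq0.
apply/andP; split; last first.
  apply: contra_notN neq => sAB; apply/eqP.
  by rewrite eqEcard sAB !cflag_size.
have ri x : x \in A :\: B -> tp x = i.
  case/setDP=> xA xB; apply/eqP; apply: contraNT xB => ne.
  exact: AB.
apply/card_le1_eqP => x y xD yD.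
have [[xA _] [yA _]] := (setDP xD, setDP yD).
by apply: (chain_tp_inj (flag_cchain fA)) => //; rewrite !ri.
Qed.

(** Changing at most one face, at an index outside the common faces, leads from [A] to some [fl g]
    and from [fl h] to [B]. Then [h * g^-1] stabilises the base faces whose types occur in
    [A :&: B], and [cg_gen] writes it by generators [(a k)^-1 * a l] with [k] and [l] outside these
    types. Each of them costs two adjacencies, through [fl' (a l * y)], that leave the common faces
    alone. *)
Lemma cface_connected : strongly_flag_connected cface.
Proof.
move=> A B fA fB; set e := rel_of_simpl _.
have [->|neq] := eqVneq A B; first exact: connect0.
have [i pi iN] : exists2 i : 'I_6, proper_rank i &
    forall x, x \in A :&: B -> tp x != i.
  have [x xA xB] : exists2 x, x \in A & x \notin B.
    apply/subsetPn; apply: contra neq => sAB.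
    by rewrite eqEcard sAB !cflag_size.
  exists (tp x).
    by apply: contraNT xB => npx; apply: flag_improper.
  move=> y /setIP[yA yB]; apply: contraNneq xB => t.
  by rewrite -(chain_tp_inj (flag_cchain fA) yA xA t).
have agree (C D : {set cface}) (j : 'I_6) : flag C -> flag D ->
    A :&: B \subset C -> A :&: B \subset D ->
    {in C, forall x, tp x != j -> x \in D} -> connect e C D.
  move=> fC fD sC sD cd; have [->|/eqP ne] := eqVneq C D; first exact: connect0.
  by apply: connect1; rewrite /e /= sC sD (agree_adjacent fC fD ne cd).
have near (C : {set cface}) : flag C -> A :&: B \subset C ->
    exists2 g, g \in G & [/\ A :&: B \subset fl g, connect e C (fl g) &
       connect e (fl g) C].
  move=> fC sC; have [g gG gC] := flag_point fC pi; exists g => //.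
  have s : A :&: B \subset fl g.
    apply/subsetP=> x xAB; rewrite mem_fl //.
    by apply: gC; [apply: (subsetP sC)|apply: iN].
  split=> //; first by apply: (agree _ _ i) => //; rewrite ?flag_fl // => x xC xi; rewrite mem_fl // gC.
  apply: (agree _ _ i) => //; rewrite ?flag_fl // => x.
  rewrite mem_fl // => gx xi; have [y yC t] := flag_tp (tp x) fC.
  by rewrite (cface_eq (esym t) gx) // gC // t.
have [g gG [sg Ag _]] := near A fA (subsetIl _ _).
have [h hG [sh _ hB]] := near B fB (subsetIr _ _).
apply: (connect_trans Ag); apply: connect_trans hB.
pose J : pred nat := [pred j | [exists x in A :&: B, (tp x : nat) == j]].
have hgJ : h * g^-1 \in <<[set x | [exists i : 'I_6, exists j : 'I_6,
      [&& proper_rank i, proper_rank j, ~~ J i, ~~ J j &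
          x == (a i)^-1 * a j]]]>>.
  apply: cg_gen; first by rewrite groupM ?groupV.
  move=> j pj /existsP[x /andP[xAB /eqP<-]].
  have gx : g \in cs x by rewrite -mem_fl // (subsetP sg).
  by rewrite -(cs_mulP _ gx) -mem_fl // (subsetP sh).
(* The left multipliers that preserve the common faces and connectedness form a group, so only the
   generators need to be checked. *)
pose S := [set x in G | [forall y in G, (A :&: B \subset fl y) ==>
    (A :&: B \subset fl (x * y)) && connect e (fl y) (fl (x * y))]].
have SP (x y : gT) : x \in S -> y \in G -> A :&: B \subset fl y ->
    [/\ x \in G, A :&: B \subset fl (x * y) & connect e (fl y) (fl (x * y))].
  by case/setIdP=> xG /forall_inP xS yG sy; have /implyP/(_ sy)/andP[] := xS y yG.
have gS : group_set S.
  apply/group_setP; split=> [|x y xS yS].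
    rewrite inE group1; apply/forall_inP=> y yG; apply/implyP=> sy.
    by rewrite mul1g sy connect0.
  have /setIdP[xG _] := xS; have /setIdP[yG _] := yS.
  rewrite inE groupM //; apply/forall_inP=> z zG; apply/implyP=> sz.
  have [_ s1 c1] := SP y z yS zG sz.
  have [_ s2 c2] := SP x (y * z) xS (groupM yG zG) s1.
  by rewrite -mulgA s2 (connect_trans c1 c2).
have {hgJ} : h * g^-1 \in Group gS.
  move: hgJ; apply/subsetP; rewrite gen_subG; apply/subsetP=> x.
  rewrite inE => /existsP[k /existsP[l /and5P[pk pl Jk Jl /eqP->]]].
  have aG := cg_aG X.
  rewrite inE groupM ?groupV //=; apply/forall_inP=> y yG; apply/implyP=> sy.
  have tJ x' : x' \in A :&: B -> forall m : 'I_6, ~~ J m -> tp x' != m.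
    move=> xAB m; apply: contraNneq => t; apply/existsP; exists x'.
    by rewrite xAB t eqxx.
  set y' := (a k)^-1 * a l * y.
  have y'G : y' \in G by rewrite !groupM ?groupV.
  have alG : a l * y \in G by rewrite groupM.
  have sl' : A :&: B \subset fl' (a l * y).
    apply/subsetP=> x' xAB; have := subsetP sy x' xAB => /imsetP[m _ E].
    have ml : m != l by rewrite -[m]/(tp (fc m y)) -E tJ.
    by rewrite E -(fl_adj yG pl ml) fc'_fl'.
  have E : a l * y = a k * y' by rewrite /y' !mulgA mulgV mul1g.
  have s' : A :&: B \subset fl y'.
    apply/subsetP=> x' xAB; have := subsetP sl' x' xAB => /imsetP[m _ E'].
    have mk : m != k by rewrite -[m](tp_fc' _ (a l * y)) -E' tJ.
    by rewrite E' E (fl_adj y'G pk mk) fc_fl.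
  rewrite s' /=; apply: (@connect_trans _ _ (fl' (a l * y))).
    apply: (agree _ _ l); rewrite ?flag_fl ?flag_fl' // => _ /imsetP[m _ ->] ml.
    by rewrite -(fl_adj yG pl ml) fc'_fl'.
  apply: (agree _ _ k); rewrite ?flag_fl ?flag_fl' // => _ /imsetP[m _ ->].
  by rewrite tp_fc' => mk; rewrite E (fl_adj y'G pk mk) fc_fl.
by move=> /SP/(_ gG sg)[_ _]; rewrite mulgKV.
Qed.

Definition crank x : int := ((tp x : nat)%:Z - 1)%R.

(** Relative to a common element [g], the faces between [x] and [y] are the cosets of the middle
    group that meet the intersection of the outer two; [cg_diamond] allows just two. *)
Lemma cface_diamond x y : (x < y)%O -> crank y = (crank x + 2%:Z)%R ->
  #|[set z | (x < z < y)%O]| = 2%N.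
Proof.
move=> xy rxy; have t : tp y = (tp x).+2 :> nat.
  by move: rxy; rewrite /crank; clear; lia.
have /cleP[_ [g gx gy]] := ltW xy; have gG := subsetP (cs_sub x) g gx.
have ltx : (tp x < 4)%N by move: (ltn_ord (tp y)); rewrite t.
have [u [/setIP[u1 u2] un sub]] := cg_diamond X ltx.
have ord : ((tp x).+1 < 6)%N by rewrite ltnS ltnS leqW // ltnS ltnW.
pose i := Ordinal ord; have uG := subsetP (cg_sub X _) u u1.
have between z : (x < z < y)%O = [&& tp z == i, cle x z & cle z y].
  apply/andP/and3P=> [[xz zy]|[/eqP tz xz zy]].
    rewrite -!leE !ltW //; split=> //.
    by have := tp_lt xz; have := tp_lt zy; rewrite t -val_eqE /=; clear; lia.
  rewrite -leE in xz; rewrite -leE in zy; rewrite !lt_neqAle xz zy !andbT.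
  have tz' : (tp z : nat) = (tp x).+1 by rewrite tz.
  split; apply/eqP=> E; first by move: tz'; rewrite -E => /eqP; rewrite ltn_eqF.
  by move: t; rewrite -E tz' => /eqP; rewrite ltn_eqF.
have -> : [set z | (x < z < y)%O] = [set fc i g; fc i (u * g)].
  apply/setP=> z; rewrite !inE between; apply/and3P/orP.
    move=> [/eqP tz xz zy]; have [h [hx hz hy]] := cle_common xz zy.
    have : h * g^-1 \in K (tp x) :&: K (tp x).+2.
      by rewrite inE -(cs_mulP _ gx) hx -t -(cs_mulP _ gy) hy.
    have hG := subsetP (cs_sub x) h hx.
    case/(subsetP sub)/setUP => hK; [left|right]; apply/eqP.
      by rewrite (fcE hz) tz; apply/fc_eqP.
    have ugG : u * g \in G by rewrite groupM.
    rewrite (fcE hz) tz; apply/fc_eqP => //.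
    by rewrite invMg mulgA -mem_rcoset.
  by move=> zE; have [v v1 [vG v2 zv]] : exists2 v, v \in K (tp x) &
      [/\ v \in G, v \in K (tp x).+2 & z = fc i (v * g)];
   [ case: zE => /eqP->; [exists 1; rewrite ?group1 ?mul1g|exists u]
   | rewrite zv eqxx; split=> //; apply/cleP; split; rewrite /= ?t ?leqnSn //;
     exists (v * g); rewrite ?mem_fc ?groupM //;
     [rewrite (cs_mulP _ gx)|rewrite (cs_mulP _ gy) t]; rewrite mulgK].
have ugG : u * g \in G by rewrite groupM.
rewrite cards2; case: eqP => // /esym/(fc_eqP i ugG gG); rewrite mulgK.
by rewrite (negPf un).
Qed.

Lemma cface_polytope : is_polytope 4 crank.
Proof.
split.
- by move=> x; rewrite /crank; have := ltn_ord (tp x); clear; lia.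
- by move=> x y /tp_lt; rewrite /crank; clear; lia.
- by exists (fc ord0 1) => x; apply: le_improper.
- exists (fc ord_max 1) => x; apply: le_improper; rewrite ?orbT //.
  exact: leq_ord.
- exact: cflag_size.
- exact: cface_connected.
- exact: cface_diamond.
Qed.

End Faces.

Definition coset_polytope (X : coset_geometry) : polytope 4 :=
  Polytope (cface_polytope X).

(** * Automorphisms, chirality and duality of coset polytopes *)

Section Automorphisms.
Variable X : coset_geometry.
Local Notation gT := (cg_type X).
Local Notation G := (cg_G X).
Local Notation K := (@cg_K X).
Local Notation a := (@cg_a X).
Local Notation P := (coset_polytope X).
Implicit Types (x y z : P) (g h : gT) (i : 'I_6).

Lemma rank_tp x : rank x = ((tp x : nat)%:Z - 1)%R. Proof. by []. Qed.

Lemma cmul_subproof x g : cface_pred (tp x, cs x :* coset_rep g).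
Proof.
have [h hx] := cs_ex x; rewrite (cs_coset hx); apply/rcosetsP.
by exists (h * coset_rep g); rewrite ?rcosetM // groupM ?coset_repG // (subsetP (cs_sub x)).
Qed.

Definition cmul g x : P :=
  exist (fun w : 'I_6 * {set gT} => is_true (cface_pred w)) _ (cmul_subproof x g).

Lemma cmul_inj g : injective (cmul g).
Proof.
move=> x y /(congr1 val)[t E]; apply: val_inj => /=.
rewrite [val x]surjective_pairing [val y]surjective_pairing.
rewrite -/(tp x) -/(tp y) -/(cs x) -/(cs y) t; congr (_, _).
by apply: (can_inj (rcosetK (coset_rep g))).
Qed.

Definition phi g : {perm P} := perm (@cmul_inj g).

Lemma cs_phi g x : g \in G -> cs (phi g x) = cs x :* g.
Proof. by move=> gG; rewrite permE /cs /= /coset_rep gG. Qed.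

Lemma tp_phi g x : tp (phi g x) = tp x. Proof. by rewrite permE. Qed.

Lemma phi_fc g h i : g \in G -> h \in G -> phi g (fc i h) = fc i (h * g).
Proof.
move=> gG hG; apply: (@cface_eq _ _ _ (h * g)).
- by rewrite tp_phi.
- by rewrite cs_phi // mem_rcoset mulgK mem_fc.
- by rewrite mem_fc // groupM.
Qed.

Lemma phi_Gamma g : g \in G -> phi g \in Gamma P.
Proof.
move=> gG; apply/GammaP=> x y; rewrite !leE /cle !tp_phi !cs_phi //.
congr (_ && _); apply/set0Pn/set0Pn=> -[h]; rewrite !inE.
  by rewrite !mem_rcoset => hh; exists (h * g^-1); rewrite inE.
by exists (h * g); rewrite !inE !mem_rcoset mulgK.
Qed.

Lemma phiM : {in G &, {morph phi : g h / g * h}}.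
Proof.
move=> g h gG hG; apply/permP=> x; rewrite permM.
have [k kx] := cs_ex x; have kG := subsetP (cs_sub x) k kx.
by rewrite (fcE kx) !phi_fc ?groupM // mulgA.
Qed.

Canonical phi_morphism := Morphism phiM.

Lemma phi_fl g h : g \in G -> h \in G -> phi g @: fl h = fl (h * g).
Proof.
move=> gG hG; rewrite /fl -imset_comp; apply: eq_imset => i /=.
exact: phi_fc.
Qed.

Lemma phi_fl' g h : g \in G -> h \in G -> phi g @: fl' h = fl' (h * g).
Proof.
move=> gG hG; rewrite /fl' -imset_comp; apply: eq_imset => i /=.
rewrite /fc'; case: ifP => _; rewrite phi_fc ?mulgA //.
by rewrite groupM ?groupV ?cg_aG.
Qed.

Lemma fl_inj : {in G &, injective (@fl X)}.
Proof.
move=> g h gG hG E.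
apply/eqP; rewrite eq_mulgV1; apply/eqP.
apply: (@all_K_trivial _ _ 1); rewrite ?groupM ?groupV // => j pj _.
have j6 : (j < 6)%N by case/andP: pj => _; apply: ltnW.
apply/(fc_eqP (Ordinal j6) gG hG).
apply: (chain_tp_inj (flag_cchain (flag_fl gG))) => //; first exact: fc_fl.
by rewrite E fc_fl.
Qed.

Lemma injm_phi : 'injm phi.
Proof.
apply/injmP=> g h gG hG E; apply: fl_inj => //.
by rewrite -[g]mul1g -[h]mul1g -!phi_fl // E.
Qed.

Lemma i_adjacent_agree (i : 'I_6) (k : nat) (A B : {set P}) : flag A -> flag B -> A <> B ->
  i = k.+1 :> nat -> {in A, forall x, tp x != i -> x \in B} -> i_adjacent k A B.
Proof.
move=> fA fB ne ik ag; apply/i_adjacentP => //; split=> // x xA rx.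
apply: ag => //; apply: contra_notN rx => /eqP t.
by rewrite rank_tp t ik; clear; lia.
Qed.

Lemma fl_fl'_adj (k : nat) g : (k < 4)%N -> g \in G ->
  i_adjacent k (fl g : {set P}) (fl' (a k.+1 * g)).
Proof.
move=> k4 gG; have k6 : (k.+1 < 6)%N by rewrite ltnS ltnW // ltnS.
have aG : a k.+1 * g \in G by rewrite groupM ?cg_aG.
apply: (@i_adjacent_agree (Ordinal k6)); rewrite ?flag_fl ?flag_fl' //.
  exact: fl_neq.
move=> _ /imsetP[l _ ->] lk.
rewrite -(fl_adj gG (i := Ordinal k6)) ?fc'_fl' //.
Qed.

Lemma flag_cases (A : {set P}) : flag A ->
  exists2 g, g \in G & A = fl g \/ A = fl' g.
Proof.
move=> fA; have [g gG gA] := flag_point fA (i := inord 1) ltac:(by rewrite inordK).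
exists g => //; have [->|/eqP ne] := eqVneq A (fl g); [by left|right].
apply: (@i_adjacent_uniq 4 P 0 (fl g)) => //; last first.
  by have := @fl_fl'_adj 0 g isT gG; rewrite cg_a1 mul1g.
apply: i_adjacent_sym; apply: (@i_adjacent_agree (inord 1)); rewrite ?flag_fl ?inordK //.
by move=> x xA tx; rewrite mem_fl // gA.
Qed.

Lemma fl_not_fl g h k : g \in G -> h \in G ->
  ~~ i_adjacent k (fl g : {set P}) (fl h).
Proof.
move=> gG hG; apply/negP=> ab.
have fg : flag (fl g : {set P}) by apply: flag_fl.
have fh : flag (fl h : {set P}) by apply: flag_fl.
have /(i_adjacentP _ fg fh)[ne ag] := ab.
case: ne; congr fl; apply/eqP; rewrite eq_mulgV1; apply/eqP.
have [ltk|lek] := ltnP k 4.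
  apply: (@all_K_trivial _ _ k.+1); rewrite ?groupM ?groupV // => j pj jk.
  have j6 : (j < 6)%N by case/andP: pj => _; apply: ltnW.
  have : fc (Ordinal j6) g \in fl h.
    apply: ag; first exact: fc_fl.
    by rewrite rank_tp /=; move: jk; clear; lia.
  by rewrite mem_fl // cs_fc // mem_rcoset -groupV invMg invgK.
apply: (@all_K_trivial _ _ 1); rewrite ?groupM ?groupV // => j pj jk.
have j6 : (j < 6)%N by case/andP: pj => _; apply: ltnW.
have : fc (Ordinal j6) g \in fl h.
  apply: ag; first exact: fc_fl.
  by rewrite rank_tp /=; case/andP: pj; move: lek; clear; lia.
by rewrite mem_fl // cs_fc // mem_rcoset -groupV invMg invgK.
Qed.

Lemma fl'_not_fl' g h k : (k < 4)%N -> g \in G -> h \in G ->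
  ~~ i_adjacent k (fl' g : {set P}) (fl' h).
Proof.
move=> k4 gG hG; apply/negP=> ab.
have aG : (a k.+1)^-1 * g \in G by rewrite groupM ?groupV ?cg_aG.
have := fl_fl'_adj k4 aG; rewrite mulgA mulgV mul1g => /i_adjacent_sym ab'.
by have := i_adjacent_uniq k4 ab ab' => /esym; apply: fl_neq.
Qed.

(** In a regular polytope [a i] is the product of the reflections at the indices 1 and [i], and
    conjugation by the former inverts it. The condition expresses the effect of this conjugation on
    rotations, without a reflection being at hand. *)
Definition mirrored : Prop := exists alpha : gT -> gT,
  [/\ {in G &, {morph alpha : g h / g * h}}, {in G, forall g, alpha g \in G} &
      forall k l, (k < 4)%N -> (l < 4)%N ->
        alpha ((a k.+1)^-1 * a l.+1) = a k.+1 * (a l.+1)^-1].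

Lemma gen_a : G \subset
  <<[set x | [exists k : 'I_4, exists l : 'I_4, x == (a k.+1)^-1 * a l.+1]]>>.
Proof.
apply/subsetP=> g gG.
have := @cg_gen X pred0 g gG (fun _ _ F => False_ind _ (notF F)).
apply/subsetP/genS/subsetP=> x; rewrite !inE.
case/existsP=> -[[|k] lk] /existsP[[[|l] ll]] /and5P[pk pl _ _ E] //.
rewrite /proper_rank /= ltnS in pk; rewrite /proper_rank /= ltnS in pl.
by apply/existsP; exists (Ordinal pk); apply/existsP; exists (Ordinal pl).
Qed.

Lemma im_permM (u v : {perm P}) (A : {set P}) : (u * v)%g @: A = v @: (u @: A).
Proof. by rewrite -imset_comp; apply: eq_imset => x; rewrite permM. Qed.

(* Conjugation by an automorphism taking [fl 1] to [fl' 1] sends each rotation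
   to its mirror image, as automorphisms commute with taking adjacent flags. *)
Lemma reflection_mirrored (gam : {perm P}) : gam \in Gamma P ->
  gam @: (fl 1 : {set P}) = fl' 1 -> mirrored.
Proof.
move=> gamG gam1; have aG := cg_aG X.
have conj_gen k l : (k < 4)%N -> (l < 4)%N ->
    phi ((a k.+1)^-1 * a l.+1) ^ gam = phi (a k.+1 * (a l.+1)^-1).
  move=> k4 l4; set u := _ * _; set v := _ * _.
  have uG : u \in G by rewrite groupM ?groupV.
  have vG : v \in G by rewrite groupM ?groupV.
  apply: (mulgI gam); rewrite -conjgC.
  apply: (@Gamma_eq 4 P _ _ (fl 1)); rewrite ?groupM ?phi_Gamma ?flag_fl //.
  rewrite !im_permM phi_fl // gam1 phi_fl' // !mul1g.
  have adj1 := fl_fl'_adj l4 (group1 G); rewrite mulg1 in adj1.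
  have adj2 := i_adjacent_sym (fl_fl'_adj k4 uG).
  rewrite /u mulgA mulgV mul1g -/u in adj2.
  have {}adj1 := Gamma_i_adjacent gamG adj1.
  have {}adj2 := Gamma_i_adjacent gamG adj2.
  rewrite gam1 in adj1.
  have aV : (a l.+1)^-1 \in G by rewrite groupV.
  have adj3 := i_adjacent_sym (fl_fl'_adj l4 aV); rewrite mulgV in adj3.
  have E := i_adjacent_uniq l4 adj1 adj3; rewrite E in adj2.
  exact: i_adjacent_uniq k4 adj2 (fl_fl'_adj k4 aV).
have conj_all g : g \in G -> phi g ^ gam \in phi @* G.
  move=> gG; rewrite -mem_conjgV.
  have phiG : phi g \in phi @* G by apply: mem_morphim.
  suff sub : phi @* G \subset (phi @* G) :^ gam^-1 by apply: (subsetP sub).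
  apply: subset_trans (morphimS _ gen_a) _; rewrite morphim_gen; last first.
    apply/subsetP=> x; rewrite inE => /existsP[k /existsP[l /eqP->]].
    by rewrite groupM ?groupV.
  rewrite gen_subG; apply/subsetP=> _ /morphimP[x xG + ->].
  rewrite inE => /existsP[k /existsP[l /eqP xE]]; rewrite mem_conjgV xE.
  by rewrite conj_gen ?ltn_ord // mem_morphim // groupM ?groupV.
exists (fun g => invm injm_phi (phi g ^ gam)); split.
- move=> g h gG hG; rewrite phiM // conjMg.
  by rewrite morphM //= conj_all.
- move=> g gG; have := conj_all g gG => /morphimP[h _ hG ->].
  by rewrite invmE.
- move=> k l k4 l4; rewrite conj_gen // invmE //.
  by rewrite groupM ?groupV.
Qed.

(** An automorphism taking [fl 1] to some [fl' g], followed by [phi g^-1], would be a reflection. *)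
Lemma Gamma_fl gam : ~ mirrored -> gam \in Gamma P ->
  exists2 g, g \in G & gam @: (fl 1 : {set P}) = fl g.
Proof.
move=> nm gamG.
have fA : flag (gam @: (fl 1 : {set P})) by apply: Gamma_flag => //; apply: flag_fl.
have [g gG [E|E]] := flag_cases fA; first by exists g.
case: nm; apply: (@reflection_mirrored (gam * phi g^-1)).
  by rewrite groupM // phi_Gamma ?groupV.
by rewrite im_permM E phi_fl' ?groupV // mulgV.
Qed.

Lemma Gamma_phi : ~ mirrored -> Gamma P = phi @* G.
Proof.
move=> nm; apply/eqP; rewrite eqEsubset; apply/andP; split; last first.
  by apply/subsetP=> _ /morphimP[g _ gG ->]; apply: phi_Gamma.
apply/subsetP=> gam gamG; have [g gG E] := Gamma_fl nm gamG.
suff -> : gam = phi g by apply: mem_morphim.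
apply: (@Gamma_eq 4 P _ _ (fl 1)); rewrite ?phi_Gamma ?flag_fl //.
by rewrite E phi_fl // mul1g.
Qed.

Lemma Gamma_isog : ~ mirrored -> Gamma P \isog G.
Proof. by move/Gamma_phi->; rewrite isog_sym sub_isog // injm_phi. Qed.

Lemma orbit_fl : ~ mirrored -> orbit 'P^* (Gamma P) (fl 1 : {set P}) = @fl X @: G.
Proof.
move=> nm; rewrite Gamma_phi //; apply/setP=> A; apply/orbitP/imsetP.
  case=> _ /morphimP[g _ gG ->] <-; exists g => //.
  by rewrite /= setactE (eq_imset _ (g := phi g)) // phi_fl // mul1g.
case=> g gG ->; exists (phi g); first exact: mem_morphim.
by rewrite /= setactE (eq_imset _ (g := phi g)) // phi_fl // mul1g.
Qed.

Lemma orbit_fl' : ~ mirrored -> orbit 'P^* (Gamma P) (fl' 1 : {set P}) = @fl' X @: G.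
Proof.
move=> nm; rewrite Gamma_phi //; apply/setP=> A; apply/orbitP/imsetP.
  case=> _ /morphimP[g _ gG ->] <-; exists g => //.
  by rewrite /= setactE (eq_imset _ (g := phi g)) // phi_fl' // mul1g.
case=> g gG ->; exists (phi g); first exact: mem_morphim.
by rewrite /= setactE (eq_imset _ (g := phi g)) // phi_fl' // mul1g.
Qed.

Lemma flag_orbitsE : ~ mirrored ->
  flag_orbits P = [set @fl X @: G; @fl' X @: G].
Proof.
move=> nm; apply/setP=> O; rewrite !inE; apply/imsetP/orP.
  case=> A; rewrite inE => /flag_cases[g gG [] -> ->]; [left|right].
    rewrite -orbit_fl //; apply/eqP/orbit_eqP; rewrite orbit_fl //.
    exact: imset_f.
  rewrite -orbit_fl' //; apply/eqP/orbit_eqP; rewrite orbit_fl' //.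
  exact: imset_f.
case=> /eqP->.
  by exists (fl 1); rewrite ?orbit_fl // inE flag_fl.
by exists (fl' 1); rewrite ?orbit_fl' // inE flag_fl'.
Qed.

Lemma coset_chiral : ~ mirrored -> chiral P.
Proof.
move=> nm; split=> [|A B ab].
  rewrite flag_orbitsE // cards2; case: eqP => // E.
  have : fl 1 \in @fl' X @: G by rewrite -E imset_f.
  by case/imsetP=> g gG /fl_neq-/(_ (group1 G)).
have [k kab k4] := adjacent_rankP ab; have [fA fB] := i_adjacent_flag kab.
apply/negP=> BA; have OA : orbit 'P^* (Gamma P) A \in flag_orbits P.
  by apply: imset_f; rewrite inE.
have AO := orbit_refl 'P^* (Gamma P) A.
move: OA; rewrite flag_orbitsE // !inE => /orP[] /eqP E; rewrite E in BA AO.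
  have [g gG Ag] := imsetP AO; have [h hG Bh] := imsetP BA.
  by move: kab; rewrite Ag Bh; apply/negP/fl_not_fl.
have [g gG Ag] := imsetP AO; have [h hG Bh] := imsetP BA.
by move: kab; rewrite Ag Bh; apply/negP/fl'_not_fl'.
Qed.

Section Duality.
Variable d : gT.
Hypothesis Gd : G :^ d = G.
Hypothesis Kd : forall i, (i <= 5)%N -> K i :^ d = K (5 - i).

Lemma Gd_mem g : (g ^ d \in G) = (g \in G).
Proof. by rewrite -{1}Gd memJ_conjg. Qed.

Lemma cdual_subproof x : cface_pred (rev_ord (tp x), cs x :^ d).
Proof.
have [h hx] := cs_ex x; rewrite (cs_coset hx); apply/rcosetsP.
exists (h ^ d); first by rewrite Gd_mem (subsetP (cs_sub x)).
by rewrite /= conjsMg conjg_set1 Kd ?subSS // -ltnS ltn_ord.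
Qed.

Definition cdual x : P :=
  exist (fun w : 'I_6 * {set gT} => is_true (cface_pred w)) _ (cdual_subproof x).

Lemma cdual_inj : injective cdual.
Proof.
move=> x y /(congr1 val)[t E]; apply: val_inj => /=.
rewrite [val x]surjective_pairing [val y]surjective_pairing.
rewrite -/(tp x) -/(tp y) -/(cs x) -/(cs y); congr (_, _).
  by apply: (can_inj (@rev_ordK 6)); apply: val_inj.
exact: (can_inj (conjsgK d)) E.
Qed.

Definition psi : {perm P} := perm cdual_inj.

Lemma psi_duality : duality psi.
Proof.
move=> x y; rewrite !permE !leE /cle /= /tp /cs /= -/(tp x) -/(tp y) -/(cs x) -/(cs y).
rewrite !subSS -conjIg setIC -!card_gt0 cardJg; congr (_ && _).
by have := ltn_ord (tp x); have := ltn_ord (tp y); clear; lia.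
Qed.

Lemma psi_fl g : g \in G -> psi @: fl g = fl (g ^ d).
Proof.
move=> gG; have fg : flag (psi @: (fl g : {set P})).
  by apply: (duality_flag psi_duality); apply: flag_fl.
have gdG : g ^ d \in G by rewrite Gd_mem.
apply: flag_sub_eq => //; first exact: flag_fl.
apply/subsetP=> _ /imsetP[x xg ->]; rewrite mem_fl //.
by rewrite permE /cs /= memJ_conjg -/(cs x) -mem_fl.
Qed.

(** The duality takes [fl g] to [fl (g ^ d)] and so preserves this orbit; being injective on flags,
    it preserves the other orbit too. *)
Lemma coset_properly_self_dual : ~ mirrored -> properly_self_dual P.
Proof.
move=> nm; exists psi; first exact: psi_duality.
have psi_inj : injective (fun A : {set P} => psi @: A).
  by move=> A B /(imset_inj perm_inj).
have Efl : [set psi @: A | A : {set P} in @fl X @: G] = @fl X @: G.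
  apply/eqP; rewrite eqEcard (card_imset _ psi_inj) leqnn andbT.
  apply/subsetP=> _ /imsetP[_ /imsetP[g gG ->] ->].
  by rewrite psi_fl // imset_f // Gd_mem.
move=> O; rewrite flag_orbitsE // !inE => /orP[] /eqP-> //.
apply/eqP; rewrite eqEcard (card_imset _ psi_inj) leqnn andbT.
apply/subsetP=> _ /imsetP[_ /imsetP[g gG ->] ->].
have fA : flag (psi @: (fl' g : {set P})).
  by apply: (duality_flag psi_duality); apply: flag_fl'.
have [h hG [E|E]] := flag_cases fA; last by rewrite E imset_f.
have : fl h \in @fl X @: G by rewrite imset_f.
rewrite -Efl => /imsetP[_ /imsetP[k kG ->]]; rewrite -E => /psi_inj/esym.
by move/(fl_neq kG gG).
Qed.

End Duality.
End Automorphisms.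

(** * Facets of coset polytopes as toroidal maps *)

Section Facets.
Variable X : coset_geometry.
Local Notation gT := (cg_type X).
Local Notation G := (cg_G X).
Local Notation K := (@cg_K X).
Local Notation P := (coset_polytope X).
Variables (q x : gT) (u : point).
Hypothesis qx : hex_action q x.
Local Notation el := (elt q x).
Local Notation s1 := (rot3 q x).
Local Notation s2 := (q^-1).
Hypothesis K4 : K 4 = <<[set s2; s1]>> :> {set gT}.
Hypothesis K14 : K 1 :&: K 4 = <[s2]>.
Hypothesis K24 : K 2 :&: K 4 = <[s1 * s2]>.
Hypothesis K34 : K 3 :&: K 4 = <[s1]>.
Hypothesis lattice_of_elt : forall v k, el v k = 1 -> (6 %| k)%N /\ in_lattice u v.
Hypothesis tr_lattice : forall v, in_lattice u v -> tr q x v = 1.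

(** The generator of the stabiliser, within the facet group, of the vertex, edge or triangle of the
    base flag: a rotation about the centre of that face. *)
Definition stab_gen (i : nat) : gT :=
  match i with 1 => s2 | 2 => s1 * s2 | _ => s1 end.

Lemma stab_genE i : (0 < i < 4)%N -> K i :&: K 4 = <[stab_gen i]>.
Proof. by case: i => [|[|[|[|]]]]. Qed.

Lemma eltK v k : el v k \in K 4.
Proof. by rewrite K4 elt_mem. Qed.

Lemma eltG v k : el v k \in G.
Proof. exact: subsetP (cg_sub X 4) _ (eltK v k). Qed.

Lemma elt_s12 v k : s1 * s2 * el v k = el (v + unit_vec k)%R (k + 3).
Proof.
rewrite -mulgA elt_qV // elt_rot3 // -addnS unit_vecD6 -elt_mod6 //.
by rewrite -(elt_mod6 qx _ (k + 3)) -(modnDr (k + 3)) -!addnA.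
Qed.

(** Left multiplication by the stabiliser changes the flag [(v, k)] but not its face of index [i];
    so faces correspond to right cosets. *)
Lemma stab_gen_elt i v k : (0 < i < 4)%N -> exists v' k',
  stab_gen i * el v k = el v' k' /\ tface i v' k' = tface i v k.
Proof.
case: i => [|[|[|[|]]]] //= _.
- by exists v, (k + 5)%N; rewrite elt_qV.
- by exists (v + unit_vec k)%R, (k + 3)%N; rewrite elt_s12 tedgeD3.
- by exists (v + unit_vec k.+1)%R, (k + 4)%N; rewrite elt_rot3 // ttriD4.
Qed.

Lemma stab_genX_elt i n v k : (0 < i < 4)%N -> exists v' k',
  stab_gen i ^+ n * el v k = el v' k' /\ tface i v' k' = tface i v k.
Proof.
move=> i4; elim: n => [|n [v1 [k1 [E1 t1]]]]; first by exists v, k; rewrite mul1g.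
have [v2 [k2 [E2 t2]]] := stab_gen_elt v1 k1 i4; exists v2, k2.
by rewrite expgS -mulgA E1 E2 t2.
Qed.

Lemma elt_inj v k v' k' : el v k = el v' k' ->
  in_lattice u (v - v')%R /\ k %% 6 = k' %% 6.
Proof.
move=> E; have [] := @lattice_of_elt (v - v')%R (5 * k' + k).
  have [_ _ q6] := qx.
  have -> : el (v - v')%R (5 * k' + k) = q ^+ (5 * k') * (el v k * (tr q x v')^-1).
    by rewrite /elt trD // trN // expgD !mulgA.
  by rewrite E /elt mulgK -expgD -mulSnr expgM q6 expg1n.
by move=> d6 L; split=> //; move: d6; clear; lia.
Qed.

Definition facet_map (g : gT) (f : tess_face) : P :=
  match f with
  | TEmpty => fc ord0 g
  | TVertex v => fc (inord 1) (tr q x v * g)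
  | TEdge v k => fc (inord 2) (el v k * g)
  | TTriangle v k => fc (inord 3) (el v k * g)
  | TPlane => fc (inord 4) g
  end.

Section FacetMap.
Variable g : gT.
Hypothesis gG : g \in G.
Local Notation h := (facet_map g).

Lemma el_gG v k : el v k * g \in G.
Proof. exact: groupM (eltG v k) gG. Qed.

Lemma stab_gen_mem i : (0 < i < 4)%N -> stab_gen i \in K i.
Proof. by move=> i4; have := cycle_id (stab_gen i); rewrite -stab_genE // => /setIP[]. Qed.

Lemma fc_stab_gen i v k : (0 < i < 4)%N ->
  fc (inord i) (stab_gen i * el v k * g) = fc (inord i) (el v k * g).
Proof.
move=> i4; rewrite -mulgA; apply: fc_mulK; first exact: el_gG.
by rewrite inordK ?stab_gen_mem //; move: i4; clear; lia.
Qed.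

(** [tedge] and [ttri] may name a face from another corner. In the group this is left multiplication
    by a power of [stab_gen i], which the coset of [K i] absorbs. *)
Lemma facet_map_tface i v k : (i <= 4)%N ->
  h (tface i v k) = fc (inord i) (el v k * g).
Proof.
case: i => [|[|[|[|[|//]]]]] _ /=.
- apply: (@cface_eq _ _ _ g); rewrite ?mem_fc //.
    by apply: val_inj; rewrite /= inordK.
  by rewrite cs_improper //= inordK.
- rewrite /elt -(mulgA (q ^+ k)); apply/esym/fc_mulK.
    by have := el_gG v 0; rewrite /elt expg0 mul1g.
  by rewrite inordK //; apply: groupX; rewrite -groupV; apply: (@stab_gen_mem 1).
- rewrite /tedge; have := ltn_pmod k (isT : 0 < 6)%N; case: ifP => k3 k6 /=.
    by rewrite inordK // elt_mod6.
  rewrite inordK; last by move: k6 k3; clear; lia.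
  rewrite -(fc_stab_gen (i := 2) v k) // elt_s12 -(elt_mod6 qx _ (k + 3)).
  by do 3!congr (_ _); congr (el _ _ * _); move: k6 k3; clear; lia.
- rewrite -ttri_mod6 -elt_mod6 //; have := ltn_pmod k (isT : 0 < 6)%N.
  have step v' k' : fc (inord 3) (el v' k' * g) =
      fc (inord 3) (el (v' + unit_vec k'.+1)%R (k' + 4) * g).
    by rewrite -elt_rot3 // -(fc_stab_gen (i := 3)).
  case: (k %% 6) => [|[|[|[|[|[|//]]]]]] _; rewrite /ttri /= ?inordK //.
  + by rewrite [RHS]step -[in RHS](elt_mod6 qx).
  + by rewrite [RHS]step -[in RHS](elt_mod6 qx).
  + rewrite [RHS]step [RHS]step -[in RHS](elt_mod6 qx) -[in RHS]addrA.
    by congr (fc _ (elt _ _ (_ + _)%R _ * _)).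
  + rewrite [RHS]step [RHS]step -[in RHS](elt_mod6 qx) -[in RHS]addrA.
    by congr (fc _ (elt _ _ (_ + _)%R _ * _)).
- apply/esym; rewrite fc_mulK // inordK //; exact: eltK.
Qed.

Lemma facet_map_le f : (h f <= fc (inord 4) g)%O.
Proof.
have [i [v [k [i4 ->]]]] := tfaceP f.
have -> : fc (inord 4) g = h (tface 4 v k) by [].
rewrite !facet_map_tface // fc_le //; first exact: el_gG.
by rewrite !inordK // ltnS (leq_trans i4).
Qed.

Lemma facet_map_translate t f : in_lattice u t -> h (translate t f) = h f.
Proof.
move=> ut; have [i [v [k [i4 ->]]]] := tfaceP f.
rewrite -tface_translate !facet_map_tface //.
congr (fc _ (_ * _)); rewrite /elt trD // (tr_lattice ut).
by rewrite mulg1.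
Qed.

Lemma inord_inj6 i j : (i <= 4)%N -> (j <= 4)%N -> inord i = inord j :> 'I_6 -> i = j.
Proof.
by move=> i4 j4 /(congr1 val); rewrite /= !inordK // ltnS ltnW // ltnS.
Qed.

(** If the cosets agree, the two elements of the facet group differ by a power of [stab_gen i],
    which keeps the face. What remains is an equality of normal forms, that is, a congruence modulo
    the lattice. *)
Lemma facet_map_fiber f f' : h f = h f' <-> translation_orbit u f f'.
Proof.
split=> [|[t ut ->]]; last by rewrite facet_map_translate.
have [i [v [k [i4 ->]]]] := tfaceP f; have [j [v' [k' [j4 ->]]]] := tfaceP f'.
rewrite !facet_map_tface // => E.
have ij : i = j by apply: inord_inj6 => //; apply: (congr1 (@tp X) E).
rewrite -{}ij {j j4} in E *.
have [i03|] := boolP (0 < i < 4)%N; last first.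
  by case: i i4 {E} => [|[|[|[|[|]]]]] // _ _; apply: torbit_refl.
have i6 : (i < 6)%N by move: i4; clear; lia.
move/(fc_eqP _ (el_gG _ _) (el_gG _ _)): E.
rewrite inordK // invMg mulgA mulgK => eK.
have : el v k * (el v' k')^-1 \in <[stab_gen i]>.
  rewrite -stab_genE // inE eK /=.
  exact: groupM (eltK _ _) (groupVr (eltK _ _)).
case/cycleP=> n E; have [v2 [k2 [E2 t2]]] := stab_genX_elt n v' k' i03.
have : el v k = el v2 k2 by rewrite -E2 -E mulgKV.
case/elt_inj=> L km; rewrite -t2 -(tface_mod6 i v) km tface_mod6.
exists (v2 - v)%R; first by rewrite -opprB; apply: in_latticeN.
by rewrite -tface_translate addrC subrK.
Qed.

Lemma facet_cover : torus_cover u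
  (fun y z : {y : P | (y <= fc (inord 4) g)%O} => (sval y <= sval z)%O)
  (fun f => exist _ (h f) (facet_map_le f)).
Proof.
have inF w : w \in cs (fc (inord 4) g : P) -> exists v k, w = el v k * g.
  rewrite cs_fc // mem_rcoset inordK // K4 => /(eltP qx)[v [k E]].
  by exists v, k; rewrite -E mulgKV.
have tp4 (y : P) : (y <= fc (inord 4) g)%O -> (tp y <= 4)%N.
  by move/tp_le; rewrite /= inordK.
split.
- case=> y yF; have /cleP[_ [w wy wF]] := yF; have [v [k wE]] := inF w wF.
  exists (tface (tp y) v k); apply: eq_exist.
  rewrite facet_map_tface ?tp4 // inord_val -wE.
  exact/esym/fcE.
- move=> f f'; rewrite -facet_map_fiber; split=> [/(congr1 sval)//|E].
  exact: eq_exist.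
- move=> f f' /=; split=> [ff'|[f2 [t ut ->]] le].
    have [i [v [k [i4 fE]]]] := tfaceP f; have [j [v' [k' [j4 fE']]]] := tfaceP f'.
    (* An element common to both faces and to the facet is a flag [(v2, k2)] of the tessellation
       that contains representatives of both faces. *)
    have [w [wf wf' wF]] := cle_common ff' (facet_map_le f').
    have [v2 [k2 wE]] := inF w wF.
    have tf : tp (h f) = inord i by rewrite fE facet_map_tface.
    have tf' : tp (h f') = inord j by rewrite fE' facet_map_tface.
    have ij : (i <= j)%N.
      have := tp_le ff'; rewrite tf tf' !inordK //; first by move: j4; clear; lia.
      by move: i4; clear; lia.
    have /facet_map_fiber[t ut E] : h (tface i v2 k2) = h f.
      by rewrite facet_map_tface // -wE -tf; apply/esym/fcE.
    have /facet_map_fiber fo : h f' = h (tface j v2 k2).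
      by rewrite facet_map_tface // -wE -tf'; apply/fcE.
    exists (tface j (v2 + t)%R k2).
      by apply: torbit_trans fo _; exists t => //; rewrite tface_translate.
    by rewrite E -tface_translate; apply: tface_le; rewrite ij.
  rewrite -(facet_map_translate f' ut).
  have [i [j [v [k [/andP[ij j4] -> ->]]]]] := tri_leP le.
  rewrite !facet_map_tface //; last exact: leq_trans ij j4.
  apply: fc_le; first exact: el_gG.
  by rewrite !inordK //; move: ij j4; clear; lia.
Qed.

End FacetMap.

Lemma coset_facets (F : P) : rank F = (4%:Z - 1)%R ->
  order_iso (fun y z : {y : P | (y <= F)%O} => (sval y <= sval z)%O) (@map36 u).
Proof.
rewrite rank_tp => rF; have tF : tp F = inord 4.
  by apply: val_inj; rewrite /= inordK //; move: rF; clear; lia.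
have [g gF] := cs_ex F; have gG := subsetP (cs_sub F) g gF.
by rewrite (fcE gF) tF; apply: iso_of_cover (facet_cover gG).
Qed.

End Facets.

(** * Coset geometries from rotations *)

Lemma mem_cycle2 (gT : finGroupType) (g h : gT) : g ^+ 2 = 1 ->
  h \in <[g]> -> h = 1 \/ h = g.
Proof.
move=> g2 /cycleP[n ->]; rewrite -(expg_mod n g2); have := ltn_pmod n (isT : 0 < 2)%N.
by case: (n %% 2)%N => [|[|]] // _; [left|right].
Qed.

Lemma mem_cycle3 (gT : finGroupType) (g h : gT) : g ^+ 3 = 1 ->
  h \in <[g]> -> h = 1 \/ g \in <[h]>.
Proof.
move=> g3 /cycleP[n ->]; rewrite -(expg_mod n g3); have := ltn_pmod n (isT : 0 < 3)%N.
case: (n %% 3)%N => [|[|[|]]] // _; first by left.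
  by right; rewrite expg1 cycle_id.
right; apply/cycleP; exists 2; rewrite -expgM.
by rewrite (expgD g 3 1) g3 mul1g.
Qed.

Lemma sqr_swap (gT : finGroupType) (g h : gT) : (g * h) ^+ 2 = 1 -> (h * g) ^+ 2 = 1.
Proof.
move=> E; have -> : h * g = (g * h) ^ g by rewrite conjgE !mulgA mulVg mul1g.
by rewrite -conjXg E conj1g.
Qed.

Lemma sqr_invg (gT : finGroupType) (g : gT) : g ^+ 2 = 1 -> g^-1 = g.
Proof. by move=> E; apply: (mulgI g); rewrite mulgV -expg2. Qed.

(* [h] inverts [g]. *)
Lemma dihedral_prod (gT : finGroupType) (g h : gT) :
  h ^+ 2 = 1 -> (g * h) ^+ 2 = 1 -> <<[set g; h]>> = <[g]> * <[h]>.
Proof.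
move=> h2 gh2; rewrite -[<<_>>]/([set g] <*> [set h]) -joing_idl -joing_idr.
rewrite norm_joinEr //.
rewrite cycle_subG; apply/normP/eqP; rewrite -cycleJ.
have -> : g ^ h = g^-1.
  have hV : h^-1 = h by apply: (mulgI h); rewrite mulgV -expg2.
  rewrite conjgE hV; apply: (mulgI g); rewrite mulgV !mulgA.
  by rewrite -gh2 expg2 !mulgA.
by rewrite cycleV.
Qed.

Section FromRotations.
Variables (gT : finGroupType) (s1 s2 s3 d : gT) (L : point -> Prop).
Hypothesis rd : rotation_data s1 s2 s3 d L.
Local Notation q := (s2^-1).
Local Notation x := (s2 ^+ 3 * s1 * s2).
Hypothesis elt6 : forall v k, elt q x v k = 1 -> (6 %| k)%N.
Hypothesis Lunit : ~ L (1, 0)%R.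

Let hex : hex_action q x := rd_hex rd.

Lemma rot3_s1 : rot3 q x = s1.
Proof. by rewrite /rot3 -(mulgA (q ^+ 3)) mulgK expVgn mulKg. Qed.

Lemma eltL v k v' k' : elt q x v k = elt q x v' k' ->
  L (v - v')%R /\ (k %% 6 = k' %% 6)%N.
Proof.
move=> E; have q6 : q ^+ 6 = 1 by case: hex.
have E1 : elt q x (v - v')%R (5 * k' + k) = 1.
  have -> : elt q x (v - v')%R (5 * k' + k) = q ^+ (5 * k') * (elt q x v k * (tr q x v')^-1).
    by rewrite /elt trD // trN // expgD !mulgA.
  by rewrite E /elt mulgK -expgD -mulSnr expgM q6 expg1n.
have d6 := elt6 E1; split; last by move: d6; clear; lia.
apply/(rd_tr rd); have := E1; rewrite /elt -(q_order hex).
by rewrite (eqP d6) expg0 mul1g.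
Qed.

Let S1 := rd_s1 rd.
Let S12 := rd_s12 rd.
Let S123 := rd_s123 rd.
Local Notation A := (s1 * s2).
Local Notation B := (s2 * s3).
Local Notation C := (s1 * s2 * s3).

Lemma s3_cube : s3 ^+ 3 = 1.
Proof.
by apply: invg_inj; rewrite -expVgn -(rd_d1 rd) -conjXg S1 conj1g invg1.
Qed.

Lemma B_sqr : B ^+ 2 = 1.
Proof.
apply: invg_inj; rewrite -expVgn invMg -(rd_d1 rd) -(rd_d2 rd) -conjMg -conjXg.
by rewrite S12 conj1g invg1.
Qed.

Definition rotK (i : nat) : {group gT} :=
  match i with
  | 1 => <<[set s2; s3]>>%G
  | 2 => <<[set A; s3]>>%G
  | 3 => <<[set s1; B]>>%G
  | 4 => <<[set s1; s2]>>%G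
  | _ => <<[set s1; s2; s3]>>%G
  end.

(** In a regular polytope, where [s1], [s2] and [s3] are the products of consecutive reflections,
    this is [rho 0 * rho (i - 1)] for [i] from 1 to 4. *)
Definition rota (i : nat) : gT :=
  match i with 2 => s1 | 3 => A | 4 => C | _ => 1 end.

Lemma gen2 (g h : gT) : g \in <<[set g; h]>> /\ h \in <<[set g; h]>>.
Proof. by split; apply: mem_gen; rewrite !inE eqxx ?orbT. Qed.

Lemma s_mem : [/\ s1 \in rotK 0, s2 \in rotK 0 & s3 \in rotK 0].
Proof. by split; apply: mem_gen; rewrite !inE eqxx ?orbT. Qed.

Lemma s2K1 : s2 \in rotK 1. Proof. by have [] := gen2 s2 s3. Qed.
Lemma s3K1 : s3 \in rotK 1. Proof. by have [] := gen2 s2 s3. Qed.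
Lemma AK2 : A \in rotK 2. Proof. by have [] := gen2 A s3. Qed.
Lemma s3K2 : s3 \in rotK 2. Proof. by have [] := gen2 A s3. Qed.
Lemma s1K3 : s1 \in rotK 3. Proof. by have [] := gen2 s1 B. Qed.
Lemma BK3 : B \in rotK 3. Proof. by have [] := gen2 s1 B. Qed.
Lemma s1K4 : s1 \in rotK 4. Proof. by have [] := gen2 s1 s2. Qed.
Lemma s2K4 : s2 \in rotK 4. Proof. by have [] := gen2 s1 s2. Qed.
Lemma BK1 : B \in rotK 1. Proof. exact: groupM s2K1 s3K1. Qed.
Lemma AK4 : A \in rotK 4. Proof. exact: groupM s1K4 s2K4. Qed.
Lemma CK2 : C \in rotK 2. Proof. exact: groupM AK2 s3K2. Qed.
Lemma CK3 : C \in rotK 3. Proof. by rewrite -mulgA; apply: groupM s1K3 BK3. Qed.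

Lemma rotK_sub i : rotK i \subset rotK 0.
Proof.
have [m1 m2 m3] := s_mem.
by case: i => [|[|[|[|[|i]]]]] //; rewrite gen_subG; apply/subsetP=> g /set2P[]->;
  rewrite // groupM.
Qed.

Lemma K4E : rotK 4 = <<[set q^-1; rot3 q x]>> :> {set gT}.
Proof. by rewrite invgK rot3_s1 setUC. Qed.

Lemma K2E : rotK 2 = <[s3]> * <[A]> :> {set gT}.
Proof. by rewrite -dihedral_prod ?S12 ?(sqr_swap S123) // setUC. Qed.

(** [C = A * s3] is another involution of the dihedral group of [s3] and [A]. [rotK_factor] uses
    both factorisations, as [C] lies in [rotK 3] and [A] in [rotK 4]. *)
Lemma K2E' : rotK 2 = <[s3]> * <[C]> :> {set gT}.
Proof.
rewrite -dihedral_prod ?S123 //.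
  apply/eqP; rewrite eqEsubset !gen_subG; apply/andP; split; apply/subsetP=> g /set2P[]->.
  - by have [m1 m2] := gen2 s3 C; have := groupM m2 (groupVr m1); rewrite mulgK.
  - by have [] := gen2 s3 C.
  - exact: s3K2.
  - exact: CK2.
have -> : s3 * C = A^-1.
  apply: (mulIg A); rewrite mulVg -(sqr_swap S123) expg2 !mulgA.
  by [].
by rewrite expVgn S12 invg1.
Qed.

Lemma K3E : rotK 3 = <[s1]> * <[B]> :> {set gT}.
Proof. by rewrite -dihedral_prod ?B_sqr // mulgA S123. Qed.

Lemma K3E' : rotK 3 = <[s1]> * <[C]> :> {set gT}.
Proof.
rewrite -dihedral_prod ?S123 //.
  apply/eqP; rewrite eqEsubset !gen_subG; apply/andP; split; apply/subsetP=> g /set2P[]->.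
  - by have [] := gen2 s1 C.
  - by have [m1 m2] := gen2 s1 C; have := groupM (groupVr m1) m2; rewrite -(mulgA s1) mulKg.
  - exact: s1K3.
  - exact: CK3.
have -> : s1 * C = B ^ s1^-1.
  by rewrite -(sqr_invg S123) conjgE invgK -(mulgA s1 s2) invMg (sqr_invg B_sqr).
by rewrite -conjXg B_sqr conj1g.
Qed.

(** The one intersection that rests on [rd_vertex]: an element of the facet group is a power of [s2]
    times a translation, and the translation must lie in the vertex group. The other intersections
    of proper stabilisers are deduced from this one. *)
Lemma K14 : rotK 1 :&: rotK 4 = <[s2]>.
Proof.
apply/eqP; rewrite eqEsubset cycle_subG inE s2K1 s2K4 !andbT.
apply/subsetP=> g /setIP[g1]; rewrite K4E => /(eltP hex)[v [k E]].
have qK : q ^+ k \in rotK 1 by rewrite groupX // groupV s2K1.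
have : tr q x v \in rotK 1 by rewrite -(groupMl _ qK) -[_ * _]/(elt q x v k) -E.
move/(rd_vertex rd)/(rd_tr rd) => E1.
by rewrite E /elt E1 mulg1 expVgn groupV mem_cycle.
Qed.

(** Otherwise [s1], whose normal form has translation part [unit_vec 1], would be a rotation about
    the origin, and the unit vectors would lie in [L]. *)
Lemma s1_s2 : s1 \notin <[s2]>.
Proof.
apply/negP=> /cycleP[n E]; apply: Lunit.
have q6 : q ^+ 6 = 1 by case: hex.
have : elt q x (unit_vec 1) 4 = elt q x 0%R (5 * n).
  rewrite -(rot3E hex) rot3_s1 E /elt tr0 mulg1 expgM.
  congr (_ ^+ n); apply: (mulgI q); by rewrite mulVg -expgS.
case/eltL; rewrite subr0 => /(rd_tr rd) T _.
apply/(rd_tr rd); apply: (conjg_inj q); rewrite trJ // conj1g.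
exact: T.
Qed.

Lemma s3_s2 : s3 \notin <[s2]>.
Proof.
apply: contra s1_s2 => h; have : s3 ^ d \in <[s2]> :^ d by rewrite memJ_conjg.
by rewrite -cycleJ (rd_d2 rd) (rd_d3 rd) cycleV groupV.
Qed.

Lemma s2_cube : s2 ^+ 3 <> 1.
Proof.
move=> E; have : elt q x 0%R 3 = 1 by rewrite /elt tr0 mulg1 expVgn E invg1.
by move/elt6.
Qed.

Lemma s2_s3 : s2 \notin <[s3]>.
Proof. by apply/negP=> /cycleP[n E]; apply: s2_cube; rewrite E -expgM mulnC expgM s3_cube expg1n. Qed.

Lemma s2_s1 : s2 \notin <[s1]>.
Proof. by apply/negP=> /cycleP[n E]; apply: s2_cube; rewrite E -expgM mulnC expgM S1 expg1n. Qed.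

Lemma s1_triv g : g \in <[s1]> -> g \in <[s2]> -> g = 1.
Proof.
move=> g1 g2; have [//|] := mem_cycle3 S1 g1.
by move/(subsetP _)=> h; case/negP: s1_s2; apply: h; rewrite cycle_subG.
Qed.

Lemma s3_triv g : g \in <[s3]> -> g \in <[s2]> -> g = 1.
Proof.
move=> g1 g2; have [//|] := mem_cycle3 s3_cube g1.
by move/(subsetP _)=> h; case/negP: s3_s2; apply: h; rewrite cycle_subG.
Qed.

Lemma A_K1 : A \notin rotK 1.
Proof.
apply: contra s1_s2 => h; have : A \in <[s2]> by rewrite -K14 inE h AK4.
by rewrite groupMr ?cycle_id.
Qed.

Lemma B_K4 : B \notin rotK 4.
Proof.
apply: contra s3_s2 => h; rewrite -K14 inE s3K1 /=.
by move: h; rewrite groupMl ?s2K4.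
Qed.

Lemma K24 : rotK 2 :&: rotK 4 = <[A]>.
Proof.
apply/eqP; rewrite eqEsubset cycle_subG inE AK2 AK4 !andbT.
apply/subsetP=> g /setIP[]; rewrite K2E => /mulsgP[u v us vA ->].
have v4 : v \in rotK 4 by apply: subsetP vA; rewrite cycle_subG AK4.
rewrite groupMr // => u4; rewrite (s3_triv us) ?mul1g // -K14 inE u4 andbT.
by apply: subsetP us; rewrite cycle_subG s3K1.
Qed.

Lemma K34 : rotK 3 :&: rotK 4 = <[s1]>.
Proof.
apply/eqP; rewrite eqEsubset cycle_subG inE s1K3 s1K4 !andbT.
apply/subsetP=> g /setIP[]; rewrite K3E => /mulsgP[u v us vB ->].
have u4 : u \in rotK 4 by apply: subsetP us; rewrite cycle_subG s1K4.
rewrite groupMl //; case: (mem_cycle2 B_sqr vB) => -> ; first by rewrite mulg1.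
by rewrite (negPf B_K4).
Qed.

Lemma K12 : rotK 1 :&: rotK 2 = <[s3]>.
Proof.
apply/eqP; rewrite eqEsubset cycle_subG inE s3K1 s3K2 !andbT.
apply/subsetP=> g /setIP[g1]; rewrite K2E => /mulsgP[u v us vA E]; move: g1; rewrite E.
have u1 : u \in rotK 1 by apply: subsetP us; rewrite cycle_subG s3K1.
rewrite groupMl //; case: (mem_cycle2 S12 vA) => -> ; first by rewrite mulg1.
by rewrite (negPf A_K1).
Qed.

Lemma K13 : rotK 1 :&: rotK 3 = <[B]>.
Proof.
apply/eqP; rewrite eqEsubset cycle_subG inE BK1 BK3 !andbT.
apply/subsetP=> g /setIP[g1]; rewrite K3E => /mulsgP[u v us vB E]; move: g1; rewrite E.
have v1 : v \in rotK 1 by apply: subsetP vB; rewrite cycle_subG BK1.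
rewrite groupMr // => u1; rewrite (s1_triv us) ?mul1g // -K14 inE u1 /=.
by apply: subsetP us; rewrite cycle_subG s1K4.
Qed.

Lemma B_s3 : B \notin <[s3]>.
Proof. by apply: contra s2_s3; rewrite groupMr ?cycle_id. Qed.

Lemma A_s1 : A \notin <[s1]>.
Proof. by apply: contra s2_s1; rewrite groupMl ?cycle_id. Qed.

Lemma K23 : rotK 2 :&: rotK 3 = <[C]>.
Proof.
apply/eqP; rewrite eqEsubset cycle_subG inE CK2 CK3 !andbT.
apply/subsetP=> g /setIP[]; rewrite K2E' => /mulsgP[u v us vC ->].
have v3 : v \in rotK 3 by apply: subsetP vC; rewrite cycle_subG CK3.
rewrite groupMr // => u3; have : u \in <[B]>.
  by rewrite -K13 inE u3 andbT; apply: subsetP us; rewrite cycle_subG s3K1.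
case/(mem_cycle2 B_sqr) => uE; first by rewrite uE mul1g.
by case/negP: B_s3; rewrite -uE.
Qed.

Lemma rotK_factor i j k : (i < j < k)%N -> (k <= 5)%N ->
  rotK j \subset (rotK j :&: rotK i) * (rotK j :&: rotK k).
Proof.
have sub5 l : rotK l \subset rotK 5 := rotK_sub l.
have l0 j' k' : rotK j' \subset (rotK j' :&: rotK 0) * (rotK j' :&: rotK k').
  by rewrite (setIidPl (rotK_sub j')) mulG_subl.
have r5 j' i' : rotK j' \subset (rotK j' :&: rotK i') * (rotK j' :&: rotK 5).
  by rewrite (setIidPl (sub5 j')) mulG_subr.
case: i => [|i]; first by move=> _ _; apply: l0.
case/andP=> ij jk k5; have [->|k5'] := eqVneq k 5; first exact: r5.
case: i j k ij jk k5 k5' => [|[|[|[|i]]]] [|[|[|[|[|j]]]]] [|[|[|[|[|[|k]]]]]] // _ _ _ _.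
- by rewrite (setIC (rotK 2)) K12 K23 -K2E'.
- by rewrite (setIC (rotK 2)) K12 K24 -K2E.
- have K3c : rotK 3 = <[B]> * <[s1]> :> {set gT}.
    have gs : group_set (<[s1]> * <[B]>) by rewrite -K3E groupP.
    by rewrite K3E; apply: (comm_group_setP gs).
  by rewrite (setIC (rotK 3)) K13 K34 -K3c.
- have K3c : rotK 3 = <[C]> * <[s1]> :> {set gT}.
    have gs : group_set (<[s1]> * <[C]>) by rewrite -K3E' groupP.
    by rewrite K3E'; apply: (comm_group_setP gs).
  by rewrite (setIC (rotK 3)) K23 K34 -K3c.
Qed.

Lemma rotK_diamond i : (i < 4)%N -> exists y,
  [/\ y \in rotK i :&: rotK i.+2, y \notin rotK i.+1 &
      rotK i :&: rotK i.+2 \subset rotK i.+1 :|: rotK i.+1 :* y].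
Proof.
case: i => [|[|[|[|//]]]] _.
- exists A; rewrite (setIidPr (rotK_sub 2)) AK2 A_K1; split=> //.
  apply/subsetP=> g; rewrite {1}K2E => /mulsgP[u v us vA ->]; rewrite inE mem_rcoset.
  have u1 : u \in rotK 1 by apply: subsetP us; rewrite cycle_subG s3K1.
  by case: (mem_cycle2 S12 vA) => ->; rewrite ?mulg1 ?mulgK u1 ?orbT.
- exists B; rewrite K13 cycle_id; split=> //.
    by apply: contra B_s3 => h; rewrite -K12 inE BK1.
  apply/subsetP=> g /(mem_cycle2 B_sqr)[]->; rewrite inE ?group1 //.
  by rewrite rcoset_refl orbT.
- exists A; rewrite K24 cycle_id; split=> //.
    by apply: contra A_s1 => h; rewrite -K34 inE h AK4.
  apply/subsetP=> g /(mem_cycle2 S12)[]->; rewrite inE ?group1 //.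
  by rewrite rcoset_refl orbT.
- exists B; rewrite (setIidPl (rotK_sub 3)) BK3 B_K4; split=> //.
  apply/subsetP=> g; rewrite {1}K3E => /mulsgP[u v us vB ->]; rewrite inE mem_rcoset.
  have u1 : u \in rotK 4 by apply: subsetP us; rewrite cycle_subG s1K4.
  by case: (mem_cycle2 B_sqr vB) => ->; rewrite ?mulg1 ?mulgK u1 ?orbT.
Qed.

Lemma rota_mem i : rota i \in rotK 0.
Proof.
have [m1 m2 m3] := s_mem.
by case: i => [|[|[|[|[|i]]]]] /=; rewrite ?group1 ?groupM.
Qed.

Lemma rota_E : [/\ (rota 1)^-1 * rota 2 = s1, (rota 1)^-1 * rota 3 = A, (rota 1)^-1 * rota 4 = C &
  [/\ (rota 2)^-1 * rota 3 = s2, (rota 2)^-1 * rota 4 = B & (rota 3)^-1 * rota 4 = s3]].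
Proof. by rewrite /= invg1 !mul1g -(mulgA s1) !mulKg (mulgA s1) mulKg. Qed.

Lemma rota_K i j l : proper_rank i -> proper_rank j -> proper_rank l ->
  l != i -> l != j -> (rota i)^-1 * rota j \in rotK l.
Proof.
have [E12 E13 E14 [E23 E24 E34]] := rota_E.
have lt i' j' : proper_rank i' -> proper_rank j' -> proper_rank l ->
    l != i' -> l != j' -> (i' < j')%N -> (rota i')^-1 * rota j' \in rotK l.
  case: i' => [|[|[|[|[|i']]]]] //; case: j' => [|[|[|[|[|j']]]]] // _ _;
  rewrite ?E12 ?E13 ?E14 ?E23 ?E24 ?E34; case: l => [|[|[|[|[|l]]]]] // _ _ _ _;
  by rewrite ?s2K1 ?s3K1 ?AK2 ?s3K2 ?s1K3 ?BK3 ?s1K4 ?s2K4 ?BK1 ?AK4 ?CK2 ?CK3.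
move=> pi pj pl li lj; case: (ltngtP i j) => [ij|ji|->].
- exact: lt.
- by rewrite -groupV invMg invgK; apply: lt.
- by rewrite mulVg group1.
Qed.

Lemma rota2 : rota 2 \in rotK 2 * rotK 1.
Proof.
have -> : rota 2 = A * s2^-1 by rewrite mulgK.
exact: mem_mulg AK2 (groupVr s2K1).
Qed.

Lemma s1_K1 : s1 \notin rotK 1.
Proof. by apply: contra s1_s2 => h; rewrite -K14 inE h s1K4. Qed.

(** Sixteen cases for [J]. With three or four indices in [J], [g] is trivial; with two, it is a
    power of the only generator left; with one or none, the stabiliser is generated by the
    admissible products by definition. *)
Lemma rota_gen (J : pred nat) g : g \in rotK 0 ->
    (forall j, proper_rank j -> J j -> g \in rotK j) ->
  g \in <<[set y | [exists i : 'I_6, exists j : 'I_6,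
      [&& proper_rank i, proper_rank j, ~~ J i, ~~ J j & y == (rota i)^-1 * rota j]]]>>.
Proof.
move=> g0 gJ; set T := [set y | _].
have inT (i j : nat) : proper_rank i -> proper_rank j -> J i = false -> J j = false ->
    (rota i)^-1 * rota j \in <<T>>.
  move=> pi pj Ji Jj; apply: mem_gen; rewrite inE.
  have lt6 k : proper_rank k -> (k < 6)%N by case/andP=> _; apply: ltnW.
  apply/existsP; exists (Ordinal (lt6 i pi)); apply/existsP; exists (Ordinal (lt6 j pj)).
  by rewrite /= pi pj Ji Jj eqxx.
have [E12 E13 E14 [E23 E24 E34]] := rota_E.
have T12 := inT 1%N 2%N isT isT; have T13 := inT 1%N 3%N isT isT.
have T14 := inT 1%N 4%N isT isT; have T23 := inT 2%N 3%N isT isT.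
have T24 := inT 2%N 4%N isT isT; have T34 := inT 3%N 4%N isT isT.
rewrite {}E12 in T12; rewrite {}E13 in T13; rewrite {}E14 in T14.
rewrite {}E23 in T23; rewrite {}E24 in T24; rewrite {}E34 in T34.
have g1 := gJ 1%N isT; have g2 := gJ 2%N isT; have g3 := gJ 3%N isT; have g4 := gJ 4%N isT.
have c12 : g \in rotK 1 -> g \in rotK 2 -> g \in <[s3]> by rewrite -K12 inE => -> ->.
have c13 : g \in rotK 1 -> g \in rotK 3 -> g \in <[B]> by rewrite -K13 inE => -> ->.
have c14 : g \in rotK 1 -> g \in rotK 4 -> g \in <[s2]> by rewrite -K14 inE => -> ->.
have c23 : g \in rotK 2 -> g \in rotK 3 -> g \in <[C]> by rewrite -K23 inE => -> ->.
have c24 : g \in rotK 2 -> g \in rotK 4 -> g \in <[A]> by rewrite -K24 inE => -> ->.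
have c34 : g \in rotK 3 -> g \in rotK 4 -> g \in <[s1]> by rewrite -K34 inE => -> ->.
have cyc y : y \in <<T>> -> g \in <[y]> -> g \in <<T>>.
  by move=> yT; apply: subsetP; rewrite cycle_subG.
have gen (Y : {set gT}) : g \in <<Y>> -> Y \subset <<T>> -> g \in <<T>>.
  by move=> gY YT; apply: (subsetP _ g gY); rewrite gen_subG.
have one : g = 1 -> g \in <<T>> by move->; apply: group1.
have t123 : g \in rotK 1 -> g \in rotK 2 -> g \in rotK 3 -> g \in <<T>>.
  move=> h1 h2 h3; apply: one; have [//|E] := mem_cycle2 B_sqr (c13 h1 h3).
  by case/negP: B_s3; rewrite -E c12.
have t124 : g \in rotK 1 -> g \in rotK 2 -> g \in rotK 4 -> g \in <<T>>.
  by move=> h1 h2 h4; apply: one; apply: s3_triv; [apply: c12|apply: c14].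
have t134 : g \in rotK 1 -> g \in rotK 3 -> g \in rotK 4 -> g \in <<T>>.
  by move=> h1 h3 h4; apply: one; apply: s1_triv; [apply: c34|apply: c14].
have t234 : g \in rotK 2 -> g \in rotK 3 -> g \in rotK 4 -> g \in <<T>>.
  move=> h2 h3 h4; apply: one; have [//|E] := mem_cycle2 S12 (c24 h2 h4).
  by case/negP: A_s1; rewrite -E c34.
case J1: (J 1%N) g1 T12 T13 T14 => g1 T12 T13 T14;
case J2: (J 2%N) g2 T12 T23 T24 => g2 T12 T23 T24;
case J3: (J 3%N) g3 T13 T23 T34 => g3 T13 T23 T34;
case J4: (J 4%N) g4 T14 T24 T34 => g4 T14 T24 T34.
- by apply: t123; rewrite (g1, g2, g3).
- by apply: t123; rewrite (g1, g2, g3).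
- by apply: t124; rewrite (g1, g2, g4).
- by apply: (cyc s3); [apply: T34|apply: c12; rewrite (g1, g2)].
- by apply: t134; rewrite (g1, g3, g4).
- by apply: (cyc B); [apply: T24|apply: c13; rewrite (g1, g3)].
- by apply: (cyc s2); [apply: T23|apply: c14; rewrite (g1, g4)].
- by apply: (gen [set s2; s3]); [apply: g1|apply/subsetP=> y /set2P[]->; rewrite (T23, T34)].
- by apply: t234; rewrite (g2, g3, g4).
- by apply: (cyc C); [apply: T14|apply: c23; rewrite (g2, g3)].
- by apply: (cyc A); [apply: T13|apply: c24; rewrite (g2, g4)].
- by apply: (gen [set A; s3]); [apply: g2|apply/subsetP=> y /set2P[]->; rewrite (T13, T34)].
- by apply: (cyc s1); [apply: T12|apply: c34; rewrite (g3, g4)].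
- by apply: (gen [set s1; B]); [apply: g3|apply/subsetP=> y /set2P[]->; rewrite (T12, T24)].
- by apply: (gen [set s1; s2]); [apply: g4|apply/subsetP=> y /set2P[]->; rewrite (T12, T23)].
- by apply: (gen [set s1; s2; s3]); [exact: g0|apply/subsetP=> y /setUP[/set2P[]|/set1P]->; rewrite (T12, T23, T34)].
Qed.

Definition rot_geometry : coset_geometry :=
  @CosetGeometry gT (rotK 0) rotK rota rotK_sub erefl erefl rotK_factor rotK_diamond erefl
    rota_mem rota_K rota2 s1_K1 rota_gen.

Lemma rot_Kd i : (i <= 5)%N -> rotK i :^ d = rotK (5 - i).
Proof.
have d1 := rd_d1 rd; have d2 := rd_d2 rd; have d3 := rd_d3 rd.
have dA : A ^ d = B^-1 by rewrite conjMg d1 d2 -invMg.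
have dB : B ^ d = A^-1 by rewrite conjMg d2 d3 -invMg.
have genV (g h : gT) : <<[set g^-1; h^-1]>> = <<[set h; g]>>.
  apply/eqP; rewrite eqEsubset !gen_subG; apply/andP; split; apply/subsetP=> y.
    by have [m1 m2] := gen2 h g; case/set2P=> ->; rewrite groupV.
  by have [m1 m2] := gen2 g^-1 h^-1; rewrite !groupV in m1 m2; case/set2P=> ->.
have conj2 (g h : gT) : <<[set g; h]>> :^ d = <<[set g ^ d; h ^ d]>>.
  by rewrite -genJ conjUg !conjg_set1.
have conj3 : rotK 0 :^ d = rotK 0.
  rewrite -genJ !conjUg !conjg_set1 d1 d2 d3; apply/eqP; rewrite eqEsubset !gen_subG.
  have [m1 m2 m3] := s_mem; apply/andP; split; apply/subsetP=> y.
    by case/setUP=> [/set2P[]|/set1P]->; rewrite groupV.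
  by case/setUP=> [/set2P[]|/set1P]->; rewrite -groupV mem_gen // !inE eqxx ?orbT.
case: i => [|[|[|[|[|[|//]]]]]] _ //=.
- by rewrite conj2 d2 d3 genV.
- by rewrite conj2 dA d3 genV.
- by rewrite conj2 d1 dB genV.
- by rewrite conj2 d1 d2 genV.
Qed.

Lemma rot_facets u : (forall v, L v <-> in_lattice u v) ->
  forall Fc : coset_polytope rot_geometry, rank Fc = (4%:Z - 1)%R ->
  order_iso (fun y z : {y : coset_polytope rot_geometry | (y <= Fc)%O} =>
    (sval y <= sval z)%O) (@map36 u).
Proof.
move=> Lu; apply: (@coset_facets rot_geometry q x u hex).
- exact: K4E.
- by rewrite invgK; apply: K14.
- by rewrite invgK rot3_s1; apply: K24.
- by rewrite rot3_s1; apply: K34.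
- move=> v k E; split; first exact: elt6 E.
  apply/Lu; have [] := @eltL v k 0%R 0; rewrite ?subr0 //.
  by rewrite E /elt tr0 expg0 mulg1.
- by move=> v /Lu/(rd_tr rd).
Qed.

(** On translations [alpha] is the reflection parallel to the base edge, which takes 1 to -1 and [w]
    to [w ^ 2 = w - 1]. It is enough to compute the images of [x] and [x ^ q] in normal form. *)
Lemma mirrored_tr : mirrored rot_geometry -> exists alpha : gT -> gT,
  [/\ {in rotK 0 &, {morph alpha : g h / g * h}},
      forall g, g \in rotK 0 -> exists2 h, h \in rotK 0 & alpha h = g
    & forall v, alpha (tr q x v) = tr q x (- v.1 - v.2, v.2)%R].
Proof.
case=> al [alM alG alE]; exists al.
have [m1 m2 m3] := s_mem; have [E12 E13 E14 [E23 E24 E34]] := rota_E.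
have al1 : al s1 = s1^-1.
  by have := alE 0%N 1%N isT isT; rewrite /= invg1 !mul1g.
have al2 : al s2 = s1 * s2^-1 * s1^-1.
  by have := alE 1%N 2%N isT isT; rewrite /= mulKg invMg mulgA.
have al3 : al s3 = A * s3^-1 * A^-1.
  by have := alE 2%N 3%N isT isT; rewrite [LHS]/= mulKg /= !invMg !mulgA.
have al_1 : al 1 = 1 by apply: (mulgI (al 1)); rewrite -alM ?group1 // !mulg1.
have alV g : g \in rotK 0 -> al g^-1 = (al g)^-1.
  by move=> gG; apply: (mulgI (al g)); rewrite mulgV -alM ?groupV // mulgV.
have alX g n : g \in rotK 0 -> al (g ^+ n) = al g ^+ n.
  by move=> gG; elim: n => [|n IH]; rewrite ?expg0 // !expgS alM ?groupX // IH.
have alz g a : g \in rotK 0 -> al (zpow g a) = zpow (al g) a.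
  by move=> gG; case: a => n /=; rewrite ?alV ?alX ?groupX.
have q0 : q \in rotK 0 by rewrite groupV.
have x0 : x \in rotK 0 by rewrite !groupM ?groupX.
have s1E : s1 = elt q x (unit_vec 1) 4 by rewrite -(rot3E hex) rot3_s1.
have qE : q = elt q x 0%R 1 by rewrite /elt tr0 mulg1 expg1.
have s2E : s2 = elt q x 0%R 5.
  have q6 : q ^+ 6 = 1 by case: hex.
  by rewrite /elt tr0 mulg1; apply: (mulgI q); rewrite mulVg -expgS.
have s1V : s1^-1 = s1 * s1 by apply: (mulgI s1); rewrite mulgV -expg2 -expgS S1.
have elt_eq v k w l : v = w -> (k %% 6 = l %% 6)%N -> elt q x v k = elt q x w l.
  by move=> -> kl; rewrite -(elt_mod6 hex) kl (elt_mod6 hex).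
have alx : al x = elt q x (-1, 0)%R 0.
  (* Stated for variables, because [q] and [x] themselves contain [s2] and [s1], and rewriting would
     expand those occurrences too. *)
  have E a r : a = elt q x (unit_vec 1) 4 -> r = elt q x 0%R 1 ->
    (a * r * (a * a)) ^+ 3 * (a * a) * (a * r * (a * a)) = elt q x (-1, 0)%R 0.
    by move=> -> ->; rewrite expgS expg2 !(eltM hex); apply: elt_eq.
  rewrite alM ?(groupM (groupX 3 m2) m1) // alM ?groupX // alX // al1 al2 s1V.
  exact: (E s1 q s1E qE).
have alq : al q = s1 * s2 * s1^-1 by rewrite alV // al2 !invMg !invgK mulgA.
have alxq : al (x ^ q) = elt q x (-1, 1)%R 0.
  have E a r t : a = elt q x (unit_vec 1) 4 -> r = elt q x 0%R 1 -> t = elt q x 0%R 5 ->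
    (a * r * (a * a)) * (elt q x (-1, 0)%R 0 * (a * t * (a * a))) = elt q x (-1, 1)%R 0.
    by move=> -> -> ->; rewrite !(eltM hex); apply: elt_eq.
  rewrite conjgE invgK alM ?groupM ?groupV // [al (x * q)]alM ?groupV //.
  rewrite alx alq al2 s1V; exact: (E s1 q s2 s1E qE s2E).
split=> //.
- have [I IE] : exists I : {group gT}, forall y, y \in I <-> exists2 h, h \in rotK 0 & al h = y.
    have gs : group_set (al @: rotK 0).
      apply/group_setP; split=> [|_ _ /imsetP[g gG ->] /imsetP[h hG ->]].
        by apply/imsetP; exists 1; rewrite ?group1.
      by rewrite -alM // imset_f // groupM.
    exists (Group gs) => y; split=> [/imsetP[h hG ->]|[h hG <-]]; last exact: imset_f.
    by exists h.
  (* Each image is the inverse of a generator conjugated by a word in the preceding ones, so the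
     generators are found in the image one after another. *)
  have I1 : s1 \in I by rewrite -groupV; apply/IE; exists s1.
  have I2 : s2 \in I.
    have : al s2 \in I by apply/IE; exists s2.
    by rewrite al2 groupMr ?groupV // groupMl // groupV.
  have I3 : s3 \in I.
    have AI := groupM I1 I2; have : al s3 \in I by apply/IE; exists s3.
    by rewrite al3 groupMr ?groupV // groupMl // groupV.
  move=> g gG; apply/IE; move: gG; apply/subsetP; rewrite gen_subG; apply/subsetP=> y.
  by case/setUP=> [/set2P[]|/set1P]->.
move=> v; have trz w a : zpow (tr q x w) a = tr q x (w *~ a)%R.
  have natc w' n : tr q x w' ^+ n = tr q x (w' *+ n)%R.
    by elim: n => [|n IH]; rewrite ?expg0 ?tr0 // expgS IH -trD // mulrS.
  case: a => n /=; first by rewrite natc pmulrn.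
  by rewrite natc -trN // NegzE mulrNz -pmulrn.
have z0 y a : y \in rotK 0 -> zpow y a \in rotK 0 by apply: zpow_mem.
rewrite {1}/tr alM ?z0 ?groupJ // !alz ?groupJ // alx alxq /elt expg0 !mul1g !trz -trD //.
by congr tr; rewrite !mulpE addpE; congr pair; clear; lia.
Qed.

End FromRotations.

(** * Products of rotation groups *)

Lemma morph_tr (aT bT : finGroupType) (f : {morphism [set: aT] >-> bT}) q x v :
  f (tr q x v) = tr (f q) (f x) v.
Proof.
have fz y a : f (zpow y a) = zpow (f y) a.
  by case: a => n /=; rewrite ?morphV ?morphX ?in_setT.
by rewrite /tr morphM ?in_setT // !fz morphJ ?in_setT.
Qed.

Section ProductGroups.
Variables (aT bT : finGroupType).

Lemma pair_ext (g h : aT * bT) : g.1 = h.1 -> g.2 = h.2 -> g = h.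
Proof. by case: g h => [a b] [a' b'] /= -> ->. Qed.

Lemma tr_fst (q x : aT * bT) v : (tr q x v).1 = tr q.1 x.1 v.
Proof. exact: (morph_tr [morphism of (@fst aT bT)]). Qed.

Lemma tr_snd (q x : aT * bT) v : (tr q x v).2 = tr q.2 x.2 v.
Proof. exact: (morph_tr [morphism of (@snd aT bT)]). Qed.

Lemma elt_fst (q x : aT * bT) v k : (elt q x v k).1 = elt q.1 x.1 v k.
Proof.
rewrite /elt -tr_fst -[LHS]/([morphism of (@fst aT bT)] _).
by rewrite morphM ?in_setT // morphX ?in_setT.
Qed.

Lemma hex_action_prod (q x : aT * bT) :
  hex_action q.1 x.1 -> hex_action q.2 x.2 -> hex_action q x.
Proof.
by case=> [A1 A2 A3] [B1 B2 B3]; split; apply: pair_ext.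
Qed.

Lemma gen_proj (D : {set aT * bT}) g : g \in <<D>> ->
  g.1 \in <<[set y.1 | y in D]>> /\ g.2 \in <<[set y.2 | y in D]>>.
Proof.
move=> gD; split.
  have := mem_morphim [morphism of (@fst aT bT)] (in_setT g) gD.
  by rewrite morphim_gen ?subsetT // morphimEsub ?subsetT.
have := mem_morphim [morphism of (@snd aT bT)] (in_setT g) gD.
by rewrite morphim_gen ?subsetT // morphimEsub ?subsetT.
Qed.

(** The relations hold coordinatewise. A translation in the group generated by pairs projects into
    both vertex groups, so [rd_vertex] is inherited, with the intersection of the two lattices. *)
Lemma rotation_data_prod s1 s2 s3 d L t1 t2 t3 e M :
  rotation_data s1 s2 s3 d L -> rotation_data t1 t2 t3 e M ->
  @rotation_data (aT * bT)%type (s1, t1) (s2, t2) (s3, t3) (d, e) (fun v => L v /\ M v).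
Proof.
case=> [A1 A2 A3 A4 A5 A6 A7 A8 A9] [B1 B2 B3 B4 B5 B6 B7 B8 B9].
split; try by apply: pair_ext.
- exact: hex_action_prod.
- move=> v; split=> [E|[/A5 E1 /B5 E2]].
    by split; [apply/A5|apply/B5]; rewrite -1?[1]/(1 : aT * bT).1 -1?[1]/(1 : aT * bT).2 -E ?tr_fst ?tr_snd.
  by apply: pair_ext; rewrite ?tr_fst ?tr_snd.
- move=> v /gen_proj[]; rewrite !imsetU1 !imset_set1 tr_fst tr_snd => /A6 ? /B6 ?.
  by split.
Qed.

Variables (A : {group aT}) (B : {group bT}).
Hypothesis simpleA : forall N : {group aT}, N \subset A -> A \subset 'N(N) ->
  N :!=: 1 -> A \subset N.
Hypothesis AB : ~~ (#|A| %| #|B|)%N.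

(** The elements of [G] with trivial second coordinate project onto a normal subgroup [K] of [A]. If
    [K] is trivial, [G] embeds in [B], and the order of its image [A] divides that of [B]; otherwise
    [K] is [A], and [G] contains [A] as a factor. *)
Lemma goursat_simple (G : {group aT * bT}) :
  fst @* G = A -> snd @* G = B -> G = setX A B :> {set _}.
Proof.
move=> GA GB; pose K := [group of fst @* 'ker_G (@snd aT bT)].
have KP y : y \in K -> (y, 1) \in G.
  case/morphimP=> [[z1 z2]] _ /setIP[zG zK] ->.
  by move: zK => /(kerP _ (in_setT _)) /= z2E; rewrite -z2E.
have KA : K \subset A by rewrite -GA morphimS // subsetIl.
have nKA : A \subset 'N(K).
  by rewrite -GA morphim_norms // normsI ?normG // (subset_trans (subsetT _)) ?ker_norm.
have GP g : g \in G -> (g.1 \in A) /\ (g.2 \in B).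
  move=> gG; split; first by rewrite -GA; apply: (mem_morphim [morphism of fst]); rewrite ?in_setT.
  by rewrite -GB; apply: (mem_morphim [morphism of snd]); rewrite ?in_setT.
have [K1|] := eqVneq (K :&: setT) 1.
  case/negP: AB; have iG : 'injm (restrm (subsetT G) [morphism of (@snd aT bT)]).
    rewrite ker_restrm; apply/subsetP=> [[z1 z2]] /setIP[zG zK]; rewrite inE.
    have : z1 \in K by apply/morphimP; exists (z1, z2); rewrite ?in_setT // inE zG.
    move: K1; rewrite setIT => ->; rewrite inE => /eqP ->.
    by move: zK => /(kerP _ (in_setT _)) /= ->.
  have := card_injm iG (subxx G); rewrite morphim_restrm setIid GB => ->.
  by rewrite -GA; apply: dvdn_morphim.
rewrite setIT => K1; have AK := simpleA KA nKA K1.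
apply/eqP; rewrite eqEsubset; apply/andP; split; apply/subsetP=> [[g1 g2]].
  by case/GP=> /= g1A g2B; rewrite !inE /= g1A.
rewrite !inE /= => /andP[g1A]; rewrite -GB => /morphimP[[h1 h2]] _ hG /= ->.
have [/= h1A _] := GP _ hG.
have -> : (g1, h2) = ((g1 * h1^-1, 1) : aT * bT) * (h1, h2).
  by apply: pair_ext; rewrite /= ?mulgKV ?mul1g.
by rewrite groupM // KP // (subsetP AK) // groupM ?groupV.
Qed.

(** As [alpha] is onto, the image of the factor [B] is normal and projects to a normal subgroup of
    [A]. The order of this subgroup divides that of [B], so it is not [A], and it must be
    trivial. *)
Lemma simple_cofactor_stable (alpha : aT * bT -> aT * bT) :
  {in setX A B &, {morph alpha : g h / g * h}} ->
  (forall g, g \in setX A B -> exists2 h, h \in setX A B & alpha h = g) ->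
  forall y, y \in B -> (alpha (1, y)).1 = 1.
Proof.
move=> aM aS; pose al := Morphism aM.
have aG : al @* setX A B = setX A B.
  apply/esym/eqP; rewrite eqEcard leq_morphim andbT; apply/subsetP=> g gG.
  by have [h hG <-] := aS g gG; apply: mem_morphim.
have B1 : setX 1 B \subset setX A B by apply: setXS; rewrite ?sub1G.
have nB1 : setX A B \subset 'N(setX 1 B).
  apply/subsetP=> [[g1 g2]]; rewrite !inE /= => /andP[g1A g2B].
  apply/subsetP=> ? /imsetP[[h1 h2]]; rewrite !inE /= => /andP[/eqP-> h2B] ->.
  by apply/andP; split; [apply/eqP/conj1g|apply: groupJ].
pose N := [group of fst @* (al @* setX 1 B)].
have fA : fst @* setX A B = A by rewrite morphim_fstX.
have aB1 : al @* setX 1 B \subset setX A B by apply: subset_trans (morphimS al B1) _; rewrite aG.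
have anB1 : setX A B \subset 'N(al @* setX 1 B).
  by apply: subset_trans (morphim_norms al nB1); rewrite aG.
have NA : N \subset A by rewrite -fA morphimS.
have nNA : A \subset 'N(N) by rewrite -fA morphim_norms.
have N1 : N :==: 1.
  apply/negPn/negP=> N1; case/negP: AB.
  have -> : A :=: N by apply/eqP; rewrite eqEsubset NA simpleA.
  have -> : #|B| = #|setX (1 : {set aT}) B|.
    by apply: esym; apply: etrans (cardsX _ _) _; rewrite cards1 mul1n.
  apply: (dvdn_trans (dvdn_morphim _ _)); exact: dvdn_morphim.
move=> y yB; suff: (alpha (1, y)).1 \in N by rewrite (eqP N1) => /set1P.
have y1 : ((1, y) : aT * bT) \in setX (1 : {set aT}) B by apply/setXP; rewrite group1.
by apply: (mem_morphim [morphism of fst]); rewrite ?in_setT //; apply: (mem_morphim al); rewrite ?(subsetP B1).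
Qed.

End ProductGroups.

Local Close Scope group_scope.
Local Open Scope ring_scope.

(** * The translation lattices of the two factors and their intersection *)

Lemma in_lattice_m0 (m : int) (v : point) :
  in_lattice (m, 0) v <-> (m %| v.1)%Z /\ (m %| v.2)%Z.
Proof.
case: v => v1 v2; split=> [[r [s]]|[/dvdzP[r /= ->] /dvdzP[s ->]]].
  rewrite !mulpE /= => -[-> ->]; rewrite !oppr0 !mul0r !addr0 !add0r.
  by rewrite !dvdz_mulr.
by exists r, s; rewrite /rot60 /= !mulpE addpE; congr pair; ring.
Qed.

Section Lattice.
Variables (p b c : nat) (m : int).
Hypotheses (p_prime : prime p) (b_gt0 : (0 < b)%N) (c_gt0 : (0 < c)%N)
  (p_eq : p = (b ^ 2 + b * c + c ^ 2)%N).

Let L (v : point) : Prop := (p%:Z %| c%:Z * v.1 - b%:Z * v.2)%Z.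

Lemma pZ_eq : p%:Z = b%:Z ^+ 2 + b%:Z * c%:Z + c%:Z ^+ 2.
Proof. by rewrite p_eq !PoszD !PoszM !expr2 -!PoszM. Qed.

Lemma Euclid_dvdzM (x y : int) : (p%:Z %| x * y)%Z = (p%:Z %| x)%Z || (p%:Z %| y)%Z.
Proof. by rewrite !dvdzE abszM Euclid_dvdM. Qed.

Lemma p_ndvd_c : ~~ (p%:Z %| c%:Z)%Z.
Proof.
rewrite dvdzE /=; apply/negP=> /(dvdn_leq c_gt0); rewrite p_eq; apply/negP; rewrite -ltnNge.
by move: b_gt0 c_gt0; clear; nia.
Qed.

Lemma p_ndvd_3 : p = 1 %[mod 12] -> ~~ (p%:Z %| 3)%Z.
Proof.
move=> p1; apply/negP; rewrite dvdzE /= => /dvdn_leq p3.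
by have := p3 isT; move: p1 (prime_gt1 p_prime); clear; lia.
Qed.

Lemma lattice_unit : ~ L (1, 0).
Proof. by rewrite /L /= mulr1 mulr0 subr0; apply/negP/p_ndvd_c. Qed.

Lemma lattice_bc : L (b%:Z, c%:Z).
Proof. by rewrite /L /= mulrC subrr dvdz0. Qed.

(* [4 p = (2 b + c) ^ 2 + 3 c ^ 2]. *)
Lemma lattice_bc_mirror : p = 1 %[mod 12] -> ~ L (- b%:Z - c%:Z, c%:Z).
Proof.
move=> p1; rewrite /L /=.
have -> : c%:Z * (- b%:Z - c%:Z) - b%:Z * c%:Z = - (c%:Z * (2 * b%:Z + c%:Z)) by ring.
rewrite rpredN Euclid_dvdzM (negPf p_ndvd_c) /= => pd.
have : (p%:Z %| 3 * (c%:Z * c%:Z))%Z.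
  have -> : 3 * (c%:Z * c%:Z) = 4 * p%:Z - (2 * b%:Z + c%:Z) * (2 * b%:Z + c%:Z).
    by rewrite pZ_eq; ring.
  by rewrite rpredB // ?dvdz_mull // dvdz_mulr.
by rewrite !Euclid_dvdzM !(negPf p_ndvd_c) !orbF; apply/negP/p_ndvd_3.
Qed.

Lemma lattice_dvd v : (p%:Z %| m)%Z ->
  (L v /\ in_lattice (m, 0) v) <-> in_lattice (m, 0) v.
Proof.
move=> pm; split=> [[]//|vm]; split=> //; move/in_lattice_m0: vm => [m1 m2].
by rewrite /L rpredB // dvdz_mull // (dvdz_trans pm).
Qed.

(** In the Eisenstein integers [b + c w] has norm [p], and [x1 + x2 w] times its conjugate
    [b + c - c w] is [x1 (b + c) + x2 c - (c x1 - b x2) w]. Since [p] does not divide [m], it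
    divides the second coefficient, and then also the first. With the quotients [k] and [l],
    [x1 + x2 w] equals [(b + c w) (l - k w)], whence the witnesses [l] and [- k]. *)
Lemma lattice_ndvd v : ~~ (p%:Z %| m)%Z ->
  (L v /\ in_lattice (m, 0) v) <-> in_lattice (m * b%:Z, m * c%:Z) v.
Proof.
move=> pm; case: v => v1 v2; split.
  rewrite /L => -[/= pd /in_lattice_m0[/= /dvdzP[x1 E1] /dvdzP[x2 E2]]].
  have : (p%:Z %| (c%:Z * x1 - b%:Z * x2) * m)%Z.
    by rewrite E1 E2 !mulrA -mulrBl in pd.
  rewrite Euclid_dvdzM (negPf pm) orbF => /dvdzP[k kE].
  have c0 : c%:Z != 0 by rewrite eqz_nat -lt0n.
  have p0 : p%:Z != 0 by rewrite eqz_nat -lt0n prime_gt0.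
  have : (p%:Z %| c%:Z * (x1 * (b%:Z + c%:Z) + x2 * c%:Z))%Z.
    apply/dvdzP; exists (x2 + k * (b%:Z + c%:Z)).
    have -> : c%:Z * (x1 * (b%:Z + c%:Z) + x2 * c%:Z)
      = (c%:Z * x1 - b%:Z * x2) * (b%:Z + c%:Z)
        + x2 * (b%:Z ^+ 2 + b%:Z * c%:Z + c%:Z ^+ 2) by ring.
    by rewrite kE -pZ_eq; ring.
  rewrite Euclid_dvdzM (negPf p_ndvd_c) /= => /dvdzP[l lE].
  have clE : c%:Z * l = x2 + k * (b%:Z + c%:Z).
    apply: (mulIf p0); rewrite -mulrA -lE.
    have -> : c%:Z * (x1 * (b%:Z + c%:Z) + x2 * c%:Z)
      = (c%:Z * x1 - b%:Z * x2) * (b%:Z + c%:Z)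
        + x2 * (b%:Z ^+ 2 + b%:Z * c%:Z + c%:Z ^+ 2) by ring.
    by rewrite kE -pZ_eq; ring.
  have x2E : x2 = c%:Z * l - k * (b%:Z + c%:Z) by rewrite clE addrK.
  have x1E : x1 = b%:Z * l + c%:Z * k.
    apply: (mulfI c0); have -> : c%:Z * x1 = k * p%:Z + b%:Z * x2 by rewrite -kE subrK.
    by rewrite x2E pZ_eq; ring.
  by exists l, (- k); rewrite /rot60 /= !mulpE addpE E1 E2 x1E x2E; congr pair; ring.
case=> r [s]; rewrite !mulpE addpE /= => -[-> ->]; split.
  rewrite /L /=; apply/dvdzP; exists (- (m * s)); rewrite pZ_eq; ring.
apply/in_lattice_m0; split; apply/dvdzP => /=.
  by exists (b%:Z * r - c%:Z * s); ring.
by exists (c%:Z * r + (b%:Z + c%:Z) * s); ring.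
Qed.

End Lattice.

Lemma Gamma_plus_sub (n : nat) (P : polytope n) (F : {set P}) :
  Gamma_plus F \subset Gamma P.
Proof.
have rG i : rho F i \in Gamma P.
  by rewrite /rho; case: pickP => [g /andP[]|_] //=; apply: group1.
by rewrite gen_subG; apply/subsetP=> _ /imsetP[i _ ->]; apply: groupM.
Qed.

Theorem theorem8p2 (p b c : nat) (m : int) (Q : polytope 4) (Phi : {set Q})
    (p_prime : prime p) (p_mod12 : p = 1 %[mod 12])
    (b_gt0 : (0 < b)%N) (c_gt0 : (0 < c)%N)
    (p_eq : p = (b ^ 2 + b * c + c ^ 2)%N)
    (m_odd : ~~ (2 %| m)%Z) (m_not3 : ~~ (3 %| m)%Z)
    (Phi_flag : flag Phi)
    (Q_self_dual : self_dual Q)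
    (Q_directly_regular : directly_regular Phi)
    (Q_type : has_type Q (@map36 (m, 0)) (@map63 (m, 0)))
    (Q_order : ~~ (p * (p ^ 2 - 1) %| #|Gamma Q|)%N) :
  exists P : polytope 4,
    [/\ chiral P,
        properly_self_dual P,
        Gamma P \isog setX (PSL2 p) (Gamma_plus Phi),
        ((p%:Z %| m)%Z -> has_type P (@map36 (m, 0)) (@map63 (m, 0)))
      & (~~ (p%:Z %| m)%Z ->
           has_type P (@map36 (m * b%:Z, m * c%:Z)) (@map63 (m * b%:Z, m * c%:Z)))].
Proof.
have [regQ index2] := Q_directly_regular; have [facQ _] := Q_type.
have [e rdQ] := regular_rotation_data Phi_flag regQ Q_self_dual facQ.
have [s1 [s2 [s3 [d [rdL genL eltL simpleL divL]]]]] :=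
  PSL2_data p_prime p_mod12 b_gt0 c_gt0 p_eq.
(* [p (p^2 - 1)] divides twice the order of [PSL2 p], and twice the order of [Gamma_plus Phi] is the
   order of [Gamma Q], because [Q] is directly regular. *)
have orderLH : ~~ (#|PSL2 p| %| #|Gamma_plus Phi|)%N.
  apply: contra Q_order => LH; apply: (dvdn_trans divL).
  have Gs : Gamma_plus Phi \subset Gamma Q by exact: Gamma_plus_sub.
  by rewrite -(Lagrange Gs) index2 mulnC dvdn_pmul2r.
have rd := rotation_data_prod rdL rdQ.
set S1 := (s1, _) in rd; set S2 := (s2, _) in rd; set S3 := (s3, _) in rd.
have elt6 v k : elt S2^-1%g (S2 ^+ 3 * S1 * S2)%g v k = 1%g -> (6 %| k)%N.
  by move=> E; apply: (eltL v); have := elt_fst S2^-1%g (S2 ^+ 3 * S1 * S2)%g v k; rewrite E => <-.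
have Lunit : ~ ((p%:Z %| c%:Z * 1 - b%:Z * 0)%Z /\ in_lattice (m, 0) (1, 0)).
  by case=> /(lattice_unit b_gt0 c_gt0 p_eq).
pose X := rot_geometry rd elt6 Lunit.
have GE : rotK S1 S2 S3 0 = setX (PSL2 p) (Gamma_plus Phi) :> {set _}.
  apply: (goursat_simple simpleL orderLH).
    by rewrite morphim_gen ?subsetT // morphimEsub ?subsetT // !imsetU !imset_set1.
  by rewrite /= Gamma_plusE morphim_gen ?subsetT // morphimEsub ?subsetT // !imsetU !imset_set1.
have chirX : ~ mirrored X.
  case/mirrored_tr=> al [alM alS alT]; rewrite GE in alM alS.
  have st := simple_cofactor_stable simpleL orderLH alM alS.
  have L1 := rd_tr rdL; have TG : tr S2^-1%g (S2 ^+ 3 * S1 * S2)%g (b%:Z, c%:Z) \in rotK S1 S2 S3 0.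
    have [m1 m2 _] := s_mem S1 S2 S3.
    by rewrite groupM ?zpow_mem ?groupJ ?groupM ?groupX ?groupV.
  have := alT (b%:Z, c%:Z); move: TG; rewrite GE.
  set T := tr _ _ (b%:Z, c%:Z) => TG.
  have T1 : T.1 = 1%g by rewrite tr_fst; apply/L1; apply: lattice_bc.
  have -> : T = (1%g, T.2) by apply: pair_ext.
  move=> E; have := st T.2; rewrite E tr_fst; case/setXP: TG => _ TB /(_ TB) /L1.
  exact: (lattice_bc_mirror p_prime b_gt0 c_gt0 p_eq).
have Kd (i : 'I_6) : (i <= 5)%N -> (cg_K X i :^ (d, e))%g = cg_K X (5 - i) := fun h => rot_Kd rd h.
have Gd : (cg_G X :^ (d, e))%g = cg_G X := rot_Kd rd (isT : (0 <= 5)%N).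
exists (coset_polytope X); split.
- exact: coset_chiral.
- exact: coset_properly_self_dual Gd Kd chirX.
- by rewrite -GE; apply: Gamma_isog.
- move=> pm; apply: (dual_has_type (psi_duality Gd Kd)).
  by apply: rot_facets => v; apply: lattice_dvd.
- move=> pm; apply: (dual_has_type (psi_duality Gd Kd)).
  by apply: rot_facets => v; apply: lattice_ndvd.
Qed.
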